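(* Let $\tau$ be a genuine smooth admissible irreducible representation of $\widetilde{H(F)}$ and suppose that $\tau$ is unitary. Then $I(\tau,0)=\mathrm{Ind}_{\widetilde{B(F)}}^{\widetilde{SL_2(F)}}\tau$ is reducible if and only if $n$ is odd and the projection of the central character of $\tau$ to $H^d(F)$ is a non-trivial quadratic character.
   Context: Setting. $n\ge 1$ is an integer, $F$ is a $p$-adic field of residual characteristic $p$ with $\gcd(p,n)=1$, and $F^*$ contains the full group $\mu_n$ of $n$-th roots of unity, identified with the $n$-th roots of unity in $\mathbb C^*$. $(\cdot,\cdot):F^*\times F^*\to\mu_n$ is the $n$-th power Hilbert symbol. Put $d=n/\gcd(n,2)$. The cover. In $SL_2(F)$ let $h(a)=\begin{pmatrix}a&0\\0&a^{-1}\end{pmatrix}$, $H(F)=\{h(a):a\in F^*\}$, $N(F)$ the upper triangular unipotent matrices, $B(F)=H(F)\ltimes N(F)$. $\widetilde{SL_2(F)}$ is the set $SL_2(F)\times\mu_n$ with multiplication $(g,\epsilon)(g',\epsilon')=(gg',c(g,g')\epsilon\epsilon')$, where $c(g_1,g_2)=\bigl(x(g_1g_2)x(g_1)^{-1},\,x(g_1g_2)x(g_2)^{-1}\bigr)$ and $x\begin{pmatrix}a&b\\c&d\end{pmatrix}=c$ if $c\ne0$, $=d$ if $c=0$. For $A\subseteq SL_2(F)$, $\widetilde A$ is its preimage in $\widetilde{SL_2(F)}$; $\mathbf s(g)=(g,1)$. A representation of $\widetilde{SL_2(F)}$ or a subgroup is genuine if $(I_2,\epsilon)$ acts by $\epsilon$.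 The center of $\widetilde{H(F)}$ is $\widetilde{H^d(F)}$, where $H^d(F)=\{h(a^d):a\in F^*\}$. When $n$ is odd we have $d=n$, the cover splits over $H^d(F)$ via $\mathbf s$, and the projection of the central character $\chi_\tau$ of $\tau$ to $H^d(F)$ is the character $h\mapsto\chi_\tau(h,1)$ of $H^d(F)$. A non-trivial quadratic character is a character of order exactly $2$. Representations of $\widetilde{H(F)}$ are extended to $\widetilde{B(F)}$ by letting $\mathbf s(N(F))$ act trivially; parabolic induction is normalized. *)

(* Defs.v *)
From HB Require Import structures.
From mathcomp Require Import all_boot all_order all_fingroup all_algebra.
From mathcomp Require Import all_field complex.
From mathcomp Require Import boolp classical_sets functions reals.

Set Implicit Arguments.
Unset Strict Implicit.
Unset Printing Implicit Defensive.

Import Order.TTheory GRing.Theory Num.Theory.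
Local Open Scope classical_set_scope.
Local Open Scope complex_scope.
Local Open Scope ring_scope.

(* A p-adic field: characteristic 0, complete for a normalized discrete
   valuation, with finite residue field of characteristic p.  The residue field
   is given as a finite field with the reduction map on the valuation ring; the
   values of pval at 0 and of pred outside the valuation ring are irrelevant. *)
Definition val_ge (F : fieldType) (v : F -> int) (k : int) (x : F) : Prop :=
  x = 0 \/ k <= v x.

Record is_padic (p : nat) (F : fieldType) (v : F -> int)
    (k : finFieldType) (red : F -> k) : Prop := IsPadic {
  padic_char0 : [pchar F] =i pred0;
  padic_valM : forall x y, x != 0 -> y != 0 -> v (x * y) = v x + v y;
  padic_valD : forall r x y, val_ge v r x -> val_ge v r y -> val_ge v r (x + y);
  padic_unif : exists2 x, x != 0 & v x = 1;
  padic_complete : forall u : nat -> F,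
    (forall r, exists N, forall i j, (N <= i)%N -> (N <= j)%N ->
       val_ge v r (u i - u j)) ->
    exists l, forall r, exists N, forall i, (N <= i)%N -> val_ge v r (u i - l);
  padic_red1 : red 1 = 1;
  padic_redD : forall x y, val_ge v 0 x -> val_ge v 0 y ->
    red (x + y) = red x + red y;
  padic_redM : forall x y, val_ge v 0 x -> val_ge v 0 y ->
    red (x * y) = red x * red y;
  padic_red_surj : forall z, exists2 x, val_ge v 0 x & red x = z;
  padic_red_ker : forall x, val_ge v 0 x -> (red x = 0 <-> val_ge v 1 x);
  padic_residue : p \in [pchar k] }.

Record padicField (p : nat) := PadicField {
  padic_sort :> fieldType;
  pval : padic_sort -> int;
  pres : finFieldType;
  presred : padic_sort -> pres;
  padicP : is_padic p pval presred }.

Section LocalField.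
Variables (p : nat) (F : padicField p).

Definition residue_card : nat := #|pres F|.

Definition vge (k : int) (x : F) : Prop := val_ge (@pval p F) k x.

Definition absF (R : realType) (x : F) : R[i] :=
  if x == 0 then 0 else residue_card%:R ^ (- @pval p F x).

(* The local reciprocity map, as the compatible family of its components
   F^* -> Gal(L/F), L/F finite abelian. *)
Section Extension.
Variable L : splittingFieldType F.

Definition abelian_ext : Prop :=
  galois 1 {:L} /\ abelian 'Gal({:L} / 1).

(* The extension of the valuation of F to L is x |-> pval (N x) / [L : F],
   with N the norm. *)
Definition norm_is (x : L) (c : F) : Prop := galNorm 1 {:L} x = c%:A.

Definition unramified : Prop :=
  forall x c, x != 0 -> norm_is x c -> ((\dim {:L})%:Z %| pval c)%Z.

Definition ext_vge (k : int) (x : L) : Prop :=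
  forall c, norm_is x c -> vge (k * (\dim {:L})%:Z) c.

Definition is_frobenius (s : gal_of {:L}) : Prop :=
  forall x, ext_vge 0 x ->
  ext_vge 1 (s x - x ^+ residue_card).
End Extension.
Arguments abelian_ext : clear implicits.
Arguments unramified : clear implicits.

(* These properties characterize the reciprocity map among all families of
   maps defined on the nonzero elements of F. *)
Record is_reciprocity_map (art : forall L : splittingFieldType F,
    F -> gal_of {:L}) : Prop := IsReciprocityMap {
  art_morph : forall L, abelian_ext L -> forall a b : F, a != 0 -> b != 0 ->
    art L (a * b) = (art L a * art L b)%g;
  art_compat : forall L L', abelian_ext L -> abelian_ext L' ->
    forall (f : {lrmorphism L -> L'}) (a : F), a != 0 ->
    forall x, f (art L a x) = art L' a (f x);
  art_norm : forall L, abelian_ext L -> forall (x : L) (c : F), x != 0 -> norm_is x c ->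
    art L c = 1%g;
  art_frob : forall L, abelian_ext L -> unramified L ->
    forall a : F, a != 0 -> pval a = 1 -> is_frobenius (art L a) }.

Section Cover.
Variable n : nat.

(* The condition z != 0 is redundant for n > 0. *)
Record mu := Mu { mu_val :> F; mu_valP : (mu_val != 0) && (mu_val ^+ n == 1) }.
HB.instance Definition _ := [isSub for mu_val].
HB.instance Definition _ := [Choice of mu by <:].

Fact mu_one_subproof : ((1 : F) != 0) && ((1 : F) ^+ n == 1).
Proof. by rewrite oner_eq0 expr1n eqxx. Qed.
Fact mu_mul_subproof (x y : mu) :
  (mu_val x * mu_val y != 0) && ((mu_val x * mu_val y) ^+ n == 1).
Proof.
have /andP[x0 /eqP xn] := mu_valP x; have /andP[y0 /eqP yn] := mu_valP y.
by rewrite mulf_neq0 //= exprMn xn yn mulr1.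
Qed.
Fact mu_inv_subproof (x : mu) : ((mu_val x)^-1 != 0) && ((mu_val x)^-1 ^+ n == 1).
Proof.
have /andP[x0 /eqP xn] := mu_valP x.
by rewrite invr_neq0 //= exprVn xn invr1.
Qed.
Definition mu_one := Mu mu_one_subproof.
Definition mu_mul x y := Mu (mu_mul_subproof x y).
Definition mu_inv x := Mu (mu_inv_subproof x).
Fact mu_mulA : associative mu_mul.
Proof. by move=> x y z; apply: val_inj; rewrite /= mulrA. Qed.
Fact mu_mul1 : left_id mu_one mu_mul.
Proof. by move=> x; apply: val_inj; rewrite /= mul1r. Qed.
Fact mu_mulr1 : right_id mu_one mu_mul.
Proof. by move=> x; apply: val_inj; rewrite /= mulr1. Qed.
Fact mu_mulV : left_inverse mu_one mu_inv mu_mul.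
Proof.
move=> x; apply: val_inj => /=; have /andP[x0 _] := mu_valP x.
by rewrite mulVf.
Qed.
Fact mu_mulrV : right_inverse mu_one mu_inv mu_mul.
Proof.
move=> x; apply: val_inj => /=; have /andP[x0 _] := mu_valP x.
by rewrite mulfV.
Qed.
HB.instance Definition _ :=
  isGroup.Build mu mu_mulA mu_mul1 mu_mulr1 mu_mulV mu_mulrV.

(* (a, b) = art(a) (b^(1/n)) / b^(1/n).  The other conventions in use replace
   the symbol by its inverse. *)
Definition is_hilbert_symbol (hilb : F -> F -> mu) : Prop :=
  exists2 art, is_reciprocity_map art &
    forall a b : F, a != 0 -> b != 0 ->
    forall (L : splittingFieldType F) (y : L), abelian_ext L ->
      y ^+ n = b%:A -> art L a y = mu_val (hilb a b) *: y.

Record SL2 := MkSL2 { sl_val :> 'M[F]_2; sl_valP : \det sl_val == 1 }.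
HB.instance Definition _ := [isSub for sl_val].
HB.instance Definition _ := [Choice of SL2 by <:].

Fact sl_one_subproof : \det (1%:M : 'M[F]_2) == 1.
Proof. by rewrite det1. Qed.
Fact sl_mul_subproof (x y : SL2) : \det (x *m y) == 1.
Proof. by rewrite det_mulmx (eqP (sl_valP x)) (eqP (sl_valP y)) mulr1. Qed.
Fact sl_unit (x : SL2) : (x : 'M[F]_2) \in unitmx.
Proof. by rewrite unitmxE (eqP (sl_valP x)) unitr1. Qed.
Fact sl_inv_subproof (x : SL2) : \det (invmx x) == 1.
Proof. by rewrite det_inv (eqP (sl_valP x)) invr1. Qed.
Definition sl_one := MkSL2 sl_one_subproof.
Definition sl_mul x y := MkSL2 (sl_mul_subproof x y).
Definition sl_inv x := MkSL2 (sl_inv_subproof x).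
Fact sl_mulA : associative sl_mul.
Proof. by move=> x y z; apply: val_inj; rewrite /= mulmxA. Qed.
Fact sl_mul1 : left_id sl_one sl_mul.
Proof. by move=> x; apply: val_inj; rewrite /= mul1mx. Qed.
Fact sl_mulr1 : right_id sl_one sl_mul.
Proof. by move=> x; apply: val_inj; rewrite /= mulmx1. Qed.
Fact sl_mulV : left_inverse sl_one sl_inv sl_mul.
Proof. by move=> x; apply: val_inj; rewrite /= mulVmx // sl_unit. Qed.
Fact sl_mulrV : right_inverse sl_one sl_inv sl_mul.
Proof. by move=> x; apply: val_inj; rewrite /= mulmxV // sl_unit. Qed.
HB.instance Definition _ :=
  isGroup.Build SL2 sl_mulA sl_mul1 sl_mulr1 sl_mulV sl_mulrV.

Definition mat2 (a b c d : F) : 'M[F]_2 :=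
  \matrix_(i < 2, j < 2)
    if i == ord0 then (if j == ord0 then a else b)
    else (if j == ord0 then c else d).

Definition Hpow (d : nat) : set SL2 :=
  [set g | exists2 a : F, a != 0 & (g : 'M[F]_2) = mat2 (a ^+ d) 0 0 (a ^- d)].
Definition Htorus : set SL2 := Hpow 1.
Definition Nunip : set SL2 :=
  [set g | exists x : F, (g : 'M[F]_2) = mat2 1 x 0 1].

Definition xfun (g : SL2) : F :=
  if sl_val g ord_max ord0 != 0 then sl_val g ord_max ord0
  else sl_val g ord_max ord_max.

Definition kubota (hilb : F -> F -> mu) (g h : SL2) : mu :=
  hilb (xfun (g * h)%g / xfun g) (xfun (g * h)%g / xfun h).

(* hilb is a phantom argument of the carrier, which determines the product. *)
Record cover_of (hilb : F -> F -> mu) := Cover { base : SL2; fiber : mu }.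

Variable hilb : F -> F -> mu.
Local Notation cover := (cover_of hilb).

Definition cover_mul (x y : cover) : cover :=
  Cover hilb (base x * base y)%g
    (kubota hilb (base x) (base y) * fiber x * fiber y)%g.
Definition cover_one : cover := Cover hilb 1%g 1%g.
(* Only the operations are declared here: the cover is a group when hilb is a
   Hilbert symbol. *)
HB.instance Definition _ := hasMul.Build cover cover_mul.
HB.instance Definition _ := hasOne.Build cover cover_one.

Definition sec (g : SL2) : cover := Cover hilb g 1%g.
Definition cover_preim (A : set SL2) : set cover := [set x | A (base x)].
Definition torus : set cover := cover_preim Htorus.

Definition congruence (m : nat) : set SL2 :=
  [set g | forall i j, vge m%:Z (sl_val g i j - (1%:M : 'M[F]_2) i j)].

(* For m > 0 and n prime to p, the section sec is a homomorphism on the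
   principal congruence subgroup of level m, and is the only splitting there as
   that subgroup is pro-p; so the images of these subgroups form a neighbourhood
   basis of 1 for the topology of the cover. *)
Definition subgroup (U : set cover) : Prop :=
  [/\ U 1%g, (forall x y, U x -> U y -> U (x * y)%g)
   & forall x y, U x -> (x * y)%g = 1%g -> U y].

Definition open_subgroup (A U : set cover) : Prop :=
  [/\ subgroup U, U `<=` A & exists2 m, (0 < m)%N &
      forall g, congruence m g -> A (sec g) -> U (sec g)].

Definition center_of (A : set cover) : set cover :=
  [set z | A z /\ forall x, A x -> (z * x = x * z)%g].
End Cover.
End LocalField.
Arguments sec {p F n} hilb g.
Arguments torus {p F n} hilb.

(* A representation of a subset A of G, closed under the product, is given by a
   function on G whose values outside A are irrelevant. *)
Section Representations.
Variables (R : realType) (G : baseUMagmaType) (A : set G).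
Variables (E : lmodType R[i]) (pi : G -> E -> E).

Definition representation : Prop :=
  [/\ forall g, A g -> linear (pi g), forall v, pi 1%g v = v
    & forall g h, A g -> A h -> forall v, pi (g * h)%g v = pi g (pi h v)].

Definition subrep (W : set E) : Prop :=
  [/\ W 0, (forall (c : R[i]) u v, W u -> W v -> W (c *: u + v))
    & forall g v, A g -> W v -> W (pi g v)].

Definition reducible (W : set E) : Prop :=
  exists W', [/\ subrep W', W' `<=` W, W' <> [set 0] & W' <> W].

Definition irreducible : Prop :=
  (exists v : E, v != 0) /\ ~ reducible [set: E].

Definition unitary : Prop :=
  exists B : {dot E for Num.conj}, forall g u v, A g -> B (pi g u) (pi g v) = B u v.

Definition fixed (U : set G) : set E :=
  [set v | forall g, U g -> pi g v = v].

Definition fin_dim (W : set E) : Prop :=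
  exists s : seq E, forall v, W v ->
  exists c : nat -> R[i], v = \sum_(i < size s) c i *: s`_i.
End Representations.

Section CoverRepresentations.
Variables (R : realType) (p : nat) (F : padicField p) (n : nat).
Variable hilb : F -> F -> mu F n.
Local Notation cover := (cover_of hilb).

Definition identification (iota : mu F n -> R[i]) : Prop :=
  [/\ forall x y, iota (x * y)%g = iota x * iota y, injective iota
    & forall w : R[i], w ^+ n = 1 <-> exists x, iota x = w].

Variables (V : lmodType R[i]) (A : set cover) (tau : cover -> V -> V).

Definition genuine (iota : mu F n -> R[i]) : Prop :=
  forall (e : mu F n) v, tau (Cover hilb 1%g e) v = iota e *: v.

Definition smooth : Prop :=
  forall v, exists2 U, open_subgroup A U & fixed tau U v.

(* An open subgroup contains a compact open one, so that requiring U to be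
   compact would not change the condition. *)
Definition admissible : Prop :=
  forall U, open_subgroup A U -> fin_dim (fixed tau U).

Definition central_character (chi : cover -> R[i]) : Prop :=
  forall z, center_of A z -> forall v, tau z v = chi z *: v.

Definition nontrivial_quadratic (D : set (SL2 F)) (phi : SL2 F -> R[i]) : Prop :=
  [/\ forall g h, D g -> D h -> phi (g * h)%g = phi g * phi h,
      forall g, D g -> phi g ^+ 2 = 1
    & exists2 g, D g & phi g != 1].

(* The space of the normalized induction of tau from the preimage of the Borel
   subgroup, whose elements are the products t * sec u; tau (t * sec u) is
   tau t, and the modulus of the Borel subgroup at h(a) is |a|^2. *)
Definition induced : set (cover -> V) :=
  [set f |
     (forall t u x, torus hilb t -> Nunip u ->
        f (t * sec hilb u * x)%g
          = absF R (sl_val (base t) ord0 ord0) *: tau t (f x))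
   /\ exists2 U, open_subgroup [set: cover] U &
        forall x k, U k -> f (x * k)%g = f x].

Definition right_transl (g : cover) (f : cover -> V) : cover -> V :=
  fun x => f (x * g)%g.
End CoverRepresentations.

(* Main.v *)
Require Import Defs.
From HB Require Import structures.
From mathcomp Require Import all_boot all_order all_fingroup all_algebra all_solvable.
From mathcomp Require Import all_field complex ring lra.
From mathcomp Require Import zify.
From mathcomp Require Import boolp classical_sets functions reals.

Set Implicit Arguments.
Unset Strict Implicit.
Unset Printing Implicit Defensive.

Import Order.TTheory GRing.Theory Num.Theory.
Local Open Scope classical_set_scope.
Local Open Scope complex_scope.
Local Open Scope ring_scope.


(* Put t(a) = tau(s(h(a))), so that t(a) t(b) = (b, a) t(ab); the symbol is trivial on 1 + P,
   and tau is finite-dimensional.  A section f of the induced representation is given by f(1)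
   and by phi(y) = f(s(w n(y))), and phi(y) = (y, -1) |y|^-1 t(y^-1) f(1) near infinity.

   Suppose that W is a proper nonzero subrepresentation.  Since tau is unitary there is an
   invariant inner product, hence an equivariant projection P onto W, and f -> (P f)(1) is
   determined on the sections vanishing at 1 by an operator D through D(int phi).  If D = 0,
   Schur's lemma makes P a scalar.  Otherwise D t(a^-1) = t(a) D, so the scalars t(a^d) satisfy
   t(a^d)^2 = (a^d, -1); applying (P f)(1) to a combination of translates of a section supported
   near B(F) that vanishes at 1 shows that the integrals of (y, -1) t(y) u over 2d consecutive
   shells add up to 0.  If t were trivial on n-th powers, then the sum of (x, -1) t(x) over
   F^* / F^*^n would be 0, which contradicts the nondegeneracy of the symbol.  This leaves n
   odd and a nontrivial quadratic character.

   Conversely, for such a character the integral of phi over P^-m is eventually periodic in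
   m, as its shell integrals cancel over 2n consecutive shells.  Its mean, followed by
   an operator L = sum over F^* / F^*^n of t(x) t(b) t(x), nonzero for a suitable b and such
   that L t(a^-1) = t(a) L, defines an intertwining endomorphism.  It maps some sections
   vanishing at 1 to sections that do not, so it is not a scalar, and its eigenspaces are
   proper subrepresentations. *)

(** * Units and roots in a p-adic field *)

(** Tameness carries the arithmetic. As n is prime to p, the group 1 + P consists of n-th powers, so
    F^* / F^*^n is generated by a uniformizer w and a unit g whose residue is a primitive root.
    Units pair trivially, and (w, g) is a primitive n-th root of unity found from the Frobenius of
    F(g^(1/n)). The symbol identities follow, and from them the cocycle identity of the cover,
    checked along the Bruhat decomposition.

    The integral of phi over F diverges: the value f(1) produces a tail of size |y|^-1, which has
    the same mass on every shell. Both directions of the theorem are therefore about the shell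
    integrals of this tail.

    The number 2d arises because h(a) acts on the coordinate y through a^2: translation by h(w^-d)
    moves balls by 2d. It is a multiple of n, so that whole classes modulo n-th powers are summed.
    The invariant inner product gives no complete space; the projection onto W is built in each
    finite-dimensional space of vectors fixed by a congruence subgroup, and the projections are then
    shown to agree. *)

Section Valuation.
Variables (p : nat) (F : padicField p).
Local Notation v := (@Defs.pval p F).
Local Notation q := (residue_card F).
Implicit Types (x y a b c : F) (k : int).

Definition fin_unit x := x != 0 /\ v x = 0.

Lemma pvalM x y : x != 0 -> y != 0 -> v (x * y) = v x + v y.
Proof. exact: (padic_valM (padicP F)). Qed.

Lemma pval1 : v 1 = 0.
Proof.
have : v 1 = v 1 + v 1 by rewrite -pvalM ?oner_neq0 // mulr1.
lia. Qed.

Lemma pvalV x : x != 0 -> v x^-1 = - v x.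
Proof.
move=> x0; have := pvalM x0 (invr_neq0 x0).
by rewrite mulfV // pval1; lia.
Qed.

Lemma pvalX x i : x != 0 -> v (x ^+ i) = v x * i%:Z.
Proof.
move=> x0; elim: i => [|i IHi]; first by rewrite expr0 pval1 mulr0.
by rewrite exprS pvalM ?expf_neq0 // IHi; lia.
Qed.

Lemma pvalXz x (i : int) : x != 0 -> v (x ^ i) = v x * i.
Proof.
move=> x0; case: i => i; first by rewrite -pvalX.
by rewrite NegzE -exprnN pvalV ?expf_neq0 // pvalX //; lia.
Qed.

Lemma pvalN1 : v (-1) = 0.
Proof.
have : v 1 = v (-1) + v (-1).
  by rewrite -pvalM ?oppr_eq0 ?oner_eq0 // mulrNN mulr1.
by rewrite pval1; lia.
Qed.

Lemma pvalN x : v (- x) = v x.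
Proof.
have [->|x0] := eqVneq x 0; first by rewrite oppr0.
by rewrite -mulN1r pvalM ?oppr_eq0 ?oner_eq0 // pvalN1 add0r.
Qed.

Lemma vge_nz k x : x != 0 -> vge k x <-> k <= v x.
Proof.
by move=> x0; split=> [[/eqP|]//|]; [rewrite (negPf x0)|right].
Qed.

Lemma vge0 k : vge k (0 : F).
Proof. by left. Qed.

Lemma vgeD k x y : vge k x -> vge k y -> vge k (x + y).
Proof. exact: (padic_valD (padicP F)). Qed.

Lemma vgeN k x : vge k x -> vge k (- x).
Proof. by case=> [->|h]; [left; rewrite oppr0|right; rewrite pvalN]. Qed.

Lemma vgeB k x y : vge k x -> vge k y -> vge k (x - y).
Proof. by move=> hx hy; apply: vgeD => //; apply: vgeN. Qed.

Lemma vge_sym k x y : vge k (x - y) -> vge k (y - x).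
Proof. by move=> /vgeN; rewrite opprB. Qed.

Lemma vge_trans k y x z : vge k (x - y) -> vge k (y - z) -> vge k (x - z).
Proof. by move=> h1 h2; have := vgeD h1 h2; rewrite addrA subrK. Qed.

Lemma vgeM i j k x y : vge i x -> vge j y -> k <= i + j -> vge k (x * y).
Proof.
case: (eqVneq x 0) => [-> _ _ _|x0]; first by left; rewrite mul0r.
case: (eqVneq y 0) => [-> _ _ _|y0]; first by left; rewrite mulr0.
rewrite !vge_nz ?mulf_neq0 // pvalM //; lia.
Qed.

Lemma vge_le k k' x : vge k x -> k' <= k -> vge k' x.
Proof. by case=> [->|h] h'; [left|right; lia]. Qed.

Lemma vge_v x : vge (v x) x.
Proof. by right. Qed.

Lemma vge_all x : (forall k, vge k x) -> x = 0.
Proof.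
move=> h; apply/eqP/negPn/negP => x0; have := h (v x + 1).
by rewrite vge_nz //; lia.
Qed.

Lemma vge1 k : k <= 0 -> vge k (1 : F).
Proof. by rewrite vge_nz ?oner_eq0 // pval1. Qed.

Lemma vge_sum k (I : Type) (r : seq I) (P : pred I) (f : I -> F) :
  (forall i, P i -> vge k (f i)) -> vge k (\sum_(i <- r | P i) f i).
Proof. move=> h; elim/big_ind: _ => //; [exact: vge0|exact: vgeD]. Qed.

Lemma vgeX i x : vge 0 x -> vge 0 (x ^+ i).
Proof.
move=> hx; elim: i => [|i IHi]; first exact: vge1.
by rewrite exprS; apply: (vgeM hx IHi).
Qed.

Lemma vgeMn i k x : vge k x -> vge k (x *+ i).
Proof.
move=> hx; elim: i => [|i IHi]; first by left.
by rewrite mulrS; apply: vgeD.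
Qed.

Lemma pvalD_dom x y : x != 0 -> vge (v x + 1) y -> x + y != 0 /\ v (x + y) = v x.
Proof.
move=> x0 hy; have xy0 : x + y != 0.
  apply/eqP => /(canRL (addrK y)); rewrite add0r => xE.
  by move/vgeN: hy; rewrite -xE vge_nz //; lia.
split=> //.
have h1 : v x <= v (x + y).
  rewrite -vge_nz //; apply: vgeD; [exact: vge_v|apply: vge_le hy _; lia].
suff : v (x + y) <= v x by lia.
rewrite leNgt; apply/negP => h.
have h2 : vge (v x + 1) (x + y) by rewrite vge_nz //; lia.
by have := vgeB h2 hy; rewrite addrK vge_nz //; lia.
Qed.

Lemma pval_close x y : x != 0 -> vge (v x + 1) (y - x) -> y != 0 /\ v y = v x.
Proof. by move=> x0 /(pvalD_dom x0); rewrite addrC subrK. Qed.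

Lemma vge_unit x : vge 0 x -> ~ vge 1 x -> fin_unit x.
Proof.
case: (eqVneq x 0) => [-> _ []|x0]; first exact: vge0.
rewrite !vge_nz // => h1 h2; split=> //.
by apply/eqP; rewrite eq_le h1 andbT leNgt; apply/negP => h3; apply: h2; lia.
Qed.

Lemma fin_unit1 : fin_unit 1.
Proof. by split; [exact: oner_neq0|exact: pval1]. Qed.

Lemma fin_unitM x y : fin_unit x -> fin_unit y -> fin_unit (x * y).
Proof. by move=> [x0 hx] [y0 hy]; split; rewrite ?mulf_neq0 // pvalM // hx hy. Qed.

Lemma fin_unitV x : fin_unit x -> fin_unit x^-1.
Proof. by move=> [x0 hx]; split; rewrite ?invr_eq0 // pvalV // hx oppr0. Qed.

Lemma fin_unitN x : fin_unit x -> fin_unit (- x).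
Proof. by move=> [x0 hx]; split; rewrite ?oppr_eq0 // pvalN. Qed.

Lemma fin_unitX x i : fin_unit x -> fin_unit (x ^+ i).
Proof. by move=> [x0 hx]; split; rewrite ?expf_neq0 // pvalX // hx mul0r. Qed.

Lemma fin_unit_vge x : fin_unit x -> vge 0 x.
Proof. by move=> [x0 hx]; rewrite vge_nz // hx. Qed.

Lemma one_unit x : vge 1 (x - 1) -> fin_unit x.
Proof.
by move=> h; have := @pval_close 1 x (oner_neq0 _); rewrite pval1; case.
Qed.

Local Notation red := (@presred p F).

Lemma redM x y : vge 0 x -> vge 0 y -> red (x * y) = red x * red y.
Proof. exact: (padic_redM (padicP F)). Qed.

Lemma redD x y : vge 0 x -> vge 0 y -> red (x + y) = red x + red y.
Proof. exact: (padic_redD (padicP F)). Qed.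

Lemma red1 : red 1 = 1.
Proof. exact: (padic_red1 (padicP F)). Qed.

Lemma red_eq0 x : vge 0 x -> (red x = 0 <-> vge 1 x).
Proof. exact: (padic_red_ker (padicP F)). Qed.

Lemma red0 : red 0 = 0.
Proof. by apply/red_eq0; exact: vge0. Qed.

Lemma redN x : vge 0 x -> red (- x) = - red x.
Proof.
move=> hx; apply/eqP; rewrite -subr_eq0 opprK -redD ?addNr ?red0 //.
exact: vgeN.
Qed.

Lemma redB x y : vge 0 x -> vge 0 y -> red (x - y) = red x - red y.
Proof. by move=> hx hy; rewrite redD ?redN //; apply: vgeN. Qed.

Lemma red_eq x y : vge 0 x -> vge 0 y -> (red x = red y <-> vge 1 (x - y)).
Proof.
move=> hx hy; rewrite -red_eq0 ?redB //; last exact: vgeB.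
by split=> [->|/eqP]; rewrite ?subrr // subr_eq0 => /eqP.
Qed.

Lemma redX x i : vge 0 x -> red (x ^+ i) = red x ^+ i.
Proof.
move=> hx; elim: i => [|i IHi]; first exact: red1.
by rewrite !exprS redM ?IHi //; apply: vgeX.
Qed.

Lemma red_nat i : red (i%:R) = i%:R.
Proof.
elim: i => [|i IHi]; first exact: red0.
rewrite !mulrS redD ?red1 ?IHi //; first exact: vge1.
by apply: vgeMn; apply: vge1.
Qed.

Lemma red_unit x : vge 0 x -> red x != 0 -> fin_unit x.
Proof. by move=> hx /eqP h; apply: vge_unit => // /red_eq0 - /(_ hx). Qed.

Lemma unit_red x : fin_unit x -> red x != 0.
Proof.
move=> ux; apply/eqP => /red_eq0 - /(_ (fin_unit_vge ux)).
by case: ux => x0 hx; rewrite vge_nz // hx.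
Qed.

Lemma red_lift z : exists2 x, vge 0 x & red x = z.
Proof. exact: (padic_red_surj (padicP F)). Qed.

Lemma residue_prime : prime p.
Proof. by case/andP: (padic_residue (padicP F)). Qed.

Lemma unif_ex : exists2 x, x != 0 & v x = 1.
Proof. exact: (padic_unif (padicP F)). Qed.

Lemma unif_decomp w x : w != 0 -> v w = 1 -> x != 0 ->
  exists2 u, fin_unit u & x = w ^ (v x) * u.
Proof.
move=> w0 w1 x0; exists (x / w ^ (v x)).
  split; first by rewrite mulf_neq0 ?invr_eq0 ?expfz_neq0.
  by rewrite pvalM ?invr_eq0 ?expfz_neq0 // pvalV ?expfz_neq0 // pvalXz // w1; lia.
by rewrite mulrC divfK // expfz_neq0.
Qed.

Lemma vge_unif w k x : w != 0 -> v w = 1 -> vge k x -> vge 0 (x / w ^ k).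
Proof.
move=> w0 w1 hx; apply: (vgeM (i := k) (j := - k)) => //; last by lia.
rewrite vge_nz ?invr_eq0 ?expfz_neq0 // pvalV ?expfz_neq0 // pvalXz // w1; lia.
Qed.

Lemma card_residue_gt1 : (1 < q)%N.
Proof.
rewrite /residue_card; have := max_card (pred2 (0 : pres F) 1).
by rewrite card2 eq_sym oner_eq0.
Qed.

(** The q - 1 nonzero residues are all roots of X^(q-1) - 1, so one of them is a primitive root; any
    integral lift of it is a unit. *)
Lemma unit_gen : exists2 g : F, fin_unit g & q.-1.-primitive_root (red g).
Proof.
have q1 := card_residue_gt1.
pose rs := enum (predC1 (0 : pres F)).
have : has q.-1.-primitive_root rs.
  apply: has_prim_root.
  - by rewrite -ltnS prednK // ltnW.
  - apply/allP => x; rewrite mem_enum => x0.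
    rewrite unity_rootE; apply/eqP; apply: (mulfI x0).
    by rewrite mulr1 -exprS prednK ?(ltnW q1) // /residue_card expf_card.
  - exact: enum_uniq.
  - by rewrite /rs -cardE cardC1.
case/hasP => z _ zP; have [g g0 gz] := red_lift z.
exists g; last by rewrite gz.
apply: red_unit => //; rewrite gz; apply/eqP => z0.
have := prim_expr_order zP; rewrite z0 expr0n.
case: (q.-1 == 0)%N / eqP => [|_ /eqP]; first by move: q1; lia.
by rewrite eq_sym oner_eq0.
Qed.

Section TameRoots.
Variable n : nat.
Hypotheses (n_gt0 : (0 < n)%N) (cop : coprime p n).

Lemma unit_n : fin_unit (n%:R : F).
Proof.
apply: red_unit; first by apply: vgeMn; apply: vge1.
rewrite red_nat -(dvdn_pcharf (padic_residue (padicP F))).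
by rewrite -prime_coprime ?residue_prime.
Qed.

(** The sum is (x^n - y^n) / (x - y), which is the derivative n up to an error in P^k; since n is a
    unit, so is this quotient on 1 + P. *)
Lemma npow_deriv_unit k x y : 1 <= k -> vge k (x - 1) -> vge k (y - 1) ->
  vge k (\sum_(i < n) x ^+ (n.-1 - i) * y ^+ i - n%:R).
Proof.
move=> k1 hx hy.
have sub1X j (z : F) : vge k (z - 1) -> vge k (z ^+ j - 1).
  move=> hz; elim: j => [|j IHj]; first by rewrite expr0 subrr; apply: vge0.
  have -> : z ^+ j.+1 - 1 = z * (z ^+ j - 1) + (z - 1) by rewrite exprS; ring.
  apply: vgeD => //; apply: (vgeM (i := 0) _ IHj); last by lia.
  by apply: fin_unit_vge; apply: one_unit; apply: vge_le hz _.
rewrite -[X in _ - X%:R](card_ord n) -sum1_card natr_sum -sumrB.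
apply: vge_sum => i _.
have -> : x ^+ (n.-1 - i) * y ^+ i - 1 =
  x ^+ (n.-1 - i) * (y ^+ i - 1) + (x ^+ (n.-1 - i) - 1) by ring.
apply: vgeD; last exact: sub1X.
apply: (vgeM (i := 0) _ (sub1X i _ hy)); last by lia.
by apply: fin_unit_vge; apply: fin_unitX; apply: one_unit; apply: vge_le hx _.
Qed.

(** On 1 + P, x^n - 1 is x - 1 times a unit, so there is no n-torsion. *)
Lemma one_unit_root_eq1 x : x ^+ n = 1 -> vge 1 (x - 1) -> x = 1.
Proof.
move=> xn hx; have := subrXX x 1 n; rewrite xn expr1n subrr => /esym/eqP.
rewrite mulf_eq0 => /orP[|/eqP s0]; first by rewrite subr_eq0 => /eqP.
have := @npow_deriv_unit 1 x 1 (lexx _) hx.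
rewrite s0 subrr sub0r => /(_ (vge0 _))/vgeN; rewrite opprK.
by case: unit_n => n0 vn; rewrite vge_nz // vn.
Qed.

(* Hensel's lemma, by Newton's iteration with constant derivative n. *)
Lemma one_unit_npow a : vge 1 (a - 1) ->
  exists2 c, vge 1 (c - 1) & c ^+ n = a.
Proof.
move=> ha; have [n0 vn] := unit_n.
pose step x := x - (x ^+ n - a) / n%:R.
pose u := fix u i := if i is i'.+1 then step (u i') else (1 : F).
have uP i : vge 1 (u i - 1) /\ vge (i%:Z + 1) (u i ^+ n - a).
  elim: i => [|i [IH1 IH2]].
    rewrite /= subrr expr1n; split; first exact: vge0.
    by apply: vge_sym; apply: vge_le ha _; lia.
  have dU : vge (i%:Z + 1) (u i.+1 - u i).
    rewrite /= /step addrAC subrr add0r; apply: vgeN.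
    apply: (vgeM IH2 (j := 0)); last by lia.
    by rewrite vge_nz ?invr_eq0 // pvalV // vn.
  have h1 : vge 1 (u i.+1 - 1).
    by apply: (vge_trans (y := u i)) => //; apply: vge_le dU _; lia.
  split=> //.
  have e : u i.+1 - u i = - ((u i ^+ n - a) / n%:R).
    by rewrite /= /step addrAC subrr add0r.
  have D := npow_deriv_unit (lexx 1) h1 IH1.
  have S := subrXX (u i.+1) (u i) n.
  set s := \sum_(_ < n) _ in D S.
  (* Newton's step makes [u i ^+ n - a] equal to - n times the increment; what remains carries the
     factor s - n in P, which gains one order. *)
  have -> : u i.+1 ^+ n - a = (u i.+1 - u i) * (s - n%:R).
    rewrite mulrBr -S e mulNr divfK //; ring.
  by apply: (vgeM dU D); lia.
have uS i : vge (i%:Z + 1) (u i.+1 - u i).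
  rewrite /= /step addrAC subrr add0r; apply: vgeN.
  apply: (vgeM (uP i).2 (j := 0)); last by lia.
  by rewrite vge_nz ?invr_eq0 // pvalV // vn.
have uD i j : vge (i%:Z + 1) (u (i + j)%N - u i).
  elim: j => [|j IHj]; first by rewrite addn0 subrr; apply: vge0.
  apply: (vge_trans (y := u (i + j)%N)) => //.
  by rewrite addnS; apply: vge_le (uS _) _; lia.
have [|c cP] := padic_complete (padicP F) (u := u).
  move=> r; exists `|r|%N => i j hi hj.
  apply: (vge_trans (y := u `|r|%N)).
    by rewrite -(subnKC hi); apply: vge_le (uD _ _) _; lia.
  by apply: vge_sym; rewrite -(subnKC hj); apply: vge_le (uD _ _) _; lia.
have cU : vge 1 (c - 1).
  have [N hN] := cP 1; apply: (vge_trans (y := u N)); last exact: (uP N).1.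
  by apply: vge_sym; apply: hN.
exists c => //; apply/eqP; rewrite -subr_eq0; apply/eqP; apply: vge_all => k.
have [N hN] := cP k; set M := maxn N `|k|%N.
apply: (vge_trans (y := u M ^+ n)).
  rewrite subrXX; apply: (vgeM (i := k) (j := 0)); last by lia.
    by apply: vge_sym; apply: hN; apply: leq_maxl.
  have D := npow_deriv_unit (lexx 1) cU (uP M).1.
  rewrite -(subrK n%:R (\sum_(_ < n) _)); apply: vgeD.
    by apply: vge_le D _.
  by apply: fin_unit_vge; exact: unit_n.
by apply: vge_le (uP M).2 _; rewrite /M; lia.
Qed.

Hypothesis mu_full : exists z : F, n.-primitive_root z.

Lemma root1_unit x : x ^+ n = 1 -> fin_unit x.
Proof.
move=> xn; have x0 : x != 0.
  apply/eqP => x0; move: xn; rewrite x0 expr0n gtn_eqF //= => /eqP.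
  by rewrite eq_sym oner_eq0.
split=> //; have := pvalX n x0; rewrite xn pval1 => /esym/eqP.
by rewrite mulf_eq0 => /orP[/eqP//|]; lia.
Qed.

(** Reduction is injective on n-th roots of unity, its kernel 1 + P having no n-torsion; hence mu_n
    embeds into the residue group of order q - 1. *)
Lemma red_prim_root z : n.-primitive_root z -> n.-primitive_root (red z).
Proof.
move=> zP; have zn := prim_expr_order zP; have uz := root1_unit zn.
have z0 := fin_unit_vge uz.
apply/andP; split=> //; apply/forallP => -[i /= hi]; apply/eqP.
rewrite unity_rootE -redX // -red1.
case: (eqVneq i.+1 n) => [->|ne]; first by rewrite zn eqxx.
apply/negbTE/eqP => /red_eq - /(_ (vgeX _ z0) (vge1 (lexx _))) h.
have : z ^+ i.+1 = 1.
  by apply: one_unit_root_eq1 => //; rewrite exprAC zn expr1n.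
move/eqP; rewrite -(prim_order_dvd zP) => /dvdn_leq => /(_ isT).
by move=> h'; move: ne hi h'; lia.
Qed.

Lemma n_dvd_card : (n %| q.-1)%N.
Proof.
have [z zP] := mu_full; rewrite (prim_order_dvd (red_prim_root zP)).
have uz := root1_unit (prim_expr_order zP).
apply/eqP; apply: (mulfI (unit_red uz)); rewrite mulr1 -exprS prednK.
  by rewrite /residue_card expf_card.
exact: ltnW card_residue_gt1.
Qed.

Section Generator.
Variables (w g : F).
Hypotheses (w0 : w != 0) (w1 : v w = 1).
Hypotheses (gU : fin_unit g) (gP : q.-1.-primitive_root (red g)).

(** Dividing u by the power of g with the same residue leaves an element of 1 + P, which is an n-th
    power; the exponent of g is then reduced modulo n. *)
Lemma unit_decomp u : fin_unit u ->
  exists i, (i < n)%N /\ exists2 c, fin_unit c & u = g ^+ i * c ^+ n.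
Proof.
move=> uU; have u0 := fin_unit_vge uU.
have q1 : red u ^+ q.-1 = 1.
  apply: (mulfI (unit_red uU)); rewrite mulr1 -exprS prednK.
    by rewrite /residue_card expf_card.
  exact: ltnW card_residue_gt1.
have /(prim_rootP gP)[[j /= _] jE] := q1.
have g0 := fin_unit_vge gU.
have gjU := fin_unitX j gU.
have [|c cU cE] := @one_unit_npow (u / g ^+ j).
  have -> : u / g ^+ j - 1 = (u - g ^+ j) / g ^+ j.
    by rewrite mulrBl mulfV //; case: gjU.
  apply: (vgeM (i := 1) (j := 0)) => //; last by apply: fin_unit_vge; apply: fin_unitV.
  by apply/red_eq; rewrite ?redX //; apply: vgeX.
exists (j %% n)%N; split; first by rewrite ltn_pmod.
exists (g ^+ (j %/ n) * c).
  by apply: fin_unitM; [exact: fin_unitX|exact: one_unit].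
rewrite exprMn cE -exprM mulrA -exprD addnC -divn_eq mulrC divfK //.
by case: gjU.
Qed.

Lemma npow_decomp x : x != 0 -> exists i j : nat,
  [/\ (i < n)%N, (j < n)%N & exists2 c, c != 0 & x = w ^+ i * g ^+ j * c ^+ n].
Proof.
move=> x0; have [u uU xE] := unif_decomp w0 w1 x0.
have [j [jn [c cU uE]]] := unit_decomp uU.
have n0 : n%:Z != 0 by lia.
exists `|(v x %% n)%Z|%N, j; split=> //.
  by have := modz_ge0 (v x) n0; have := ltz_pmod (v x) (d := n%:Z); lia.
exists (w ^ (v x %/ n)%Z * c).
  by rewrite mulf_neq0 ?expfz_neq0 //; case: cU.
rewrite exprMn {1}xE uE {1}(divz_eq (v x) n) expfzDr //.
have -> : w ^ ((v x %/ n)%Z * n) = (w ^ (v x %/ n)%Z) ^+ n.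
  by rewrite [RHS]exprnP exprz_exp.
have -> : w ^ (v x %% n)%Z = w ^+ `|(v x %% n)%Z|%N.
  by rewrite -[in LHS](gez0_abs (modz_ge0 (v x) n0)) -exprnP.
ring.
Qed.

End Generator.
End TameRoots.
End Valuation.

(** * Kummer extensions and the Hilbert symbol *)

Section Kummer.

Lemma irreducible_factor (K : fieldType) (P : {poly K}) :
  (1 < size P)%N -> exists2 r, irreducible_poly r & r %| P.
Proof.
have [m] := ubnP (size P); elim: m P => // m IHm P /ltnSE lePm P1.
have P0 : P != 0 by rewrite -size_poly_gt0 ltnW.
have [irrP|] := EM (irreducible_poly P); first by exists P.
move/not_andP => [//|/existsNP[Q]] /not_implyP[Q1] /not_implyP[QP] nQP.
have Q0 : Q != 0 by apply: contraNneq P0 => Q0; rewrite Q0 dvd0p in QP.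
have leQP : (size Q < size P)%N.
  rewrite ltn_neqAle dvdp_leq // andbT; apply/negP => /eqP e; apply: nQP.
  by rewrite -dvdp_size_eqp // e.
have [||r irr_r rQ] := IHm Q; first exact: leq_trans leQP lePm.
  by rewrite ltn_neqAle eq_sym Q1 size_poly_gt0.
by exists r => //; apply: dvdp_trans rQ QP.
Qed.

Lemma root_ext (K : fieldType) (n : nat) (b : K) : (0 < n)%N ->
  exists (L : fieldExtType K) (z : L), z ^+ n = b%:A.
Proof.
move=> n0; have sz : size ('X^n - b%:P) = n.+1 by rewrite size_XnsubC.
have [|r irr_r rP] := @irreducible_factor K ('X^n - b%:P); first by rewrite sz.
have [L _ [z rz _]] := irredp_FAdjoin irr_r; exists L, z.
have /rootP : root (map_poly (in_alg L) ('X^n - b%:P)) z.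
  by apply: root_dvdp rz; rewrite dvdp_map.
rewrite rmorphB /= map_polyXn map_polyC /= hornerD hornerN hornerXn hornerC.
by move/eqP; rewrite subr_eq0 => /eqP.
Qed.

(** Additivity of the symbol in its second argument compares roots of b, b' and b b', which have to
    lie in a single extension: [L2] is built over [L1] and regarded over K. *)
Lemma root_ext2 (K : fieldType) (n : nat) (b1 b2 : K) : (0 < n)%N ->
  exists (M : fieldExtType K) (z1 z2 : M), z1 ^+ n = b1%:A /\ z2 ^+ n = b2%:A.
Proof.
move=> n0; have [L1 [z1 hz1]] := @root_ext K n b1 n0.
have [L2 [z2 hz2]] := @root_ext L1 n b2%:A n0.
exists (baseFieldType L2), (z1%:A : L2), z2; split.
  have -> : (b1%:A : baseFieldType L2) = (b1%:A : L1)%:A :> L2.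
    exact: baseField_scaleE.
  by rewrite -hz1 -[RHS]/(in_alg L2 (z1 ^+ n)) rmorphXn.
by rewrite [LHS]hz2; apply/esym; exact: baseField_scaleE.
Qed.

Variables (F : fieldType) (n : nat) (z : F).
Hypotheses (zP : n.-primitive_root z) (ch0 : [pchar F] =i pred0).

Let n_gt0 : (0 < n)%N. Proof. exact: prim_order_gt0 zP. Qed.

Lemma XnsubC_prod (L : fieldExtType F) (y : L) : y != 0 ->
  'X^n - (y ^+ n)%:P = \prod_(i < n) ('X - (z%:A ^+ i * y)%:P).
Proof.
move=> y0; set rs := [seq z%:A ^+ i * y | i : 'I_n].
have zLP : n.-primitive_root (z%:A : L) by rewrite -[z%:A]/(in_alg L z) fmorph_primitive_root.
have szr : size rs = n by rewrite size_map size_enum_ord.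
have Urs : uniq rs.
  rewrite map_inj_uniq ?enum_uniq // => i j /(mulIf y0)/eqP.
  by rewrite (eq_prim_root_expr zLP) !modn_small // => /eqP/val_inj.
have sz : size ('X^n - (y ^+ n)%:P) = n.+1 by rewrite size_XnsubC.
rewrite [LHS](@all_roots_prod_XsubC _ _ rs); first last.
- by rewrite uniq_rootsE.
- apply/allP => _ /mapP[i _ ->]; apply/rootP.
  rewrite !(hornerE, hornerXn) exprMn exprAC (prim_expr_order zLP) expr1n mul1r.
  by rewrite subrr.
- by rewrite szr.
rewrite lead_coefE sz /= coefB coefXn eqxx coefC gtn_eqF // subr0 scale1r.
by rewrite big_map big_enum.
Qed.

(** As F contains the n-th roots of unity, adjoining one root of each X^n - b adjoins all of
    them. *)
Lemma kummer_splitting (L : fieldExtType F) (zs : seq L) (bs : seq F) :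
  all (fun b => b != 0) bs -> map (fun x => x ^+ n) zs = map (in_alg L) bs ->
  <<1 & zs>>%VS = fullv -> SplittingField.axiom L.
Proof.
move=> bs0 zsE full.
exists (\prod_(b <- bs) ('X^n - (b%:A)%:P)).
  apply: rpred_prod => b _; rewrite rpredB ?polyOverXn // polyOverC.
  exact: rpredZ (mem1v _).
exists [seq z%:A ^+ (i : 'I_n) * y | y <- zs, i <- enum 'I_n].
  rewrite big_allpairs_dep /= -(big_map (in_alg L) xpredT (fun b => 'X^n - b%:P)).
  rewrite -zsE big_map /=.
  rewrite (eq_big_seq (fun y => \prod_(i <- enum 'I_n) ('X - (z%:A ^+ i * y)%:P))).
    exact: eqpxx.
  move=> y yzs; rewrite big_enum /= XnsubC_prod //.
  apply/eqP => y0; have : y ^+ n \in map (in_alg L) bs.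
    by rewrite -zsE; apply: map_f.
  case/mapP => b bbs; rewrite y0 expr0n gtn_eqF //= => /esym/eqP.
  by rewrite -[b%:A]/(in_alg L b) fmorph_eq0; apply/negP; apply: (allP bs0).
apply/eqP; rewrite eqEsubv subvf -full; apply/Fadjoin_seqP; split.
  exact: subv_adjoin_seq.
move=> y yzs; apply: seqv_sub_adjoin; apply/allpairsP.
exists (y, Ordinal n_gt0) => /=; split=> //; first by rewrite mem_enum.
by rewrite expr0 mul1r.
Qed.

(** Every automorphism multiplies each generator by a scalar of F, and scalings commute, so
    commutators fix all generators. Separability comes from characteristic 0. *)
Lemma kummer_galois (L : splittingFieldType F) (zs : seq L) (bs : seq F) :
  map (fun x => x ^+ n) zs = map (in_alg L) bs -> <<1 & zs>>%VS = fullv ->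
  galois 1 {:L} /\ abelian 'Gal({:L} / 1).
Proof.
move=> zsE full.
have chL : [pchar L] =i pred0 by move=> i; rewrite (fmorph_pchar (in_alg L)) ch0.
split.
  rewrite /galois sub1v normalFieldf andbT /=.
  by apply/separableP => x _; apply: pcharf0_separable.
have galE (s : gal_of {:L}) y : s \in 'Gal({:L} / 1)%g -> y \in zs ->
    exists c : F, s y = c *: y.
  move=> sG yzs; have : y ^+ n \in map (in_alg L) bs by rewrite -zsE; apply: (map_f (fun x : L =>
    x ^+ n)).
  case/mapP => b _ /= yn.
  have [->|y0] := eqVneq y 0; first by exists 0; rewrite rmorph0 scaler0.
  have : root ('X^n - (y ^+ n)%:P) (s y).
    have sy : (s y) ^+ n = b%:A by rewrite -rmorphXn yn; exact: rmorph_alg.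
    by apply/rootP; rewrite !(hornerE, hornerXn) sy yn subrr.
  rewrite XnsubC_prod // -(big_map (fun i : 'I_n => z%:A ^+ i * y) xpredT
    (fun x => 'X - x%:P)) root_prod_XsubC => /mapP[i _ ->].
  by exists (z ^+ i); rewrite -[z%:A]/(in_alg L z) -rmorphXn /= mulr_algl.
apply/centsP => s sG t tG; apply/eqP; rewrite -(inj_eq (mulIg (t * s)^-1)%g) mulgV.
set u := (_ * _)%g; have uG : u \in 'Gal({:L} / 1)%g by rewrite groupM ?groupV ?groupM.
have : (<<1 & zs>> <= fixedField [set u])%VS.
  apply/Fadjoin_seqP; split.
    apply/subvP => a a1; apply/fixedFieldP; first exact: memvf.
    by move=> r /set1P ->; apply: (fixed_gal (sub1v _) uG).
  move=> y yzs; apply/fixedFieldP; first exact: memvf.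
  move=> r /set1P ->; rewrite galM ?memvf //.
  have -> : (s * t)%g y = (t * s)%g y.
    rewrite !galM ?memvf //; have [c cE] := galE _ _ sG yzs.
    have [d dE] := galE _ _ tG yzs.
    by rewrite dE cE !linearZ /= dE cE !scalerA mulrC.
  by rewrite -galM ?memvf // mulgV gal_id.
rewrite full => uK; apply/gal_eqP => x _; rewrite gal_id.
by have /fixedFieldP := subvP uK x (memvf x); apply; rewrite ?memvf ?set11.
Qed.
Lemma kummer_pack (L0 : fieldExtType F) (ys : seq L0) (bs : seq F) :
  all (fun b => b != 0) bs -> map (fun x => x ^+ n) ys = map (in_alg L0) bs ->
  <<1 & ys>>%VS = fullv ->
  exists (L : splittingFieldType F) (ys : seq L),
    [/\ map (fun x => x ^+ n) ys = map (in_alg L) bs, <<1 & ys>>%VS = fullv,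
       galois 1 {:L} & abelian 'Gal({:L} / 1)].
Proof.
move=> bs0 ysE yfull; have ax := kummer_splitting bs0 ysE yfull.
pose splitM := FieldExt_isSplittingField.Build F L0 ax.
pose L : splittingFieldType F := HB.pack L0 splitM.
have [gL aL] := @kummer_galois L ys bs ysE yfull.
by exists L, ys.
Qed.

(** M itself need not be Galois; it is replaced by the subfield that the roots generate. *)
Lemma kummer_ext (M : fieldExtType F) (zs : seq M) (bs : seq F) :
  all (fun b => b != 0) bs -> map (fun x => x ^+ n) zs = map (in_alg M) bs ->
  exists (L : splittingFieldType F) (ys : seq L),
    [/\ map (fun x => x ^+ n) ys = map (in_alg L) bs, <<1 & ys>>%VS = fullv,
       galois 1 {:L} & abelian 'Gal({:L} / 1)].
Proof.
move=> bs0 zsE; pose Lp : fieldExtType F := subvs_of <<1 & zs>>.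
pose ys : seq Lp := map (vsproj <<1 & zs>>) zs.
have vys : map vsval ys = zs.
  rewrite /ys -map_comp map_id_in // => x xzs /=.
  by rewrite vsprojK // seqv_sub_adjoin.
clearbody ys.
have ysE : map (fun x => x ^+ n) ys = map (in_alg Lp) bs.
  apply: (inj_map (can_inj (@vsvalK _ _ _))).
  rewrite -!map_comp [RHS](_ : _ = map (in_alg M) bs); last first.
    by apply: eq_map => b; rewrite /= algid1.
  by rewrite -zsE -[X in _ = map _ X]vys -!map_comp; apply: eq_map => x /=; rewrite rmorphXn.
have yfull : <<1 & ys>>%VS = fullv :> {vspace Lp}.
  pose toL := linfun (vsval : Lp -> M).
  apply/vspaceP => u; rewrite memvf.
  have : val u \in (toL @: <<1 & ys>>)%VS.
    rewrite aimg_adjoin_seq aimg1 (_ : map toL ys = zs) ?(valP u) //.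
    by rewrite -[RHS]vys; apply: eq_map => x; rewrite lfunE.
  by case/memv_imgP => x xK; rewrite lfunE => /val_inj ->.
exact: kummer_pack ysE yfull.
Qed.

End Kummer.

Section CyclicKummer.
Variables (F : fieldType) (n : nat) (z : F).
Hypothesis zP : n.-primitive_root z.
Variables (L : splittingFieldType F) (y : L) (b : F).
Hypotheses (b0 : b != 0) (yE : y ^+ n = b%:A) (yfull : <<1; y>>%VS = fullv).
Hypothesis gal1 : galois 1 {:L}.

Let n_gt0 : (0 < n)%N. Proof. exact: prim_order_gt0 zP. Qed.

Lemma kummer_neq0 : y != 0.
Proof.
apply/eqP => y0; move: yE; rewrite y0 expr0n gtn_eqF // => /esym/eqP.
by rewrite -[b%:A]/(in_alg L b) fmorph_eq0 (negPf b0).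
Qed.

Lemma kummer_gal_scale (s : gal_of {:L}) : exists2 c : F, c ^+ n = 1 & s y = c *: y.
Proof.
have sy : (s y) ^+ n = b%:A by rewrite -rmorphXn yE; exact: rmorph_alg.
have : root ('X^n - (y ^+ n)%:P) (s y).
  by apply/rootP; rewrite !(hornerE, hornerXn) sy yE subrr.
rewrite (XnsubC_prod zP) ?kummer_neq0 // -(big_map (fun i : 'I_n => z%:A ^+ i * y)
  xpredT (fun x => 'X - x%:P)) root_prod_XsubC => /mapP[i _ ->].
exists (z ^+ i); first by rewrite exprAC (prim_expr_order zP) expr1n.
by rewrite -[z%:A]/(in_alg L z) -rmorphXn /= mulr_algl.
Qed.

Lemma card_gal1 : #|'Gal({:L} / 1)%g| = \dim {:L}.
Proof. by rewrite -galois_dim // dimv1 divn1. Qed.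

Lemma galNorm_scale (c : F) (x : L) :
  galNorm 1 {:L} (c *: x) = c ^+ \dim {:L} *: galNorm 1 {:L} x.
Proof.
rewrite /galNorm -card_gal1 -prodr_const -scaler_prod.
by apply: eq_bigr => s _; rewrite linearZ.
Qed.

Lemma galNorm_in (x : L) : exists c : F, galNorm 1 {:L} x = c%:A.
Proof. by have /vlineP := mem_galNorm gal1 (memvf x). Qed.

(** The norm c of y satisfies c^n = N(y^n) = N(b) = b^[L:F]; this yields the lower bound for the
    degree in [kummer_dim]. *)
Lemma kummer_norm_power : exists c : F, c ^+ n = b ^+ \dim {:L}.
Proof.
have [c cE] := galNorm_in y; exists c; apply: (fmorph_inj (in_alg L)).
rewrite !rmorphXn /= -cE -yE /galNorm -prodrXl -card_gal1 -prodr_const.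
by apply: eq_bigr => s _; rewrite -rmorphXn yE; exact: rmorph_alg.
Qed.

Lemma adjoin_degree_dim : adjoin_degree 1 y = \dim {:L}.
Proof. by rewrite adjoin_degreeE yfull dimv1 divn1. Qed.

Lemma kummer_root : root (map_poly (in_alg L) ('X^n - b%:P)) y.
Proof.
apply/rootP; rewrite rmorphB /= map_polyXn map_polyC /= !(hornerE, hornerXn).
by rewrite yE subrr.
Qed.

Hypothesis bdeg : forall m c, c ^+ n = b ^+ m -> (n %| m)%N.

(** y is a root of X^n - b, so the degree is at most n. The hypothesis [bdeg] says that b has order
    n modulo n-th powers, and with the norm of y it shows that n divides the degree. *)
Lemma kummer_dim : \dim {:L} = n.
Proof.
have dimn : (\dim {:L} <= n)%N.
  have : minPoly 1 y %| map_poly (in_alg L) ('X^n - b%:P).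
    apply: minPoly_dvdp kummer_root; apply/polyOver1P.
    by exists ('X^n - b%:P).
  move/dvdp_leq; rewrite size_minPoly adjoin_degree_dim size_map_poly.
  rewrite size_XnsubC // ltnS; apply.
  by rewrite map_poly_eq0 -size_poly_gt0 size_XnsubC.
have [c /bdeg h] := kummer_norm_power.
by apply/eqP; rewrite eqn_leq dimn dvdn_leq ?adim_gt0.
Qed.

(** The n conjugates of y are distinct, hence are all the roots of X^n - b. Evaluating at 0 gives
    the product of the - s y directly, whatever the parity of n. *)
Lemma kummer_norm : galNorm 1 {:L} (- y) = (- b)%:A.
Proof.
pose rs := [seq s y | s : gal_of {:L} <- enum 'Gal({:L} / 1)%g].
have szr : size rs = n by rewrite size_map -cardE card_gal1 kummer_dim.
have Urs : uniq rs.
  rewrite map_inj_in_uniq ?enum_uniq // => s t; rewrite !mem_enum => sG tG e.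
  apply/eqP; have := @gal_adjoin_eq _ _ 1%AS y; rewrite -yfull in s t sG tG e *.
  by move=> ->; rewrite ?e.
have sz : size ('X^n - (b%:A : L)%:P) = n.+1 by rewrite size_XnsubC.
have PE : 'X^n - (b%:A : L)%:P = \prod_(r <- rs) ('X - r%:P).
  rewrite [LHS](@all_roots_prod_XsubC _ _ rs); first last.
  - by rewrite uniq_rootsE.
  - apply/allP => _ /mapP[s _ ->]; apply/rootP.
    rewrite !(hornerE, hornerXn) -rmorphXn yE.
    by apply/eqP; rewrite subr_eq0; apply/eqP; exact: rmorph_alg.
  - by rewrite szr.
  by rewrite lead_coefE sz /= coefB coefXn eqxx coefC gtn_eqF // subr0 scale1r.
have := congr1 (fun Q => Q.[0]) PE; rewrite /= !(hornerE, hornerXn) expr0n.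
rewrite gtn_eqF // ?sub0r ?add0r horner_prod big_map big_enum /= => e.
rewrite /galNorm scaleNr e; apply: eq_bigr => s _.
by rewrite !hornerE rmorphN.
Qed.

End CyclicKummer.

(** If a factor of degree e has a root x, then x^(q^e - 1) = 1. With q - 1 = m n and S = 1 + q + ...
    + q^(e-1) this reads g^(m S) = 1, so n divides S; and S = e modulo n because q = 1 modulo n.
    Hence n <= e. *)
Lemma finfield_Xn_sub_gen_irr (k : finFieldType) (g : k) (n : nat) :
  (0 < n)%N -> (n %| #|k|.-1)%N -> #|k|.-1.-primitive_root g ->
  irreducible_poly ('X^n - g%:P).
Proof.
move=> n0 /dvdnP[m mE] gP.
have q1 : (0 < #|k|.-1)%N := prim_order_gt0 gP.
have m0 : (0 < m)%N by move: q1; rewrite mE; case: (m).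
have sz : size ('X^n - g%:P) = n.+1 by rewrite size_XnsubC.
have P0 : 'X^n - g%:P != 0 by rewrite -size_poly_gt0 sz.
split; first by rewrite sz.
move=> Q Q1 QP.
have Q0 : Q != 0 by apply: contraNneq P0 => Q0; rewrite Q0 dvd0p in QP.
have [|r irr_r rQ] := @irreducible_factor k Q.
  by rewrite ltn_neqAle eq_sym Q1 size_poly_gt0.
have rP := dvdp_trans rQ QP.
suff szr : (n.+1 <= size r)%N.
  rewrite -dvdp_size_eqp // sz eqn_leq -{1}sz dvdp_leq //=.
  by apply: leq_trans szr _; apply: dvdp_leq.
have r1 : (1 < size r)%N by case: irr_r.
have [L dimL [x rx _]] := irredp_FAdjoin irr_r.
have xn : x ^+ n = g%:A.
  have /rootP : root (map_poly (in_alg L) ('X^n - g%:P)) x.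
    by apply: root_dvdp rx; rewrite dvdp_map.
  rewrite rmorphB /= map_polyXn map_polyC /= !(hornerE, hornerXn).
  by move/eqP; rewrite subr_eq0 => /eqP.
set e := (size r).-1 in dimL; have e0 : (0 < e)%N by rewrite /e; case: (size r) r1.
have g0 : g != 0.
  apply/eqP => g0; have := prim_expr_order gP; rewrite g0 expr0n gtn_eqF //.
  by move/eqP; rewrite eq_sym oner_eq0.
have x0 : x != 0.
  apply/eqP => x0; move: xn; rewrite x0 expr0n gtn_eqF // => /esym/eqP.
  by rewrite -[g%:A]/(in_alg L g) fmorph_eq0 (negPf g0).
have := Fermat's_little_theorem {:L}%AS x; rewrite memvf dimL => /esym/eqP xq.
have xq1 : x ^+ (#|k| ^ e).-1 = 1.
  apply: (mulfI x0); rewrite mulr1 -exprS prednK // expn_gt0.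
  by rewrite (leq_trans q1 (leq_pred _)).
set S := (\sum_(i < e) #|k| ^ i)%N.
have : g ^+ (m * S) = 1.
  apply: (fmorph_inj (in_alg L)); rewrite rmorphXn rmorph1 /= -xn -exprM.
  by rewrite mulnA (mulnC n) -mE -predn_exp.
move/eqP; rewrite -(prim_order_dvd gP) mE dvdn_pmul2l // => nS.
have Se : (S = e %[mod n])%N.
  transitivity ((\sum_(i < e) 1) %% n)%N; last by rewrite sum1_card card_ord.
  apply/eqP; rewrite /S.
  elim/big_ind2: _ => // [a1 a2 b1 b2 /eqP h1 /eqP h2|i _].
    by rewrite -modnDm h1 h2 modnDm.
  rewrite -modnXm (_ : #|k| %% n = 1 %% n)%N ?modnXm ?exp1n //.
  have -> : #|k| = (m * n + 1)%N by rewrite -mE addn1 prednK // (leq_trans q1 (leq_pred _)).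
  by rewrite modnMDl.
move: nS; rewrite /dvdn Se -/(n %| e)%N => /dvdn_leq -/(_ e0).
by rewrite /e; case: (size r) r1.
Qed.

Lemma one_plus_mul (A : comNzRingType) (a S T : A) :
  (1 + a * S) * (1 + a * T) = 1 + a * (S + T + a * (S * T)).
Proof. ring. Qed.

(** * Integral polynomials and the unramified extension F(g^(1/n)) *)

Section IntegralPoly.
Variables (p : nat) (F : padicField p).
Local Notation v := (@Defs.pval p F).
Local Notation red := (@presred p F).

Definition integral_poly (Q : {poly F}) := forall i, vge 0 Q`_i.

(** [red] is a ring morphism on the valuation ring only, so coefficients are reduced one by one, and
    the morphism laws below are for integral polynomials. *)
Definition red_poly (Q : {poly F}) : {poly pres F} := \poly_(i < size Q) red Q`_i.

Lemma coef_red_poly Q i : (red_poly Q)`_i = red Q`_i.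
Proof. by rewrite coef_poly; case: ltnP => // h; rewrite nth_default // red0. Qed.

Lemma integral_polyD P Q : integral_poly P -> integral_poly Q -> integral_poly (P + Q).
Proof. by move=> hP hQ i; rewrite coefD; apply: vgeD. Qed.

Lemma integral_polyB P Q : integral_poly P -> integral_poly Q -> integral_poly (P - Q).
Proof. by move=> hP hQ i; rewrite coefB; apply: vgeB. Qed.

Lemma integral_polyM P Q : integral_poly P -> integral_poly Q -> integral_poly (P * Q).
Proof.
move=> hP hQ i; rewrite coefM; apply: vge_sum => j _.
exact: (vgeM (hP _) (hQ _)).
Qed.

Lemma integral_polyC c : vge 0 c -> integral_poly c%:P.
Proof. by move=> hc i; rewrite coefC; case: eqP => // _; apply: vge0. Qed.

Lemma integral_polyX : integral_poly 'X.
Proof. by move=> i; rewrite coefX; case: eqP => _; [apply: vge1|apply: vge0]. Qed.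

Lemma integral_polyXn j : integral_poly 'X^j.
Proof. by move=> i; rewrite coefXn; case: eqP => _; [apply: vge1|apply: vge0]. Qed.

Lemma red_polyD P Q : integral_poly P -> integral_poly Q ->
  red_poly (P + Q) = red_poly P + red_poly Q.
Proof. by move=> hP hQ; apply/polyP => i; rewrite coefD !coef_red_poly coefD redD. Qed.

Lemma red_polyB P Q : integral_poly P -> integral_poly Q ->
  red_poly (P - Q) = red_poly P - red_poly Q.
Proof. by move=> hP hQ; apply/polyP => i; rewrite coefB !coef_red_poly coefB redB. Qed.

Lemma red_polyM P Q : integral_poly P -> integral_poly Q ->
  red_poly (P * Q) = red_poly P * red_poly Q.
Proof.
move=> hP hQ; apply/polyP => i; rewrite coefM coef_red_poly coefM.
have hm (j : 'I_i.+1) : vge 0 (P`_j * Q`_(i - j)) by exact: (vgeM (hP _) (hQ _)).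
elim: (index_enum _) => [|j r IHr]; first by rewrite !big_nil red0.
rewrite !big_cons redD ?IHr //; last by apply: vge_sum.
by rewrite redM // !coef_red_poly.
Qed.

Lemma red_polyC c : red_poly c%:P = (red c)%:P.
Proof. by apply/polyP => i; rewrite coef_red_poly !coefC; case: eqP => // _; exact: red0. Qed.

Lemma red_polyXn j : red_poly 'X^j = 'X^j.
Proof.
by apply/polyP => i; rewrite coef_red_poly !coefXn; case: eqP => _; [exact: red1|exact: red0].
Qed.

Lemma red_poly_lift (Q : {poly pres F}) : exists2 P, integral_poly P & red_poly P = Q.
Proof.
have /boolp.choice[f fP] (z : pres F) : exists x, vge 0 x /\ red x = z.
  by have [x x0 xz] := red_lift z; exists x.
exists (\poly_(i < size Q) f Q`_i).
  by move=> i; rewrite coef_poly; case: ifP => _; [exact: (fP _).1|exact: vge0].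
apply/polyP => i; rewrite coef_red_poly coef_poly; case: ltnP => h.
  exact: (fP _).2.
by rewrite nth_default // red0.
Qed.

(** w^k is extracted for k the least valuation of a nonzero coefficient; a coefficient attaining it
    becomes a unit. *)
Lemma poly_primitive_part (w : F) (Q : {poly F}) : w != 0 -> v w = 1 -> Q != 0 ->
  exists k : int, exists Q1 : {poly F},
    [/\ Q = (w ^ k) *: Q1, integral_poly Q1, red_poly Q1 != 0 & size Q1 = size Q].
Proof.
move=> w0 w1 Q0; have sQ : (0 < size Q)%N by rewrite size_poly_gt0.
have hi0 : ((size Q).-1 < size Q)%N by rewrite prednK.
have l0 : Q`_(Ordinal hi0) != 0 by rewrite -lead_coefE lead_coef_eq0.
case: (@arg_minP _ int _ (Ordinal hi0) (fun i => Q`_i != 0) (fun i => v Q`_i) l0).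
move=> i /= Qi min_i.
have wk : w ^ v Q`_i != 0 by rewrite expfz_neq0.
exists (v Q`_i), ((w ^ v Q`_i)^-1 *: Q); split.
- by rewrite scalerA mulfV // scale1r.
- move=> j; rewrite coefZ mulrC; apply: vge_unif => //.
  have [->|Qj] := eqVneq Q`_j 0; first exact: vge0.
  have hj : (j < size Q)%N by apply: contraNT Qj; rewrite -leqNgt => /leq_sizeP ->.
  by rewrite vge_nz //; apply: (min_i (Ordinal hj)).
- apply/eqP => /polyP/(_ i); rewrite coef_red_poly coef0 coefZ mulrC.
  have U : fin_unit (Q`_i / w ^ v Q`_i).
    split; first by rewrite mulf_neq0 ?invr_eq0.
    by rewrite pvalM ?invr_eq0 // pvalV // pvalXz // w1 mul1r subrr.
  by apply/eqP; exact: unit_red.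
- by rewrite size_scale ?invr_eq0.
Qed.
End IntegralPoly.

Section UnramifiedKummer.
Variables (p n : nat) (F : padicField p).
Hypotheses (n_gt0 : (0 < n)%N) (cop : coprime p n).
Hypothesis mu_full : exists z : F, n.-primitive_root z.
Local Notation v := (@Defs.pval p F).
Local Notation red := (@presred p F).
Local Notation q := (residue_card F).
Variables (w g : F).
Hypotheses (w0 : w != 0) (w1 : v w = 1).
Hypotheses (gU : fin_unit g) (gP : q.-1.-primitive_root (red g)).

(** Raising to the power (q - 1) / n makes the left side 1 in the residue field, where g has order q
    - 1. *)
Lemma gen_degree m (c : F) : c ^+ n = g ^+ m -> (n %| m)%N.
Proof.
move=> cE; have cU : fin_unit c.
  have [g0 vg] := fin_unitX m gU.
  have c0 : c != 0 by apply: contraNneq g0 => c0; rewrite -cE c0 expr0n gtn_eqF.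
  split=> //; have := pvalX n c0; rewrite cE vg => /esym/eqP.
  by rewrite mulf_eq0 => /orP[/eqP//|]; lia.
have /dvdnP[m' mE] := n_dvd_card n_gt0 cop mu_full.
have q1 := prim_order_gt0 gP.
have : red g ^+ (m * m') == 1.
  rewrite exprM -(redX m (fin_unit_vge gU)) -cE (redX n (fin_unit_vge cU)) -exprM mulnC -mE.
  apply/eqP; apply: (mulfI (unit_red cU)); rewrite mulr1 -exprS prednK.
    by rewrite /residue_card expf_card.
  by rewrite (leq_trans q1 (leq_pred _)).
rewrite -(prim_order_dvd gP) mE (mulnC m) dvdn_pmul2l //.
by move: q1; rewrite mE; case: (m').
Qed.

Variables (L : splittingFieldType F) (y : L).
Hypotheses (yE : y ^+ n = g%:A) (yfull : <<1; y>>%VS = fullv).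
Hypothesis gal1 : galois 1 {:L}.
Local Notation ev Q := (map_poly (in_alg L) Q).[y].
Local Notation Nm := (galNorm 1 {:L}).

Let g0 : g != 0. Proof. by case: gU. Qed.

Lemma unram_dim : \dim {:L} = n.
Proof. by case: mu_full => z zP; apply: (kummer_dim zP yE yfull gal1 gen_degree). Qed.

(* O[y] turns out to be the ring of integers of L, as g generates the residue field. *)
Definition integral_ext (x : L) :=
  exists Q : {poly F}, [/\ integral_poly Q, (size Q <= n)%N & x = ev Q].

Lemma evD P Q : ev (P + Q) = ev P + ev Q.
Proof. by rewrite rmorphD hornerD. Qed.
Lemma evM P Q : ev (P * Q) = ev P * ev Q.
Proof. by rewrite rmorphM hornerM. Qed.
Lemma evC c : ev c%:P = c%:A.
Proof. by rewrite map_polyC hornerC. Qed.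
Lemma evB P Q : ev (P - Q) = ev P - ev Q.
Proof. by rewrite rmorphB hornerD hornerN. Qed.
Lemma evXn i : ev 'X^i = y ^+ i.
Proof. by rewrite map_polyXn hornerXn. Qed.
Lemma evX : ev 'X = y.
Proof. by rewrite map_polyX hornerX. Qed.

Lemma integral_extD x x' : integral_ext x -> integral_ext x' -> integral_ext (x + x').
Proof.
move=> [P [hP sP ->]] [Q [hQ sQ ->]]; exists (P + Q); split; last by rewrite evD.
  exact: integral_polyD.
by rewrite (leq_trans (size_polyD _ _)) // geq_max sP.
Qed.

Lemma integral_extZ c x : vge 0 c -> integral_ext x -> integral_ext (c *: x).
Proof.
move=> hc [P [hP sP ->]]; exists (c *: P); split.
- by move=> i; rewrite coefZ; apply: (vgeM hc (hP i)).
- by rewrite (leq_trans (size_scale_leq _ _)).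
- by rewrite -mul_polyC evM evC mulr_algl.
Qed.

Lemma integral_ext1 : integral_ext 1.
Proof.
exists 1%:P; split; first by apply: integral_polyC; apply: vge1.
  by rewrite (leq_trans (size_polyC_leq1 _)).
by rewrite evC scale1r.
Qed.

(** The coefficient that reaches degree n is brought back to degree 0 by y^n = g, with g
    integral. *)
Lemma integral_ext_y x : integral_ext x -> integral_ext (y * x).
Proof.
move=> [P [hP sP ->]].
exists ('X * P - (P`_n.-1)%:P * ('X^n - g%:P)); split.
- apply: integral_polyB; first by apply: integral_polyM => //; apply: integral_polyX.
  apply: integral_polyM; first by apply: integral_polyC.
  apply: integral_polyB; first exact: integral_polyXn.
  by apply: integral_polyC; apply: fin_unit_vge.
- apply/leq_sizeP => j hj; rewrite coefB coefXM coefCM coefB coefXn coefC.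
  have -> : (j == 0%N) = false by rewrite gtn_eqF // (leq_trans n_gt0).
  rewrite subr0.
  have [->|nj] := eqVneq j n; first by rewrite mulr1 subrr.
  rewrite mulr0 subr0 nth_default // (leq_trans sP) //.
  by move: nj hj; lia.
- rewrite evB !evM evX evC evB.
  by rewrite evXn evC yE subrr mulr0 subr0.
Qed.

Lemma integral_extM x x' : integral_ext x -> integral_ext x' -> integral_ext (x * x').
Proof.
move=> [P [hP sP ->]] hx'; rewrite horner_coef mulr_suml.
elim/big_ind: _ => [|a b|i _].
- rewrite -(scale0r (1 : L)); apply: integral_extZ integral_ext1; exact: vge0.
- exact: integral_extD.
- rewrite coef_map /= mulr_algl -scalerAl; apply: integral_extZ; first exact: hP.
  elim: (nat_of_ord i) => [|j IHj]; first by rewrite expr0 mul1r.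
  by rewrite exprS -mulrA; apply: integral_ext_y.
Qed.

Lemma integral_ext_of_poly (Q : {poly F}) : integral_poly Q -> integral_ext (ev Q).
Proof.
move=> hQ; rewrite horner_coef; elim/big_ind: _ => [|a b|i _].
- rewrite -(scale0r (1 : L)); apply: integral_extZ integral_ext1; exact: vge0.
- exact: integral_extD.
- rewrite coef_map /= mulr_algl; apply: integral_extZ; first exact: hQ.
  rewrite -[_ ^+ _]mulr1; elim: (nat_of_ord i) => [|j IHj].
    by rewrite expr0 mul1r; apply: integral_ext1.
  by rewrite exprS -mulrA; apply: integral_ext_y.
Qed.

Lemma integral_ext_gal (s : gal_of {:L}) x : integral_ext x -> integral_ext (s x).
Proof.
move=> [P [hP sP ->]]; have [z zP] := mu_full.
have [c cn sy] := kummer_gal_scale zP g0 yE s.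
rewrite -horner_map -map_poly_comp (eq_map_poly (g := in_alg L)); last first.
  by move=> a; exact: rmorph_alg.
rewrite [X in _.[X]](_ : _ = c *: y) ?horner_coef; last exact: sy.
elim/big_ind: _ => [|a b|i _].
- rewrite -(scale0r (1 : L)); apply: integral_extZ integral_ext1; exact: vge0.
- exact: integral_extD.
- rewrite coef_map /= mulr_algl; apply: integral_extZ; first exact: hP.
  elim: (nat_of_ord i) => [|j IHj]; first by rewrite expr0; apply: integral_ext1.
  rewrite exprS -scalerAl; apply: integral_extZ; last exact: integral_ext_y.
  by apply: fin_unit_vge; apply: (root1_unit n_gt0).
Qed.

(** 1, y, ..., y^(n-1) are independent over F since the degree is n, so the polynomial representing
    c is constant. *)
Lemma integral_ext_base (c : F) : integral_ext c%:A -> vge 0 c.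
Proof.
move=> [Q [hQ sQ cE]]; suff -> : c = Q`_0 by exact: hQ.
have [z zP] := mu_full.
have : map_poly (in_alg L) (Q - c%:P) == 0.
  rewrite -(@root_small_adjoin_poly _ _ 1%AS y).
  - by apply/rootP; rewrite evB evC -cE subrr.
  - by apply/polyOver1P; exists (Q - c%:P).
  - rewrite (adjoin_degree_dim yfull) unram_dim size_map_poly.
    rewrite (leq_trans (size_polyD _ _)) // geq_max sQ size_polyN.
    by rewrite (leq_trans (size_polyC_leq1 _)).
rewrite map_poly_eq0 => /eqP/polyP/(_ 0%N); rewrite coefB coefC /= coef0.
by move/eqP; rewrite subr_eq0 => /eqP.
Qed.

Lemma integral_ext_norm x c : integral_ext x -> norm_is x c -> vge 0 c.
Proof.
move=> hx cE; apply: integral_ext_base; rewrite -cE /galNorm.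
by elim/big_ind: _ => [||s _]; [exact: integral_ext1|exact: integral_extM|
  exact: integral_ext_gal].
Qed.

(** Every conjugate of 1 + w x has the same shape, hence so does the norm; being in F, it lies in 1
    + P. *)
Lemma one_integral_norm x c : integral_ext x -> norm_is (1 + w *: x) c -> fin_unit c.
Proof.
move=> hx cE.
have [S hS SE] : exists2 S, integral_ext S & Nm (1 + w *: x) = 1 + w *: S.
  rewrite /galNorm; elim/big_ind: _ => [|_ _ [S hS ->] [T hT ->]|s _].
  - exists 0; last by rewrite scaler0 addr0.
    by rewrite -(scale0r (1 : L)); apply: integral_extZ integral_ext1; exact: vge0.
  - exists (S + T + w *: (S * T)).
      apply: integral_extD; first exact: integral_extD.
      by apply: integral_extZ; [rewrite vge_nz // w1|exact: integral_extM].
    rewrite -(mulr_algl w S) -(mulr_algl w T) -(mulr_algl w (S * T)) -(mulr_algl w (_ + _)).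
    exact: one_plus_mul.
  - exists (s x); first exact: integral_ext_gal.
    by rewrite rmorphD rmorph1; congr (_ + _); exact: linearZ.
apply: one_unit; have : vge 0 ((c - 1) / w).
  apply: integral_ext_base; move: cE; rewrite /norm_is SE => cE.
  suff -> : ((c - 1) / w)%:A = S by [].
  rewrite mulrC -scalerA scalerBl -cE scale1r addrAC subrr add0r scalerA mulVf //.
  by rewrite scale1r.
move=> h; have -> : c - 1 = (c - 1) / w * w by rewrite divfK.
by apply: (vgeM h (vge_v w)); rewrite w1.
Qed.

Lemma ext_poly x : exists2 Q : {poly F}, (size Q <= n)%N & x = ev Q.
Proof.
have xy : x \in <<1; y>>%VS by rewrite yfull memvf.
have /polyOver1P[Q QE] := Fadjoin_polyOver 1 y x.
exists Q; last by rewrite -QE Fadjoin_poly_eq.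
have := size_Fadjoin_poly 1 y x.
by rewrite (adjoin_degree_dim yfull) unram_dim QE size_map_poly.
Qed.

(** Modulo P, Q is a nonzero polynomial of degree less than n, hence prime to the irreducible X^n -
    g. A Bezout relation lifts to an integral [A1] with A1(y) Q(y) in 1 + w O[y], whose norm is a
    unit; both factors have integral norms, so both norms are units. *)
Lemma unram_primitive Q c : integral_poly Q -> red_poly Q != 0 -> (size Q <= n)%N ->
  norm_is (ev Q) c -> fin_unit c.
Proof.
move=> hQ Q0 sQ cE.
have irr := finfield_Xn_sub_gen_irr n_gt0 (n_dvd_card n_gt0 cop mu_full) gP.
set X := 'X^n - _ in irr; have sX : size X = n.+1 by rewrite size_XnsubC.
have copQ : coprimep (red_poly Q) X.
  rewrite coprimep_sym /coprimep; have gX := dvdp_gcdl X (red_poly Q).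
  apply: contraT => /(irr.2 _)/(_ gX) e.
  have : X %| red_poly Q by rewrite -(eqp_dvdl _ e) dvdp_gcdr.
  move/dvdp_leq => /(_ Q0); rewrite sX leqNgt ltnS.
  by rewrite (leq_trans (size_poly _ _) sQ).
have /Bezout_coprimepP[[U V]] := copQ; rewrite -size_poly_eq1.
case/size_poly1P => e e0 /= UV.
have [A1 hA1 A1E] := red_poly_lift (e^-1 *: U).
have [A2 hA2 A2E] := red_poly_lift (e^-1 *: V).
have hX : integral_poly ('X^n - g%:P).
  apply: integral_polyB; first exact: integral_polyXn.
  by apply: integral_polyC; apply: fin_unit_vge.
have rX : red_poly ('X^n - g%:P) = X.
  rewrite red_polyB ?red_polyXn ?red_polyC //; first exact: integral_polyXn.
  by apply: integral_polyC; apply: fin_unit_vge.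
pose E := A1 * Q + A2 * ('X^n - g%:P) - 1%:P.
have hE1 : integral_poly (A1 * Q + A2 * ('X^n - g%:P)).
  by apply: integral_polyD; apply: integral_polyM.
have h1 : integral_poly (1%:P : {poly F}) by apply: integral_polyC; apply: vge1.
have hE : integral_poly E by apply: integral_polyB.
have rE : red_poly E = 0.
  rewrite red_polyB // red_polyD ?red_polyM //; try exact: integral_polyM.
  rewrite A1E A2E rX red_polyC red1 -!scalerAl -scalerDr UV scale_polyC mulVf //.
  by rewrite subrr.
pose E1 := w^-1 *: E.
have hE1' : integral_poly E1.
  move=> i; rewrite coefZ mulrC -[w]expr1z; apply: vge_unif => //.
  by apply/red_eq0 => //; rewrite -coef_red_poly rE coef0.
have evE : ev A1 * ev Q = 1 + w *: ev E1.
  have : ev A1 * ev Q = 1 + ev E.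
    rewrite /E evB evD !evM evC scale1r.
    rewrite evB evXn evC yE subrr mulr0 addr0.
    by rewrite addrC subrK.
  move=> ->; congr (1 + _); rewrite -mulr_algl -(evC w) -evM mul_polyC.
  by rewrite /E1 scalerA mulfV // scale1r.
have [c1 c1E] := galNorm_in gal1 (ev A1).
have u1 : fin_unit (c1 * c).
  apply: (one_integral_norm (integral_ext_of_poly hE1')).
  rewrite /norm_is -evE galNormM c1E cE -[(c1 * c)%:A]/(in_alg L (c1 * c)).
  by rewrite rmorphM.
have v1 := integral_ext_norm (integral_ext_of_poly hA1) c1E.
have v2 : vge 0 c by apply: (integral_ext_norm _ cE); apply: integral_ext_of_poly.
case: u1; rewrite mulf_eq0 negb_or => /andP[c10 c0]; rewrite pvalM //.
move: v1 v2; rewrite !vge_nz // => v1 v2 s; split=> //; lia.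
Qed.

(** By [unram_primitive], x is w^k times an element of unit norm, so its norm has valuation n k. *)
Lemma unram_gen : unramified L.
Proof.
move=> x c x0 cE; have [Q sQ xE] := ext_poly x.
have Q0 : Q != 0.
  by apply: contra_neq x0 => Q0; rewrite xE Q0 rmorph0 horner0.
have [k [Q1 [QE hQ1 rQ1 sQ1]]] := poly_primitive_part w0 w1 Q0.
have xE' : x = (w ^ k) *: ev Q1 by rewrite xE QE -mul_polyC evM evC mulr_algl.
have [c1 c1E] := galNorm_in gal1 (ev Q1).
have sQ1n : (size Q1 <= n)%N by rewrite sQ1.
have [c10 vc1] := unram_primitive hQ1 rQ1 sQ1n c1E.
have cE' : c = (w ^ k) ^+ n * c1.
  apply: (fmorph_inj (in_alg L)); rewrite /= -[LHS]cE xE'.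
  rewrite (galNorm_scale gal1) c1E unram_dim scalerA.
  by [].
by rewrite unram_dim cE' pvalM ?expf_neq0 ?expfz_neq0 // vc1 addr0 pvalX ?expfz_neq0 // dvdz_mull.
Qed.
End UnramifiedKummer.

(** * The tame Hilbert symbol *)

Section Hilbert.
Variables (p n : nat) (F : padicField p).
Hypotheses (n_gt0 : (0 < n)%N) (cop : coprime p n).
Hypothesis mu_full : exists z : F, n.-primitive_root z.
Local Notation v := (@Defs.pval p F).
Local Notation red := (@presred p F).
Local Notation q := (residue_card F).
Variable hilb : F -> F -> mu F n.
Hypothesis hilbP : is_hilbert_symbol hilb.
Local Notation h a b := (mu_val (hilb a b)).
Implicit Types (a b c u w : F).

Lemma kummer_abelian (M : fieldExtType F) (zs : seq M) (bs : seq F) :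
  all (fun b => b != 0) bs -> map (fun x => x ^+ n) zs = map (in_alg M) bs ->
  exists (L : splittingFieldType F) (ys : seq L),
    [/\ map (fun x => x ^+ n) ys = map (in_alg L) bs, <<1 & ys>>%VS = fullv &
       abelian_ext L].
Proof.
move=> bs0 zsE; have [z zP] := mu_full.
have [L [ys [h1 h2 h3 h4]]] := kummer_ext zP (padic_char0 (padicP F)) bs0 zsE.
by exists L, ys; split.
Qed.

Lemma kummer1 (b : F) : b != 0 -> exists (L : splittingFieldType F) (y : L),
  [/\ y ^+ n = b%:A, <<1; y>>%VS = fullv & abelian_ext L].
Proof.
move=> b0; have [M [z zE]] := root_ext b n_gt0.
have [||L [ys [h1 h2 h3]]] := @kummer_abelian M [:: z] [:: b].
- by rewrite /= b0.
- by rewrite /= zE.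
case: ys h1 h2 => [//|y [|//]] [h1] h2; exists L, y; split=> //.
by rewrite -h2 adjoin_seq1.
Qed.

Lemma kummer2 (b1 b2 : F) : b1 != 0 -> b2 != 0 ->
  exists (L : splittingFieldType F) (y1 y2 : L),
  [/\ y1 ^+ n = b1%:A, y2 ^+ n = b2%:A & abelian_ext L].
Proof.
move=> b10 b20; have [M [z1 [z2 [zE1 zE2]]]] := root_ext2 b1 b2 n_gt0.
have [||L [ys [h1 h2 h3]]] := @kummer_abelian M [:: z1; z2] [:: b1; b2].
- by rewrite /= b10 b20.
- by rewrite /= zE1 zE2.
by case: ys h1 h2 => [//|y1 [//|y2 [|//]]] [h1 h1'] h2; exists L, y1, y2.
Qed.

Lemma hilb_neq0 a b : h a b != 0.
Proof. by case/andP: (mu_valP (hilb a b)). Qed.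

Lemma hilb_exp a b : h a b ^+ n = 1.
Proof. by case/andP: (mu_valP (hilb a b)) => _ /eqP. Qed.

Lemma root_neq0 (L : fieldExtType F) (b : F) (y : L) :
  b != 0 -> y ^+ n = b%:A -> y != 0.
Proof.
move=> b0 yE; apply/eqP => y0; move: yE; rewrite y0 expr0n gtn_eqF // => /esym/eqP.
by rewrite -[b%:A]/(in_alg L b) fmorph_eq0 (negPf b0).
Qed.

Lemma scale_root_inj (L : fieldExtType F) (c d : F) (y : L) :
  y != 0 -> c *: y = d *: y -> c = d.
Proof.
move=> y0 /eqP; rewrite -subr_eq0 -scalerBl scaler_eq0 (negPf y0) orbF subr_eq0.
by move/eqP.
Qed.

Lemma hilbMl a a' b : a != 0 -> a' != 0 -> b != 0 -> h (a * a') b = h a b * h a' b.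
Proof.
move=> a0 a'0 b0; have [art artP hE] := hilbP.
have [L [y [yE yfull abL]]] := kummer1 b0; apply: (scale_root_inj (root_neq0 b0 yE)).
rewrite -(hE _ _ (mulf_neq0 a0 a'0) b0 _ _ abL yE) (art_morph artP abL a0 a'0).
rewrite galM ?memvf // (hE _ _ a0 b0 _ _ abL yE) linearZ /=.
by rewrite (hE _ _ a'0 b0 _ _ abL yE) scalerA.
Qed.

Lemma hilbMr a b b' : a != 0 -> b != 0 -> b' != 0 -> h a (b * b') = h a b * h a b'.
Proof.
move=> a0 b0 b'0; have [art artP hE] := hilbP.
have [L [y [y' [yE y'E abL]]]] := kummer2 b0 b'0.
have yy : (y * y') ^+ n = (b * b')%:A.
  by rewrite exprMn yE y'E -[RHS]/(in_alg L (b * b')) rmorphM.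
have bb := mulf_neq0 b0 b'0; apply: (scale_root_inj (root_neq0 bb yy)).
rewrite -(hE _ _ a0 bb _ _ abL yy) rmorphM /=.
rewrite (hE _ _ a0 b0 _ _ abL yE) (hE _ _ a0 b'0 _ _ abL y'E).
by rewrite -scalerAl -scalerAr scalerA.
Qed.

Lemma hilb1l b : b != 0 -> h 1 b = 1.
Proof.
move=> b0; have := hilbMl (oner_neq0 _) (oner_neq0 _) b0; rewrite mulr1.
by move/esym/(canRL (mulKf (hilb_neq0 1 b))); rewrite mulVf ?hilb_neq0.
Qed.

Lemma hilb1r a : a != 0 -> h a 1 = 1.
Proof.
move=> a0; have := hilbMr a0 (oner_neq0 _) (oner_neq0 _); rewrite mulr1.
by move/esym/(canRL (mulKf (hilb_neq0 a 1))); rewrite mulVf ?hilb_neq0.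
Qed.

Lemma hilbVl a b : a != 0 -> b != 0 -> h a^-1 b = (h a b)^-1.
Proof.
move=> a0 b0; apply: (mulfI (hilb_neq0 a b)).
by rewrite -hilbMl ?invr_eq0 // !mulfV ?hilb1l // hilb_neq0.
Qed.

Lemma hilbVr a b : a != 0 -> b != 0 -> h a b^-1 = (h a b)^-1.
Proof.
move=> a0 b0; apply: (mulfI (hilb_neq0 a b)).
by rewrite -hilbMr ?invr_eq0 // !mulfV ?hilb1r // hilb_neq0.
Qed.

Lemma hilbXl a b i : a != 0 -> b != 0 -> h (a ^+ i) b = h a b ^+ i.
Proof.
move=> a0 b0; elim: i => [|i IHi]; first by rewrite !expr0 hilb1l.
by rewrite !exprS hilbMl ?expf_neq0 // IHi.
Qed.

Lemma hilbXr a b i : a != 0 -> b != 0 -> h a (b ^+ i) = h a b ^+ i.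
Proof.
move=> a0 b0; elim: i => [|i IHi]; first by rewrite !expr0 hilb1r.
by rewrite !exprS hilbMr ?expf_neq0 // IHi.
Qed.

Lemma hilb_npow_l c b : c != 0 -> b != 0 -> h (c ^+ n) b = 1.
Proof. by move=> c0 b0; rewrite hilbXl // hilb_exp. Qed.

Lemma hilb_npow_r a c : a != 0 -> c != 0 -> h a (c ^+ n) = 1.
Proof. by move=> a0 c0; rewrite hilbXr // hilb_exp. Qed.

(* -b is the norm of - b^(1/n), from an extension of degree n. *)
Lemma hilb_norm b : b != 0 -> (forall m c, c ^+ n = b ^+ m -> (n %| m)%N) ->
  h (- b) b = 1.
Proof.
move=> b0 bdeg; have [art artP hE] := hilbP; have [z zP] := mu_full.
have [L [y [yE yfull abL]]] := kummer1 b0; have [gal1 _] := abL.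
have y0 := root_neq0 b0 yE; apply: (scale_root_inj y0).
have Nb0 : - b != 0 by rewrite oppr_eq0.
rewrite -(hE _ _ Nb0 b0 _ _ abL yE) (art_norm artP abL (x := - y)).
- by rewrite gal_id scale1r.
- by rewrite oppr_eq0.
- by rewrite /norm_is (kummer_norm zP yE yfull gal1 bdeg).
Qed.

Lemma unif_degree w m c : w != 0 -> v w = 1 -> c ^+ n = w ^+ m -> (n %| m)%N.
Proof.
move=> w0 w1 cE; have c0 : c != 0.
  by apply: contraNneq (expf_neq0 m w0) => c0; rewrite -cE c0 expr0n gtn_eqF.
have := pvalX n c0; rewrite cE pvalX // w1 mul1r => mE.
have : (n%:Z %| m%:Z)%Z by rewrite mE dvdz_mull.
by rewrite /dvdz.
Qed.

(** [hilb_norm] applies to - w: valuations show that it has order n modulo n-th powers. *)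
Lemma hilb_unif w : w != 0 -> v w = 1 -> h w (- w) = 1.
Proof.
move=> w0 w1; have := @hilb_norm (- w); rewrite opprK; apply.
  by rewrite oppr_eq0.
by move=> m c; apply: unif_degree; rewrite ?oppr_eq0 ?pvalN.
Qed.

(** The tame symbol formula: the Frobenius sends y = g^(1/n) to y^q modulo the maximal ideal, and
    y^q = g^((q - 1) / n) y. *)
Lemma hilb_frobenius_red g w : fin_unit g -> q.-1.-primitive_root (red g) ->
  w != 0 -> v w = 1 -> red (h w g) = red g ^+ (q.-1 %/ n).
Proof.
move=> gU gP w0 w1; have [art artP hE] := hilbP; have [g0 vg] := gU.
have [L [y [yE yfull abL]]] := kummer1 g0; have [gal1 _] := abL.
have unr := unram_gen n_gt0 cop mu_full w0 w1 gU gP yE yfull gal1.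
have dimL := unram_dim n_gt0 cop mu_full w0 w1 gU gP yE yfull gal1.
have yint : integral_ext n y y.
  rewrite -[X in integral_ext _ _ X]mulr1.
  exact: (integral_ext_y n_gt0 cop w0 w1 gU gP yE gal1 (integral_ext1 n_gt0 _)).
have normint := integral_ext_norm n_gt0 cop mu_full w0 w1 gU gP yE yfull gal1.
have [c cE] := galNorm_in gal1 y.
have cU : fin_unit c.
  have cn : c ^+ n = g ^+ n.
    apply: (fmorph_inj (in_alg L)); rewrite !rmorphXn /= -cE /galNorm -prodrXl.
    rewrite -[X in _ = _ ^+ X]dimL -(card_gal1 gal1) -prodr_const.
    by apply: eq_bigr => s _; rewrite -rmorphXn yE; exact: rmorph_alg.
  have c0 : c != 0.
    by apply: contraNneq (expf_neq0 n g0) => c0; rewrite -cn c0 expr0n gtn_eqF.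
  split=> //; have := pvalX n c0; rewrite cn pvalX // vg mul0r => /esym/eqP.
  by rewrite mulf_eq0 => /orP[/eqP//|]; lia.
set m := (q.-1 %/ n)%N; have mE : (q.-1 = m * n)%N.
  by rewrite divnK // (n_dvd_card n_gt0 cop mu_full).
have yq : y ^+ q = g ^+ m *: y.
  rewrite -(@prednK q) ?(ltnW (card_residue_gt1 F)) // mE exprS mulnC exprM yE.
  rewrite -[g%:A]/(in_alg L g) -rmorphXn /= mulrC mulr_algl.
  by [].
have := art_frob artP abL unr w0 w1 (x := y).
rewrite (hE _ _ w0 g0 _ _ abL yE) yq -scalerBl => frob.
have hyp : ext_vge 0 y by move=> c' c'E; rewrite mul0r; apply: normint c'E.
have hU := root1_unit n_gt0 cop (hilb_exp w g).
have gmU := fin_unitX m gU.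
suff : vge 1 (h w g - g ^+ m).
  by move/(red_eq (fin_unit_vge hU) (fin_unit_vge gmU)) ->; rewrite (redX m (fin_unit_vge gU)).
have [e0|e0] := eqVneq (h w g - g ^+ m) 0; first by rewrite e0; apply: vge0.
(* Congruences in L are read off norms: this norm is the n-th power of the difference times a unit,
   so valuation at least n puts the difference into P. *)
have /(frob hyp) : norm_is ((h w g - g ^+ m) *: y) ((h w g - g ^+ m) ^+ n * c).
  by rewrite /norm_is (galNorm_scale gal1) cE scalerA dimL.
have [c0 vc] := cU.
rewrite dimL mul1r !vge_nz ?mulf_neq0 ?expf_neq0 // pvalM ?expf_neq0 // vc addr0.
rewrite pvalX //; nia.
Qed.

Section Gen.
Variables (g w : F).
Hypotheses (gU : fin_unit g) (gP : q.-1.-primitive_root (red g)).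
Hypotheses (w0 : w != 0) (w1 : v w = 1).

Let g0 : g != 0. Proof. by case: gU. Qed.

(** Both symbols reduce to the same power of g, and reduction is injective on n-th roots of
    unity. *)
Lemma hilb_unif_gen w' : w' != 0 -> v w' = 1 -> h w' g = h w g.
Proof.
move=> w'0 w'1.
have U a b := root1_unit n_gt0 cop (hilb_exp a b).
suff : h w' g / h w g = 1.
  by move/(canRL (divfK (hilb_neq0 w g))); rewrite mul1r.
have U1 : fin_unit (h w' g / h w g) by apply: fin_unitM; last apply: fin_unitV.
apply: (one_unit_root_eq1 n_gt0 cop).
  by rewrite exprMn exprVn !hilb_exp invr1 mulr1.
apply/red_eq; first exact: fin_unit_vge.
  exact: vge1.
apply: (mulIf (unit_red (U w g))); rewrite -(redM (fin_unit_vge U1) (fin_unit_vge (U w g))) divfK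
  ?hilb_neq0 //.
by rewrite red1 mul1r !hilb_frobenius_red.
Qed.

(** w u is a uniformizer too, so (w u, g) = (w, g). *)
Lemma hilb_unit_gen u : fin_unit u -> h u g = 1.
Proof.
move=> [u0 vu]; apply: (mulfI (hilb_neq0 w g)); rewrite mulr1 -hilbMl //.
by apply: hilb_unif_gen; rewrite ?mulf_neq0 // pvalM // vu addr0.
Qed.

(** Nondegeneracy of the symbol: the residue g^((q - 1) / n) has order exactly n. *)
Lemma hilb_unif_gen_prim : n.-primitive_root (h w g).
Proof.
apply/andP; split=> //; apply/forallP => -[i /= hi]; apply/eqP.
rewrite unity_rootE; have [->|ne] := eqVneq i.+1 n; first by rewrite hilb_exp eqxx.
apply/negbTE/eqP => hi1; have := congr1 red hi1.
rewrite (redX _ (fin_unit_vge (root1_unit n_gt0 cop (hilb_exp w g)))).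
rewrite red1 hilb_frobenius_red // -exprM => /eqP.
have nd := n_dvd_card n_gt0 cop mu_full.
rewrite -(prim_order_dvd gP) -{1}(divnK nd) dvdn_pmul2l; last first.
  by rewrite divn_gt0 // dvdn_leq // (prim_order_gt0 gP).
by move/dvdn_leq => /(_ isT); move: ne hi; lia.
Qed.

End Gen.

Lemma hilb_units u u' : fin_unit u -> fin_unit u' -> h u u' = 1.
Proof.
move=> uU u'U; have [g gU gP] := unit_gen F; have [w w0 w1] := unif_ex F.
have [i [_ [c [c0 _] ->]]] := unit_decomp n_gt0 cop gU gP u'U.
have [u0 _] := uU; have [g0 _] := gU.
rewrite hilbMr ?expf_neq0 // hilb_npow_r // mulr1 hilbXr //.
by rewrite (hilb_unit_gen gU gP w0 w1 uU) expr1n.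
Qed.

Lemma hilb_unif_unit w u : w != 0 -> v w = 1 -> fin_unit u -> h w u * h u w = 1.
Proof.
move=> w0 w1 uU; have [u0 vu] := uU.
have wu1 : v (w * u) = 1 by rewrite pvalM // vu addr0.
have := hilb_unif (mulf_neq0 w0 u0) wu1.
rewrite hilbMl ?oppr_eq0 ?mulf_neq0 // -mulNr !(hilbMr, oppr_eq0, w0, u0) //=.
rewrite hilb_unif // mul1r -mulN1r hilbMr ?oppr_eq0 ?oner_eq0 //.
rewrite (hilb_units uU uU) (hilb_units uU (fin_unitN (fin_unit1 F))).
by rewrite mul1r mulr1.
Qed.

(** [hilb_norm] covers only elements of order n modulo n-th powers. For b = w^k u, expanding by the
    values on w and on units leaves (w, -1)^(k + k^2), an even power of a sign. *)
Lemma hilb_N a : a != 0 -> h a (- a) = 1.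
Proof.
have pow (b : F) : b != 0 -> h b (- b) = 1 -> h b^-1 (- b^-1) = 1.
  move=> b0 hb; rewrite hilbVl ?oppr_eq0 ?invr_eq0 // -invrN hilbVr ?oppr_eq0 //.
  by rewrite hb !invr1.
suff nat_case (b : F) : b != 0 -> (0 <= v b) -> h b (- b) = 1.
  move=> a0; have [le0|gt0] := leP 0 (v a); first exact: nat_case.
  rewrite -[a]invrK; apply: pow; first by rewrite invr_eq0.
  by apply: nat_case; rewrite ?invr_eq0 // pvalV //; lia.
move=> b0 vb; have [w w0 w1] := unif_ex F.
have [u uU bE] := unif_decomp w0 w1 b0; have [u0 _] := uU.
move: bE; case: (v b) vb => // k _ bE; rewrite bE -exprnP => {b b0 bE}.
have N1 : (-1 : F) != 0 by rewrite oppr_eq0 oner_eq0.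
have wk := expf_neq0 k w0.
rewrite -mulN1r !(hilbMl, hilbMr) ?mulf_neq0 //.
rewrite (hilb_units uU uU) (hilb_units uU (fin_unitN (fin_unit1 F))) mulr1 mul1r.
rewrite !(hilbXl, hilbXr) //.
have ww : h w w * h w (-1) = 1.
  by rewrite -hilbMr // mulrN1 hilb_unif.
have hw2 : h w (-1) * h w (-1) = 1.
  by rewrite -hilbMr // mulrNN mulr1 hilb1r.
have e2 : h w w = h w (-1).
  by apply: (mulIf (hilb_neq0 w (-1))); rewrite ww hw2.
have uw := hilb_unif_unit w0 w1 uU.
rewrite !mulrA -[LHS]mulrA -(exprMn k (h w u)) uw expr1n mulr1 e2 -exprM -exprD.
have -> : (k + k * k = 2 * (k * k.+1)./2)%N.
  have := odd_double_half (k * k.+1); rewrite oddM oddS andbN add0n mul2n => ->.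
  by rewrite mulnS.
by rewrite exprM expr2 hw2 expr1n.
Qed.

Lemma hilb_anti a b : a != 0 -> b != 0 -> h a b * h b a = 1.
Proof.
move=> a0 b0; have := hilb_N (mulf_neq0 a0 b0).
rewrite hilbMl ?oppr_eq0 ?mulf_neq0 // -{1}mulNr -mulrN.
rewrite !hilbMr ?oppr_eq0 // hilb_N // hilb_N // mul1r mulr1.
by [].
Qed.

Lemma hilb_self a : a != 0 -> h a a = h a (-1).
Proof.
move=> a0; have N1 : (-1 : F) != 0 by rewrite oppr_eq0 oner_eq0.
have e : h a (-1) * h a (-1) = 1 by rewrite -hilbMr // mulrNN mulr1 hilb1r.
apply: (mulIf (hilb_neq0 a (-1))); rewrite e -hilbMr // mulrN1.
exact: hilb_N.
Qed.

Lemma hilb_one_unit_r a u : a != 0 -> vge 1 (u - 1) -> h a u = 1.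
Proof.
move=> a0 /(one_unit_npow n_gt0 cop)[c cU <-]; apply: hilb_npow_r => //.
by case: (one_unit cU).
Qed.

Lemma hilb_one_unit_l a u : a != 0 -> vge 1 (u - 1) -> h u a = 1.
Proof.
move=> a0 /(one_unit_npow n_gt0 cop)[c cU <-]; apply: hilb_npow_l => //.
by case: (one_unit cU).
Qed.

(** In the tame case this is a discussion of v(a). If a lies in P then b lies in 1 + P; if b lies in
    P, symmetrically; two units pair trivially; and if v(a) < 0 then b = - a (1 - a^-1) with 1 -
    a^-1 in 1 + P, which reduces to (a, -a) = 1. *)
Lemma hilb_steinberg a b : a != 0 -> b != 0 -> a + b = 1 -> h a b = 1.
Proof.
move=> a0 b0 ab.
have key (x y : F) : x != 0 -> y != 0 -> x + y = 1 -> 0 < v x ->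
    vge 1 (y - 1).
  move=> x0 y0 xy vx; have -> : y - 1 = - x by rewrite -xy opprD addrCA addrN addr0.
  by apply: vgeN; rewrite vge_nz //; lia.
have [va|va|va] := ltgtP (v a) 0; last first.
- have [vb|vb|vb] := ltgtP (v b) 0.
  + have : v 1 = v b.
      rewrite -ab addrC; apply: (pvalD_dom b0 _).2.
      by rewrite vge_nz // va; lia.
    by rewrite pval1; lia.
  + by apply: hilb_one_unit_l => //; apply: (key b) => //; rewrite addrC.
  + by apply: hilb_units.
- by apply: hilb_one_unit_r => //; apply: (key a).
have bE : b = - a * (1 - a^-1) by rewrite mulrBr mulr1 mulNr mulfV // opprK -ab addKr.
have c0 : 1 - a^-1 != 0 by apply: contraNneq b0 => c0; rewrite bE c0 mulr0.
rewrite bE hilbMr ?oppr_eq0 // hilb_N // mul1r; apply: hilb_one_unit_r => //.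
rewrite addrC addrA addNr add0r; apply: vgeN.
by rewrite vge_nz ?invr_eq0 // pvalV //; lia.
Qed.

End Hilbert.

(** * Integration of locally constant functions *)

Section Integral.
Variables (p : nat) (F : padicField p).
Local Notation v := (@Defs.pval p F).
Local Notation red := (@presred p F).
Local Notation q := (residue_card F).
Variable w : F.
Hypotheses (w0 : w != 0) (w1 : v w = 1).
Implicit Types (x y a u : F).

(** Representatives of O / P^r indexed by a finite type; [rs_idx] is meaningful on O only. *)
Record residue_system (r : nat) := ResidueSystem {
  rs_type : finType;
  rs_rep : rs_type -> F;
  rs_idx : F -> rs_type;
  rs_int : forall c, vge 0 (rs_rep c);
  rs_repK : forall c, rs_idx (rs_rep c) = c;
  rs_eq : forall x y, vge 0 x -> vge 0 y ->
    (rs_idx x = rs_idx y <-> vge r%:Z (x - y));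
  rs_card : #|rs_type| = (q ^ r)%N }.

Lemma vge_mulw k x : vge k x -> vge (k + 1) (w * x).
Proof. by move=> h; apply: (vgeM (vge_v w) h); rewrite w1 addrC. Qed.

Lemma vge_divw k x : vge (k + 1) x -> vge k (x / w).
Proof.
move=> h; apply: (vgeM h (j := -1)); last by lia.
by rewrite vge_nz ?invr_eq0 // pvalV // w1.
Qed.

(** Expansion in powers of w: a class modulo P^(r+1) is a first digit together with the class modulo
    P^r of the quotient by w. *)
Lemma residue_system_ex r : exists _ : residue_system r, True.
Proof.
suff [S] : inhabited (residue_system r) by exists S.
have /boolp.choice[s sP] (z : pres F) : exists x, vge 0 x /\ red x = z.
  by have [x x0 xz] := red_lift z; exists x.
elim: r => [|r [S]].
  apply: inhabits; apply: (@ResidueSystem 0 unit (fun=> 0) (fun=> tt)) => //.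
  - by move=> _; apply: vge0.
  - by case.
  - by move=> x y hx hy; split=> // _; apply: vgeB.
  - by rewrite card_unit.
have hs x : vge 0 x -> vge 0 ((x - s (red x)) / w).
  move=> hx; apply: vge_divw; rewrite add0r; apply/red_eq => //; first exact: (sP _).1.
  by rewrite (sP _).2.
apply: inhabits; apply: (@ResidueSystem r.+1 (pres F * rs_type S)%type
  (fun c => s c.1 + w * rs_rep c.2)
  (fun x => (red x, rs_idx S ((x - s (red x)) / w)))).
- move=> c; apply: vgeD; first exact: (sP _).1.
  by apply: vge_le (vge_mulw (rs_int _)) _.
- move=> [c d] /=; have rE : red (s c + w * rs_rep d) = c.
    have h := vge_mulw (rs_int d).
    have h1 : vge 1 (w * rs_rep d) by apply: vge_le h _.
    have h0 : vge 0 (w * rs_rep d) by apply: vge_le h _.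
    rewrite (redD (sP c).1 h0) (sP c).2.
    by have /(red_eq0 h0) -> := h1; rewrite addr0.
  by rewrite rE addrAC subrr add0r mulrC mulKf // rs_repK.
- move=> x y hx hy; split=> [[rxy] /rs_eq - /(_ (hs _ hx) (hs _ hy))|h].
    rewrite rxy -mulrBl opprB addrA subrK => /vge_mulw.
    by rewrite mulrC divfK // -addn1 PoszD.
  have rxy : red x = red y by apply/red_eq => //; apply: vge_le h _; lia.
  congr pair => //; apply/rs_eq; try exact: hs.
  rewrite rxy -mulrBl opprB addrA subrK; apply: vge_divw.
  by apply: vge_le h _; lia.
- by rewrite card_prod rs_card expnS.
Qed.

Definition rsys r : residue_system r := sval (cid (residue_system_ex r)).
Local Notation T r := (rs_type (rsys r)).
Local Notation rep := rs_rep.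
Local Notation idx r := (rs_idx (rsys r)).

Variable R : realType.
Local Notation C := R[i].
Local Notation Q := (q%:R : C).

Lemma Q_gt1 : 1 < Q.
Proof. by rewrite ltr1n card_residue_gt1. Qed.

Lemma Q_neq0 : Q != 0.
Proof. by rewrite pnatr_eq0 -lt0n (ltnW (card_residue_gt1 F)). Qed.

Section Values.
Variable E : lmodType C.
Implicit Types (f g : F -> E).

Definition mean r f : E := (Q ^+ r)^-1 *: \sum_(c : T r) f (rep c).

Definition levelO r f := forall x y, vge 0 x -> vge 0 y -> vge r%:Z (x - y) -> f x = f y.

Lemma rep_idx r x : vge 0 x -> vge r%:Z (x - rep (idx r x)).
Proof. by move=> hx; apply/(@rs_eq _ (rsys r)); rewrite ?rs_repK //; apply: rs_int. Qed.

(** An injective map of the finite set O / P^r permutes it. Stated for any s, this serves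
    translations, multiplication by units and inversion of units alike. *)
Lemma mean_inj r f (s : F -> F) : levelO r f ->
  (forall x, vge 0 x -> vge 0 (s x)) ->
  (forall x y, vge 0 x -> vge 0 y -> vge r%:Z (s x - s y) -> vge r%:Z (x - y)) ->
  mean r (f \o s) = mean r f.
Proof.
move=> hf s0 sinj; rewrite /mean; congr (_ *: _).
rewrite [RHS](reindex_inj (h := fun c : T r => idx r (s (rep c)))) /=; last first.
  move=> c d /rs_eq - /(_ (s0 _ (rs_int _)) (s0 _ (rs_int _))) h.
  rewrite -(rs_repK c) -(rs_repK d); apply/rs_eq; try exact: rs_int.
  by apply: sinj h; apply: rs_int.
apply: eq_bigr => c _; apply: hf; first exact: s0 (rs_int _).
  exact: rs_int.
exact: rep_idx (s0 _ (rs_int _)).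
Qed.

Lemma pair_rep_bij r r' : bijective (fun c : T r * T r' =>
  idx (r + r')%N (rep c.1 + w ^+ r * rep c.2)).
Proof.
have wr x : vge 0 x -> vge r%:Z (w ^+ r * x).
  move=> hx; apply: (vgeM (i := r%:Z) _ hx); last by lia.
  by rewrite vge_nz ?expf_neq0 // pvalX // w1 mul1r.
have int0 (c : T r * T r') : vge 0 (rep c.1 + w ^+ r * rep c.2).
  by apply: vgeD (rs_int _) _; apply: vge_le (wr _ (rs_int _)) _.
apply: inj_card_bij; last by rewrite card_prod !rs_card expnD.
move=> [c d] [c' d'] /rs_eq - /(_ (int0 (c, d)) (int0 (c', d'))) /= h.
have cc : c = c'.
  rewrite -(rs_repK c) -(rs_repK c'); apply/rs_eq; try exact: rs_int.
  have h1 : vge r%:Z (rep c + w ^+ r * rep d - (rep c' + w ^+ r * rep d')).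
    by apply: vge_le h _; lia.
  have := vgeB (vgeD h1 (wr _ (rs_int d'))) (wr _ (rs_int d)).
  by congr (vge _ _); ring.
rewrite cc in h *; congr pair.
rewrite -(rs_repK d) -(rs_repK d'); apply/rs_eq; try exact: rs_int.
have := vge_unif (k := (r + r')%N%:Z) w0 w1 h => h2.
have e : rep c' + w ^+ r * rep d - (rep c' + w ^+ r * rep d')
   = w ^+ r * (rep d - rep d') by ring.
rewrite e in h; have := vgeM h (k := r'%:Z) (j := - r%:Z) (y := (w ^+ r)^-1).
rewrite mulrC mulKf ?expf_neq0 //; apply; last by lia.
by rewrite vge_nz ?invr_eq0 ?expf_neq0 // pvalV ?expf_neq0 // pvalX // w1 mul1r.
Qed.

Lemma mean_pair r r' f : levelO (r + r') f -> mean (r + r') f =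
  (Q ^+ r)^-1 *: \sum_(c : T r) mean r' (fun x => f (rep c + w ^+ r * x)).
Proof.
move=> hf; rewrite /mean -scaler_sumr scalerA exprD invfM; congr (_ *: _).
have /= [h' h1 h2] := pair_rep_bij r r'.
rewrite (reindex _ (onW_bij _ (pair_rep_bij r r'))) /= pair_bigA /=.
apply: eq_bigr => -[c d] _ /=.
have h0 : vge 0 (rep c + w ^+ r * rep d).
  apply: vgeD (rs_int _) _; apply: (vgeM (i := 0) _ (rs_int _)) => //.
  by apply: vgeX; rewrite vge_nz // w1.
by apply/esym/hf => //; [exact: rs_int|exact: rep_idx].
Qed.

Lemma mean_cst r (e : E) : mean r (fun=> e) = e.
Proof.
rewrite /mean sumr_const rs_card -[e *+ _]scaler_nat scalerA natrX mulVf ?scale1r //.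
by rewrite expf_neq0 // Q_neq0.
Qed.

Lemma levelO_le r r' f : levelO r f -> (r <= r')%N -> levelO r' f.
Proof. by move=> h le x y hx hy hxy; apply: h => //; apply: vge_le hxy _; lia. Qed.

Lemma mean_refine r r' f : levelO r f -> (r <= r')%N -> mean r' f = mean r f.
Proof.
move=> hf le; have := levelO_le hf le; rewrite -{1 2}(subnKC le) => hf'.
rewrite mean_pair //; congr (_ *: _); apply: eq_bigr => c _.
rewrite -[RHS](mean_cst (r' - r)) /mean; congr (_ *: _); apply: eq_bigr => d _.
have h : vge r%:Z (w ^+ r * rep d).
  apply: (vgeM (i := r%:Z) _ (rs_int _)); last by lia.
  by rewrite vge_nz ?expf_neq0 // pvalX // w1 mul1r.
apply: hf; [|exact: rs_int|by rewrite addrAC subrr add0r].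
by apply: vgeD (rs_int _) _; apply: vge_le h _.
Qed.

(** [xget] picks some level at which f is constant; by [mean_refine] the choice does not matter. *)
Definition intO f : E := mean (xget 0%N [set r | levelO r f]) f.

Lemma intOE r f : levelO r f -> intO f = mean r f.
Proof.
move=> h; rewrite /intO; set r' := xget _ _.
have h' : levelO r' f by apply: (@xgetPex _ 0%N [set r | levelO r f]); exists r.
by rewrite -(mean_refine h (leq_maxl r r')) (mean_refine h' (leq_maxr r r')).
Qed.

(* The integral over P^m, for the Haar measure of F giving mass 1 to O; meaningful for
   f satisfying lcst m f. *)
Definition bint (m : int) f : E := Q ^ (- m) *: intO (fun x => f (w ^ m * x)).

Definition lcst (m : int) f := exists l : int, forall x y,
  vge m x -> vge m y -> vge l (x - y) -> f x = f y.

Lemma vge_wz (m k : int) x : vge k x -> vge (m + k) (w ^ m * x).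
Proof.
move=> hx; apply: (vgeM (i := m) _ hx) => //.
by rewrite vge_nz ?expfz_neq0 // pvalXz // w1 mul1r.
Qed.

Lemma lcst_level m f : lcst m f -> exists r0 : nat, forall r, (r0 <= r)%N ->
  levelO r (fun x => f (w ^ m * x)).
Proof.
move=> [l hl]; exists `|l - m|%N => r hr x y hx hy hxy.
have := vge_wz m hxy; rewrite mulrBr => h; apply: hl.
- by have := vge_wz m hx; rewrite addr0.
- by have := vge_wz m hy; rewrite addr0.
- by apply: vge_le h _; lia.
Qed.

Lemma bintE m f : lcst m f -> exists r0 : nat, forall r, (r0 <= r)%N ->
  bint m f = Q ^ (- m) *: mean r (fun x => f (w ^ m * x)).
Proof.
move=> /lcst_level[r0 h]; exists r0 => r hr; rewrite /bint.
by rewrite (intOE (h r hr)).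
Qed.

Lemma lcst_sub m m' f : lcst m f -> m <= m' -> lcst m' f.
Proof.
move=> [l h] le; exists l => x y hx hy; apply: h; [exact: vge_le hx _|exact: vge_le hy _].
Qed.

Lemma lcst_eq m f g : (forall x, vge m x -> f x = g x) -> lcst m f -> lcst m g.
Proof.
by move=> fg [l h]; exists l => x y hx hy hxy; rewrite -!fg //; apply: h.
Qed.

Lemma bint_eq m f g : lcst m f -> (forall x, vge m x -> f x = g x) ->
  bint m f = bint m g.
Proof.
move=> hf fg; have [r hr] := bintE hf; have [r' hr'] := bintE (lcst_eq fg hf).
rewrite (hr (maxn r r') (leq_maxl _ _)) (hr' (maxn r r') (leq_maxr _ _)) /mean.
congr (_ *: (_ *: _)); apply: eq_bigr => c _; apply: fg.
by have := vge_wz m (rs_int c); rewrite addr0.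
Qed.

Lemma lcstD m f g : lcst m f -> lcst m g -> lcst m (fun x => f x + g x).
Proof.
move=> [l h] [l' h']; exists (Num.max l l') => x y hx hy hxy.
by rewrite (h x y) ?(h' x y) //; apply: vge_le hxy _; lia.
Qed.

Lemma bintD m f g : lcst m f -> lcst m g ->
  bint m (fun x => f x + g x) = bint m f + bint m g.
Proof.
move=> hf hg; have [r1 h1] := bintE hf; have [r2 h2] := bintE hg.
have [r3 h3] := bintE (lcstD hf hg); set r := (r1 + r2 + r3)%N.
rewrite (h1 r) ?(h2 r) ?(h3 r) /r; try lia.
by rewrite -scalerDr /mean -scalerDr big_split.
Qed.

Lemma lcst_cst m (e : E) : lcst m (fun=> e).
Proof. by exists 0. Qed.

Lemma bint_cst m (e : E) : bint m (fun=> e) = Q ^ (- m) *: e.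
Proof.
by have [r h] := bintE (lcst_cst m e); rewrite (h r) // mean_cst.
Qed.

Lemma lcst_trans m f y : vge m y -> lcst m f -> lcst m (fun x => f (x + y)).
Proof.
move=> hy [l h]; exists l => a b ha hb hab; apply: h; try exact: vgeD.
by rewrite opprD addrACA subrr addr0.
Qed.

Lemma bint_trans m f y : vge m y -> lcst m f ->
  bint m (fun x => f (x + y)) = bint m f.
Proof.
move=> hy hf; have [r1 h1] := bintE hf; have [r2 h2] := bintE (lcst_trans hy hf).
have [r3 h3] := lcst_level hf; set r := (r1 + r2 + r3)%N.
rewrite (h1 r) ?(h2 r) /r; try lia; congr (_ *: _).
have y'0 : vge 0 (y / w ^ m) by apply: vge_unif.
rewrite -[RHS](mean_inj (s := fun x => x + y / w ^ m)).
- rewrite /mean; congr (_ *: _); apply: eq_bigr => c _ /=; congr f.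
  by rewrite mulrDr (mulrC _ (y / _)) divfK // expfz_neq0.
- by apply: h3; lia.
- by move=> x hx; apply: vgeD.
- by move=> x x' _ _; rewrite opprD addrACA subrr addr0.
Qed.

Lemma lcst_scale m a f : a != 0 -> lcst (m + v a) f -> lcst m (fun x => f (a * x)).
Proof.
move=> a0 [l h]; exists (l - v a) => x y hx hy hxy; apply: h.
- by apply: (vgeM (vge_v a) hx); lia.
- by apply: (vgeM (vge_v a) hy); lia.
- by rewrite -mulrBr; apply: (vgeM (vge_v a) hxy); lia.
Qed.

Lemma bint_scale m a f : a != 0 -> lcst (m + v a) f ->
  bint m (fun x => f (a * x)) = Q ^ (v a) *: bint (m + v a) f.
Proof.
move=> a0 hf; have [r1 h1] := bintE hf; have [r2 h2] := bintE (lcst_scale a0 hf).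
have [r3 h3] := lcst_level hf; set r := (r1 + r2 + r3)%N.
rewrite (h1 r) ?(h2 r) /r; try lia.
rewrite scalerA -expfzDr ?Q_neq0 //; have -> : v a + - (m + v a) = - m by lia.
congr (_ *: _); have [u [u0 vu] aE] := unif_decomp w0 w1 a0.
rewrite -[RHS](mean_inj (s := fun x => u * x)).
- rewrite /mean; congr (_ *: _); apply: eq_bigr => c _ /=; congr f.
  by rewrite {1}aE expfzDr //; ring.
- by apply: h3; lia.
- by move=> x hx; apply: (vgeM (i := 0) _ hx); rewrite // vge_nz // vu.
- move=> x x' _ _; rewrite -mulrBr => h.
  rewrite -[x - x'](mulKf u0); apply: (vgeM (i := 0) _ h); last by lia.
  by rewrite vge_nz ?invr_eq0 // pvalV // vu.
Qed.

Lemma bint_sum_rep m f (r0 : nat) : lcst m f -> exists r : nat, [/\ (r0 <= r)%N,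
   bint m f = Q ^ (- (m + r%:Z)) *: \sum_(c : T r) f (w ^ m * rep c) &
   forall x y, vge m x -> vge m y -> vge (m + r%:Z) (x - y) -> f x = f y].
Proof.
move=> hf; have [r1 h1] := bintE hf; have [r2 h2] := lcst_level hf.
exists (r0 + r1 + r2)%N; split; first lia.
  rewrite (h1 (r0 + r1 + r2)%N); last lia.
  rewrite /mean scalerA opprD expfzDr ?Q_neq0 //; congr (_ * _ *: _).
  by rewrite -exprnN.
move=> x y hx hy hxy.
have wm : w ^ m != 0 by rewrite expfz_neq0.
rewrite -[x](divfK wm) -[y](divfK wm) ![_ / _ * _]mulrC.
apply: (h2 (r0 + r1 + r2)%N); [lia|exact: vge_unif|exact: vge_unif|].
rewrite -mulrBl; apply: (vgeM hxy (j := - m)); last by lia.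
by rewrite vge_nz ?invr_eq0 // pvalV // pvalXz // w1 mul1r.
Qed.

Lemma rep_unique m r x : vge m x -> exists c0 : T r, forall c,
  vge (m + r%:Z) (x - w ^ m * rep c) <-> c = c0.
Proof.
move=> hx; have wm : w ^ m != 0 by rewrite expfz_neq0.
have hx' := vge_unif w0 w1 hx; exists (idx r (x / w ^ m)) => c.
have -> : x - w ^ m * rep c = w ^ m * (x / w ^ m - rep c).
  by rewrite mulrBr mulrCA mulfV // mulr1.
split=> [h|->]; last by apply: vge_wz; apply: rep_idx.
rewrite -(rs_repK c); apply/esym/rs_eq => //; first exact: rs_int.
have := vgeM h (k := r%:Z) (j := - m) (y := (w ^ m)^-1).
rewrite mulrC mulKf //; apply; last by lia.
by rewrite vge_nz ?invr_eq0 // pvalV // pvalXz // w1 mul1r.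
Qed.

(** Integration over the shell of elements of valuation exactly m. *)
Definition aint (m : int) f : E :=
  bint m (fun x => if (x != 0) && (v x == m) then f x else 0).

Lemma shell_close m l x y : vge m x -> vge m y -> vge l (x - y) -> m + 1 <= l ->
  ((x != 0) && (v x == m)) = ((y != 0) && (v y == m)).
Proof.
wlog suff W : x y / vge m x -> vge m y -> vge l (x - y) -> m + 1 <= l ->
    ((x != 0) && (v x == m)) -> ((y != 0) && (v y == m)).
  move=> hx hy hxy ml; apply/idP/idP; apply: W => //.
  by apply: vge_sym.
move=> hx hy hxy ml /andP[x0 /eqP vx]; have [] := @pval_close _ _ x y x0.
  by apply: vge_sym; apply: vge_le hxy _; rewrite vx.
by move=> -> ->; rewrite vx eqxx.
Qed.

Definition lcst_shell (m : int) f := exists l : int, forall x y,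
  x != 0 -> v x = m -> y != 0 -> v y = m -> vge l (x - y) -> f x = f y.

Lemma lcst_shellP m f : lcst_shell m f ->
  lcst m (fun x => if (x != 0) && (v x == m) then f x else 0).
Proof.
move=> [l h]; exists (Num.max l (m + 1)) => x y hx hy hxy.
have hc : vge (m + 1) (x - y) by apply: vge_le hxy _; lia.
rewrite (shell_close hx hy hc) //; case: ifP => // /andP[y0 /eqP vy].
have /andP[x0 /eqP vx] : (x != 0) && (v x == m).
  by rewrite (shell_close hx hy hc) // y0 vy eqxx.
by apply: h => //; apply: vge_le hxy _; lia.
Qed.

Lemma lcst_lcst_shell m f : lcst m f -> lcst_shell m f.
Proof.
move=> [l h]; exists l => x y x0 vx y0 vy; apply: h; rewrite vge_nz //.
  by rewrite vx.
by rewrite vy.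
Qed.

Lemma aint_eq m f g : lcst_shell m f ->
  (forall x, x != 0 -> v x = m -> f x = g x) -> aint m f = aint m g.
Proof.
move=> hf fg; apply: bint_eq; first exact: lcst_shellP.
by move=> x hx; case: ifP => // /andP[x0 /eqP]; apply: fg.
Qed.

Lemma aint_scale m a f : a != 0 -> lcst_shell (m + v a) f ->
  aint m (fun x => f (a * x)) = Q ^ (v a) *: aint (m + v a) f.
Proof.
move=> a0 hf; rewrite /aint -(bint_scale a0 (lcst_shellP hf)).
apply: esym; apply: bint_eq; first exact: lcst_scale (lcst_shellP hf).
move=> x hx; rewrite mulf_eq0 (negPf a0) /=.
case: (eqVneq x 0) => //= x0; rewrite pvalM // addrC (inj_eq (addIr _)).
by [].
Qed.

(** P^(m+1) is one of the q classes of P^m modulo P^(m+1), and f cut off on the shell is supported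
    on that class. *)
Lemma bint_split m f : lcst m f -> bint m f = aint m f + bint (m + 1) f.
Proof.
move=> hf; have hs := lcst_shellP (lcst_lcst_shell hf).
pose g x := if (x != 0) && (v x == m) then 0 else f x.
have hg : lcst m g.
  have [l h] := hf; exists (Num.max l (m + 1)) => x y hx hy hxy; rewrite /g.
  have hc : vge (m + 1) (x - y) by apply: vge_le hxy _; lia.
  rewrite (shell_close hx hy hc) //; case: ifP => // _.
  by apply: h => //; apply: vge_le hxy _; lia.
have -> : bint m f = aint m f + bint m g.
  rewrite /aint -bintD //; apply: bint_eq => // x hx; rewrite /g.
  by case: ifP => _; rewrite ?addr0 ?add0r.
congr (_ + _); have [r1 h1] := bintE hg.
have hf1 : lcst (m + 1) f by apply: lcst_sub hf _; lia.
have [r2 h2] := bintE hf1; have [r3 h3] := lcst_level hg.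
have [r4 h4] := lcst_level hf1; set r := (r1 + r2 + r3 + r4)%N.
rewrite (h1 (1 + r)%N) ?(h2 r) /r -/r; try lia.
rewrite mean_pair; last by apply: h3; lia.
have wm : w ^ m != 0 by rewrite expfz_neq0.
(* The class of 0. Its representative need not be 0, hence the translation by [rep c0 / w] below. *)
set c0 := idx 1 0; have c0P : vge 1 (rep c0) by have := rep_idx 1 (vge0 _ 0); rewrite sub0r =>
  /vgeN; rewrite opprK.
rewrite (bigD1 c0) //= [X in _ + X]big1 ?addr0; last first.
  move=> c cc0; rewrite -[RHS](mean_cst r) /mean; congr (_ *: _).
  apply: eq_bigr => d _; rewrite /g.
  have [c0' vc] : fin_unit (rep c + w ^+ 1 * rep d).
    have h : vge 1 (w ^+ 1 * rep d) by have := vge_mulw (rs_int d); rewrite add0r.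
    have [h'|h'] := EM (vge 1 (rep c)).
      by case/eqP: cc0; rewrite -(rs_repK c); apply/rs_eq; rewrite ?subr0 //; [exact:
        rs_int|exact: vge0].
    have [u0 vu] := vge_unit (rs_int c) h'.
    by have := @pvalD_dom _ _ _ (w ^+ 1 * rep d) u0; rewrite vu; apply.
  by rewrite mulf_neq0 // pvalM // pvalXz // w1 vc mul1r addr0 eqxx.
rewrite scalerA expr1 -exprN1 -expfzDr ?Q_neq0 //.
rewrite -opprD; congr (_ *: _).
have hy : vge 0 (rep c0 / w) by apply: vge_divw.
rewrite -[RHS](mean_inj (s := fun x => x + rep c0 / w)).
- rewrite /mean; congr (_ *: _); apply: eq_bigr => d _ /=; rewrite /g.
  rewrite (_ : w ^ m * (rep c0 + w ^+ 1 * rep d) = w ^ (m + 1) * (rep d + rep c0 / w)).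
    rewrite ifF //; apply/negP => /andP[n0 /eqP vn].
    have := vge_wz (m + 1) (vgeD (rs_int d) hy); rewrite addr0 vge_nz // vn; lia.
  by rewrite expfzDr // expr1 expr1z; field.
- by apply: h4; rewrite /r; lia.
- by move=> x hx; apply: vgeD.
- by move=> x x' _ _; rewrite opprD addrACA subrr addr0.
Qed.

(** The Jacobian of inversion is constant on a shell; once both shells are scaled to the units,
    inversion permutes the units modulo P^r. *)
Lemma aint_inv m f : lcst_shell (- m) f ->
  aint m (fun x => f x^-1) = Q ^ (- (m + m)) *: aint (- m) f.
Proof.
move=> [l hl]; pose g x := if (x != 0) && (v x == 0) then f (w ^ (- m) * x) else 0.
(* Inversion is extended by the identity off the units, so that it is injective modulo P^r on all of
   O. *)
pose s x := if (x != 0) && (v x == 0) then x^-1 else x.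
have wm : w ^ m != 0 by rewrite expfz_neq0.
have wm' : w ^ (- m) != 0 by rewrite expfz_neq0.
have vwm x : x != 0 -> v (w ^ m * x) = m + v x by move=> x0; rewrite pvalM // pvalXz // w1 mul1r.
have vwm' x : x != 0 -> v (w ^ (- m) * x) = - m + v x by move=> x0; rewrite pvalM // pvalXz // w1
  mul1r.
have gs : lcst_shell (- m) f by exists l.
have [r1 h1] := bintE (lcst_shellP gs).
have fs : lcst_shell m (fun x => f x^-1).
  exists (l + m + m) => x y x0 vx y0 vy hxy; apply: hl; rewrite ?invr_eq0 ?pvalV ?vx ?vy //.
  have -> : x^-1 - y^-1 = (y - x) * (x^-1 * y^-1) by field; rewrite x0 y0.
  apply: (vgeM (j := - (m + m)) (vge_sym hxy)); last by lia.
  by rewrite vge_nz ?mulf_neq0 ?invr_eq0 // pvalM ?invr_eq0 // !pvalV // vx vy; lia.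
have [r2 h2] := bintE (lcst_shellP fs).
have [r3 h3] := lcst_level (lcst_shellP gs).
set r := (1 + r1 + r2 + r3)%N; rewrite /aint (h1 r) ?(h2 r) /r -/r; try lia.
rewrite scalerA -expfzDr ?Q_neq0 //; have -> : - (m + m) + - - m = - m by lia.
congr (_ *: _); rewrite -[RHS](mean_inj (s := s)).
- rewrite /mean; congr (_ *: _); apply: eq_bigr => c _ /=; rewrite /s.
  set x := rep c; rewrite !mulf_eq0 (negPf wm) (negPf wm') /=.
  case: (eqVneq x 0) => [->|x0] /=; first by rewrite !eqxx.
  rewrite vwm //; have [vx|vx] := eqVneq (v x) 0.
    rewrite /= invr_eq0 x0 vwm' ?invr_eq0 // pvalV // vx oppr0 !addr0 !eqxx /=.
    by rewrite -invr_expz invfM.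
  rewrite /= x0 vwm' //= !ifF //; apply/negbTE; lia.
- by apply: h3; rewrite /r; lia.
- by move=> x hx; rewrite /s; case: ifP => // /andP[x0 /eqP vx]; rewrite vge_nz ?invr_eq0 //
  pvalV // vx.
- move=> x y hx hy; rewrite /s; case: ifP => [/andP[x0 /eqP vx]|hx'].
    case: ifP => [/andP[y0 /eqP vy]|hy'] h.
      have -> : x - y = (y^-1 - x^-1) * (x * y) by field; rewrite x0 y0.
      apply: (vgeM (j := 0) (vge_sym h)); last by lia.
      by rewrite vge_nz ?mulf_neq0 // pvalM // vx vy.
    have := shell_close (m := 0) (x := x^-1) (y := y) _ hy h.
    rewrite invr_eq0 x0 pvalV // vx hy' eqxx /= => abs; suff : true = false by [].
    by apply: abs; [rewrite vge_nz ?invr_eq0 // pvalV // vx|rewrite /r; lia].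
  case: ifP => [/andP[y0 /eqP vy]|hy'] h //.
  have := shell_close (m := 0) (x := x) (y := y^-1) hx _ h.
  have y'0 : y^-1 != 0 by rewrite invr_eq0.
  rewrite y'0 pvalV // vy hx' eqxx /= => abs; suff : false = true by [].
  by apply: abs; [rewrite vge_nz ?invr_eq0 // pvalV // vy|rewrite /r; lia].
Qed.

End Values.

Lemma bint_linear (E E' : lmodType C) (L : E -> E') m f : linear L -> lcst m f ->
  L (bint m f) = bint m (fun x => L (f x)).
Proof.
move=> Llin hf; pose L' : {linear E -> E'} := HB.pack L (GRing.isLinear.Build _ _ _ _ L Llin).
have hLf : lcst m (fun x => L (f x)).
  by have [l h] := hf; exists l => x y hx hy hxy; rewrite (h x y).
have [r1 h1] := bintE hf; have [r2 h2] := bintE hLf.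
rewrite (h1 (r1 + r2)%N) ?(h2 (r1 + r2)%N); try lia.
have LZ (a : C) e : L (a *: e) = a *: L e by exact: (linearZ_LR L').
by rewrite /mean !LZ; congr (_ *: (_ *: _)); exact: (linear_sum L').
Qed.

Lemma bint_ge0 m (f : F -> C^o) : lcst m f -> (forall x, 0 <= f x) ->
  0 <= bint m f /\ (bint m f = 0 -> forall x, vge m x -> f x = 0).
Proof.
move=> hf f0; have [r [_ -> hr]] := bint_sum_rep 0 hf.
have Q0 : 0 < Q ^ (- (m + r%:Z)) by rewrite exprz_gt0 // (lt_trans ltr01 Q_gt1).
split; first by rewrite mulr_ge0 ?(ltW Q0) // sumr_ge0.
move=> /eqP; rewrite scaler_eq0 (gt_eqF Q0) /= psumr_eq0 // => /allP h x hx.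
have [c0 c0P] := rep_unique r hx; have hc := (c0P c0).2 (erefl _).
rewrite (hr x (w ^ m * rep c0)) //; first by apply/eqP; apply: h; rewrite mem_index_enum.
by have := vge_wz m (rs_int c0); rewrite addr0.
Qed.

End Integral.

(** * The metaplectic group *)

Ltac field_nz := field; repeat (apply/andP; split); rewrite ?oner_eq0 ?hilb_neq0 //.

Local Notation "g '_a'" := (sl_val g ord0 ord0) (at level 2, left associativity, format "g '_a'").
Local Notation "g '_b'" := (sl_val g ord0 ord_max) (at level 2, left associativity, format "g '_b'").
Local Notation "g '_c'" := (sl_val g ord_max ord0) (at level 2, left associativity, format "g '_c'").
Local Notation "g '_d'" := (sl_val g ord_max ord_max) (at level 2, left associativity, format "g '_d'").

Section SL2Elements.
Variables (p : nat) (F : padicField p).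
Implicit Types (a b c d x y t : F) (g h : SL2 F).


Lemma mat2_a a b c d : mat2 a b c d ord0 ord0 = a. Proof. by rewrite mxE. Qed.
Lemma mat2_b a b c d : mat2 a b c d ord0 ord_max = b. Proof. by rewrite mxE. Qed.
Lemma mat2_c a b c d : mat2 a b c d ord_max ord0 = c. Proof. by rewrite mxE. Qed.
Lemma mat2_d a b c d : mat2 a b c d ord_max ord_max = d. Proof. by rewrite mxE. Qed.
Definition mat2E := (mat2_a, mat2_b, mat2_c, mat2_d).

Lemma ord2P (i : 'I_2) : i = ord0 \/ i = ord_max.
Proof. by case: i => [[|[|//]] hi]; [left|right]; apply: val_inj. Qed.

Lemma mx2_ext (M N : 'M[F]_2) : M ord0 ord0 = N ord0 ord0 -> M ord0 ord_max = N ord0 ord_max ->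
  M ord_max ord0 = N ord_max ord0 -> M ord_max ord_max = N ord_max ord_max -> M = N.
Proof.
move=> h1 h2 h3 h4; apply/matrixP => i j.
by case: (ord2P i) => ->; case: (ord2P j) => ->.
Qed.

Lemma det_mx2 (M : 'M[F]_2) :
  \det M = M ord0 ord0 * M ord_max ord_max - M ord0 ord_max * M ord_max ord0.
Proof.
rewrite (expand_det_row _ ord0) !big_ord_recl big_ord0 addr0 /cofactor !det_mx11 !mxE.
rewrite /= expr0 mul1r expr1 mulN1r mulrN.
by congr (_ * M _ _ - M _ _ * M _ _); apply: val_inj.
Qed.

(** The value is 1 when the determinant is not 1, so that matrices can be written without carrying a
    proof. *)
Definition sl (a b c d : F) : SL2 F := odflt (1%g : SL2 F) (insub (mat2 a b c d) : option (SL2 F)).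

Lemma slE a b c d : a * d - b * c = 1 -> sl_val (sl a b c d) = mat2 a b c d.
Proof.
move=> h; rewrite /sl insubT // det_mx2; by rewrite !mat2E h.
Qed.

Lemma sl_det g : g _a * g _d - g _b * g _c = 1.
Proof. by rewrite -det_mx2; apply/eqP; apply: sl_valP. Qed.

Lemma sl_mulE g h (i j : 'I_2) : sl_val (g * h)%g i j =
  sl_val g i ord0 * sl_val h ord0 j + sl_val g i ord_max * sl_val h ord_max j.
Proof.
rewrite mxE !big_ord_recl big_ord0 addr0.
by congr (_ + sl_val g _ _ * sl_val h _ _); apply: val_inj.
Qed.

Lemma sl_ext g h : g _a = h _a -> g _b = h _b -> g _c = h _c -> g _d = h _d -> g = h.
Proof. by move=> *; apply: val_inj; apply: mx2_ext. Qed.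

Lemma sl1E (i j : 'I_2) : sl_val (1%g : SL2 F) i j = (i == j)%:R.
Proof. by rewrite mxE. Qed.

Definition upper (x : F) := sl 1 x 0 1.
Definition lower (y : F) := sl 1 0 y 1.
Definition diag (a : F) := sl a 0 0 a^-1.
Definition weyl := sl 0 (-1) 1 0.
Definition weylV := sl 0 1 (-1) 0.

Lemma upperE x : sl_val (upper x) = mat2 1 x 0 1.
Proof. by rewrite slE // mulr0 subr0 mulr1. Qed.
Lemma lowerE y : sl_val (lower y) = mat2 1 0 y 1.
Proof. by rewrite slE // mul0r subr0 mulr1. Qed.
Lemma diagE a : a != 0 -> sl_val (diag a) = mat2 a 0 0 a^-1.
Proof. by move=> a0; rewrite slE // mulr0 subr0 mulfV. Qed.
Lemma weylE : sl_val weyl = mat2 0 (-1) 1 0.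
Proof. by rewrite slE // mul0r mulr1 sub0r opprK. Qed.
Lemma weylVE : sl_val weylV = mat2 0 1 (-1) 0.
Proof. by rewrite slE // mul0r mul1r sub0r opprK. Qed.

Definition genE := (sl_mulE, upperE, lowerE, weylE, weylVE, @mat2_a, @mat2_b, @mat2_c,
  @mat2_d).

Lemma upperD x y : (upper x * upper y)%g = upper (x + y).
Proof. by apply: sl_ext; rewrite !genE; ring. Qed.

Lemma upper0 : upper 0 = 1%g.
Proof. by apply: sl_ext; rewrite !genE sl1E. Qed.

Lemma lower0 : lower 0 = 1%g.
Proof. by apply: sl_ext; rewrite !genE sl1E. Qed.

Lemma diagM a b : a != 0 -> b != 0 -> (diag a * diag b)%g = diag (a * b).
Proof.
move=> a0 b0; have ab := mulf_neq0 a0 b0.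
by apply: sl_ext; rewrite ?sl_mulE !diagE // !mat2E ?invfM; ring.
Qed.

Lemma diag1 : diag 1 = 1%g.
Proof. by apply: sl_ext; rewrite diagE ?oner_eq0 // !genE sl1E ?invr1. Qed.

Lemma bruhat_big g : g _c != 0 ->
  g = (upper (g _a / g _c) * diag (g _c)^-1 * (weyl * upper (g _d / g _c)))%g.
Proof.
move=> c0; have ci : (g _c)^-1 != 0 by rewrite invr_eq0.
have e := sl_det g; apply: sl_ext; rewrite !sl_mulE !upperE weylE diagE // !mat2E invrK.
- by field_nz.
- rewrite [LHS](_ : _ = (g _a * g _d - 1) / g _c); first by field_nz.
  by rewrite -e; field.
- by field_nz.
- by field_nz.
Qed.

Lemma bruhat_small g : g _c = 0 -> g _a != 0 /\ g = (diag (g _a) * upper (g _b / g _a))%g.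
Proof.
move=> c0; have := sl_det g; rewrite c0 mulr0 subr0 => e.
have a0 : g _a != 0 by apply: contra_eq_neq e => ->; rewrite mul0r eq_sym oner_eq0.
split=> //; apply: sl_ext; rewrite !sl_mulE !upperE diagE // !mat2E ?c0.
- by field_nz.
- by field_nz.
- by ring.
- by rewrite mul0r add0r mulr1; apply: (mulfI a0); rewrite e mulfV.
Qed.

End SL2Elements.
Arguments weyl {p F}.
Arguments weylV {p F}.

Section CongruenceSubgroups.
Variables (p : nat) (F : padicField p).
Implicit Types (a b c d x y t : F) (g k : SL2 F).

Lemma congruenceP m g : congruence m g ->
  [/\ vge m%:Z (g _a - 1), vge m%:Z (g _b), vge m%:Z (g _c) & vge m%:Z (g _d - 1)].
Proof.
move=> hg; split.
- by have := hg ord0 ord0; rewrite mxE.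
- by have := hg ord0 ord_max; rewrite mxE subr0.
- by have := hg ord_max ord0; rewrite mxE subr0.
- by have := hg ord_max ord_max; rewrite mxE.
Qed.

Lemma congruenceI m g : vge m%:Z (g _a - 1) -> vge m%:Z (g _b) -> vge m%:Z (g _c) ->
  vge m%:Z (g _d - 1) -> congruence m g.
Proof.
move=> *; move=> i j; rewrite mxE.
by case: (ord2P i) => ->; case: (ord2P j) => -> /=; rewrite ?subr0.
Qed.

Lemma congruence1 m : congruence m (1%g : SL2 F).
Proof. by move=> i j; rewrite subrr; apply: vge0. Qed.

Lemma vge_one_mul m x y : vge m%:Z (x - 1) -> vge m%:Z (y - 1) -> vge m%:Z (x * y - 1).
Proof.
move=> hx hy; have -> : x * y - 1 = (x - 1) * (y - 1) + ((x - 1) + (y - 1)) by ring.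
by apply: vgeD; [apply: (vgeM hx hy); lia|exact: vgeD].
Qed.

Lemma vge_mul_one m x y : vge m%:Z x -> vge m%:Z (y - 1) -> vge m%:Z (x * y).
Proof.
move=> hx hy; have -> : x * y = x * (y - 1) + x by ring.
by apply: vgeD => //; apply: (vgeM hx hy); lia.
Qed.

Lemma congruenceM m g k : congruence m g -> congruence m k -> congruence m (g * k)%g.
Proof.
move=> /congruenceP[a1 b1 c1 d1] /congruenceP[a2 b2 c2 d2].
apply: congruenceI; rewrite sl_mulE.
- rewrite addrAC; apply: vgeD; first exact: vge_one_mul.
  by apply: (vgeM b1 c2); lia.
- apply: vgeD; last exact: vge_mul_one.
  by rewrite mulrC; apply: vge_mul_one.
- apply: vgeD; first exact: vge_mul_one.
  by rewrite mulrC; apply: vge_mul_one.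
- rewrite -addrA; apply: vgeD; last exact: vge_one_mul.
  by apply: (vgeM c1 b2); lia.
Qed.

Lemma sl_invE g : [/\ (g^-1)%g _a = g _d, (g^-1)%g _b = - g _b, (g^-1)%g _c = - g _c &
  (g^-1)%g _d = g _a].
Proof.
have e := sl_det g; have ee : g _d * g _a - (- g _b) * (- g _c) = 1 by rewrite -e; ring.
suff -> : (g^-1)%g = sl (g _d) (- g _b) (- g _c) (g _a) by rewrite slE // !mat2E.
have e2 : (g * sl (g _d) (- g _b) (- g _c) (g _a))%g = 1%g.
  by apply: sl_ext; rewrite !sl_mulE slE // !mat2E sl1E /= -?e; ring.
by rewrite -[RHS]mul1g -(mulVg g) -mulgA e2 mulg1.
Qed.

Lemma congruenceV m g : congruence m g -> congruence m (g^-1)%g.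
Proof.
move=> /congruenceP[a1 b1 c1 d1]; have [ea eb ec ed] := sl_invE g.
by apply: congruenceI; rewrite ?ea ?eb ?ec ?ed //; apply: vgeN.
Qed.

Lemma congruence_le m m' g : congruence m g -> (m' <= m)%N -> congruence m' g.
Proof. by move=> hg le i j; apply: vge_le (hg i j) _; lia. Qed.

Lemma one_neq0 x : vge 1 (x - 1) -> x != 0.
Proof. by case/one_unit. Qed.

(** g^-1 k g - 1 = g^-1 (k - 1) g, where the outer factors have entries in P^-N. *)
Lemma conj_congruence_le g k m m' N :
  (forall i j, vge (- N%:Z) (sl_val g i j) /\ vge (- N%:Z) (sl_val (g^-1)%g i j)) ->
  (m + N + N <= m')%N -> congruence m' k -> congruence m (g^-1 * k * g)%g.
Proof.
move=> hN' hm' hk i j.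
have -> : sl_val (g^-1 * k * g)%g i j - (1%:M : 'M[F]_2) i j =
    (sl_val (g^-1)%g *m (sl_val k - 1%:M) *m sl_val g) i j.
  have e : sl_val (g^-1)%g *m sl_val g = 1%:M by exact: (congr1 (@sl_val _ _) (mulVg g)).
  by rewrite mulmxBr mulmx1 mulmxBl e [RHS]mxE [X in _ = _ + X]mxE.
rewrite mxE; apply: vge_sum => s _; rewrite mxE.
apply: (vgeM (i := m%:Z + N%:Z) (j := - N%:Z)); [|exact: (hN' _ _).1|lia].
apply: vge_sum => t _; apply: (vgeM (i := - N%:Z) (j := m'%:Z)).
- exact: (hN' _ _).2.
- by have := hk t s; rewrite !mxE.
- by lia.
Qed.

Lemma conj_congruence g m : exists2 m', (0 < m')%N &
  forall k, congruence m' k -> congruence m (g^-1 * k * g)%g.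
Proof.
have [N hN'] : exists N : nat, forall i j, vge (- N%:Z) (sl_val g i j) /\
    vge (- N%:Z) (sl_val (g^-1)%g i j).
  have bd x : exists N : nat, forall N', (N <= N')%N -> vge (- N'%:Z) x.
    exists `|Defs.pval x|%N => N' hN'; right; lia.
  have [N1 h1] := bd (g _a); have [N2 h2] := bd (g _b).
  have [N3 h3] := bd (g _c); have [N4 h4] := bd (g _d).
  exists (N1 + N2 + N3 + N4)%N => i j; have [ea eb ec ed] := sl_invE g.
  case: (ord2P i) => ->; case: (ord2P j) => ->; rewrite ?ea ?eb ?ec ?ed; split;
    rewrite -?[vge _ (- _)]/(vge _ (- _)); try apply: vgeN;
    first [apply: h1|apply: h2|apply: h3|apply: h4]; lia.
by exists (m + N + N).+1 => // k; apply: conj_congruence_le hN' _; lia.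
Qed.

Lemma congruence_normal m m' g k : congruence m' g -> congruence m k ->
  congruence m (g^-1 * k * g)%g.
Proof.
move=> hg; have int g' : congruence m' g' -> forall i j, vge 0 (sl_val g' i j).
  move=> h i j; rewrite -[sl_val g' i j](subrK ((1%:M : 'M[F]_2) i j)); apply: vgeD.
    by apply: vge_le (h i j) _.
  by rewrite mxE; case: (i == j); [apply: vge1|apply: vge0].
apply: (@conj_congruence_le g k m m 0); last lia.
by move=> i j; rewrite oppr0; split; apply: int => //; apply: congruenceV.
Qed.

End CongruenceSubgroups.

(** * The cocycle identity and the covering group *)

Section CoverGroup.
Variables (p n : nat) (F : padicField p).
Hypotheses (n_gt0 : (0 < n)%N) (cop : coprime p n).
Hypothesis mu_full : exists z : F, n.-primitive_root z.
Variable hilb : F -> F -> mu F n.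
Hypothesis hilbP : is_hilbert_symbol hilb.
Local Notation h a b := (mu_val (hilb a b)).
Implicit Types (a b c d x y t : F) (g : SL2 F).

Local Notation K g g' := (mu_val (kubota hilb g g')).
Local Notation X := (@xfun p F).

Let hMl a b c : a != 0 -> b != 0 -> c != 0 -> h (a * b) c = h a c * h b c.
Proof. exact: (hilbMl n_gt0 mu_full hilbP). Qed.
Let hMr a b c : a != 0 -> b != 0 -> c != 0 -> h a (b * c) = h a b * h a c.
Proof. exact: (hilbMr n_gt0 mu_full hilbP). Qed.
Let hVl a b : a != 0 -> b != 0 -> h a^-1 b = (h a b)^-1.
Proof. exact: (hilbVl n_gt0 mu_full hilbP). Qed.
Let hVr a b : a != 0 -> b != 0 -> h a b^-1 = (h a b)^-1.
Proof. exact: (hilbVr n_gt0 mu_full hilbP). Qed.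
Let h1l a : a != 0 -> h 1 a = 1.
Proof. exact: (hilb1l n_gt0 mu_full hilbP). Qed.
Let h1r a : a != 0 -> h a 1 = 1.
Proof. exact: (hilb1r n_gt0 mu_full hilbP). Qed.
Let hN a : a != 0 -> h a (- a) = 1.
Proof. exact: (hilb_N n_gt0 cop mu_full hilbP). Qed.
Let hA a b : a != 0 -> b != 0 -> h b a = (h a b)^-1.
Proof.
move=> a0 b0; have := hilb_anti n_gt0 cop mu_full hilbP a0 b0.
by move/(canRL (mulKf (hilb_neq0 hilb a b))) ->; rewrite mulr1.
Qed.
Let hS a : a != 0 -> h a a = h a (-1).
Proof. exact: (hilb_self n_gt0 cop mu_full hilbP). Qed.
Let h0 a b : h a b != 0 := hilb_neq0 hilb a b.
Let N10 : (-1 : F) != 0. Proof. by rewrite oppr_eq0 oner_eq0. Qed.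
Let hN1 a : a != 0 -> h a (-1) * h a (-1) = 1.
Proof. by move=> a0; rewrite -hMr // mulrNN mulr1 h1r. Qed.

Lemma xfun_c g : g _c != 0 -> X g = g _c.
Proof. by rewrite /xfun => ->. Qed.

Lemma xfun_d g : g _c = 0 -> X g = g _d.
Proof. by rewrite /xfun => ->; rewrite eqxx. Qed.

Lemma xfun_neq0 g : X g != 0.
Proof.
have [c0|c0] := eqVneq (g _c) 0; last by rewrite xfun_c.
rewrite xfun_d //; have := sl_det g; rewrite c0 mulr0 subr0 => e.
by apply: contra_eq_neq e => ->; rewrite mulr0 eq_sym oner_eq0.
Qed.

Lemma xfun_upperl x g : X (upper x * g)%g = X g.
Proof. by rewrite /xfun !genE !mul0r !add0r !mul1r. Qed.

Lemma xfun_upperr x g : X (g * upper x)%g = X g.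
Proof.
rewrite /xfun !genE mulr1 mulr0 addr0.
by case: eqP => //= ->; rewrite mul0r add0r mulr1.
Qed.

Lemma xfun_diagl a g : a != 0 -> X (diag a * g)%g = a^-1 * X g.
Proof.
move=> a0; rewrite /xfun !sl_mulE diagE // !genE !mul0r !add0r.
by rewrite mulf_eq0 invr_eq0 (negPf a0) /=; case: eqP.
Qed.

Lemma xfun_upper x : X (upper x) = 1.
Proof. by rewrite /xfun !genE eqxx. Qed.

Lemma xfun_diag a : a != 0 -> X (diag a) = a^-1.
Proof. by move=> a0; rewrite /xfun diagE // !genE eqxx. Qed.

Lemma xfun_weyl : X weyl = 1.
Proof. by rewrite /xfun !genE oner_eq0. Qed.

Lemma kubota_upperl x g : K (upper x) g = 1.
Proof.
rewrite /kubota xfun_upperl xfun_upper divr1 mulfV ?xfun_neq0 // h1r //.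
exact: xfun_neq0.
Qed.

Lemma kubota_upperr x g : K g (upper x) = 1.
Proof.
rewrite /kubota xfun_upperr xfun_upper divr1 mulfV ?xfun_neq0 // h1l //.
exact: xfun_neq0.
Qed.

Lemma kubota_diagl a g : a != 0 -> K (diag a) g = (h (X g) a)^-1.
Proof.
move=> a0; rewrite /kubota xfun_diagl // xfun_diag // -hVr ?xfun_neq0 //.
have X0 := xfun_neq0 g.
have -> : a^-1 * X g / a^-1 = X g by field_nz.
by have -> : a^-1 * X g / X g = a^-1 by field_nz.
Qed.

Lemma kubota_diagr_c a g : a != 0 -> g _c != 0 -> K g (diag a) = h a (g _c).
Proof.
move=> a0 c0; have e : (g * diag a)%g _c = g _c * a.
  by rewrite sl_mulE diagE // !genE mulr0 addr0.
have e0 : (g * diag a)%g _c != 0 by rewrite e mulf_neq0.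
rewrite /kubota !(xfun_c e0) (xfun_c c0) xfun_diag // e.
have -> : g _c * a / g _c = a by field_nz.
have -> : g _c * a / a^-1 = g _c * a * a by field_nz.
by rewrite !hMr ?mulf_neq0 // hS // -mulrA hN1 // mulr1.
Qed.

Lemma kubota_diagr_d a g : a != 0 -> g _c = 0 -> K g (diag a) = (h a (g _d))^-1.
Proof.
move=> a0 c0; have e : (g * diag a)%g _c = 0.
  by rewrite sl_mulE diagE // !genE c0 mul0r mulr0 addr0.
have d0 : g _d != 0 by rewrite -(xfun_d c0) xfun_neq0.
rewrite /kubota (xfun_d e) (xfun_d c0) xfun_diag // sl_mulE diagE // !genE mulr0 add0r.
have -> : g _d / a / g _d = a^-1 by field_nz.
have -> : g _d / a / a^-1 = g _d by field_nz.
by rewrite hVl.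
Qed.

Definition cocycle g1 g2 g3 :=
  K g1 g2 * K (g1 * g2)%g g3 = K g2 g3 * K g1 (g2 * g3)%g.

Lemma K0 g g' : K g g' != 0.
Proof. exact: h0. Qed.

Lemma cocycle_upperl x g2 g3 : cocycle (upper x) g2 g3.
Proof.
by rewrite /cocycle !kubota_upperl mul1r mulr1 /kubota -mulgA !xfun_upperl.
Qed.

Lemma cocycle_upperr x g1 g2 : cocycle g1 g2 (upper x).
Proof.
by rewrite /cocycle !kubota_upperr mul1r mulr1 /kubota mulgA !xfun_upperr.
Qed.

Lemma cocycle_upperm x g1 g2 : cocycle g1 (upper x) g2.
Proof.
by rewrite /cocycle !kubota_upperr !kubota_upperl !mul1r /kubota mulgA xfun_upperr xfun_upperl.
Qed.

Lemma cocycle_diagl a g2 g3 : a != 0 -> cocycle (diag a) g2 g3.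
Proof.
move=> a0; rewrite /cocycle !kubota_diagl // /kubota -mulgA !xfun_diagl //.
have X2 := xfun_neq0 g2; have X3 := xfun_neq0 g3; have X23 := xfun_neq0 (g2 * g3)%g.
have -> : a^-1 * X (g2 * g3)%g / (a^-1 * X g2) = X (g2 * g3)%g / X g2.
  by field_nz.
rewrite !(hMl, hMr, hVl, hVr) ?(mulf_neq0, invr_eq0) //.
by field_nz.
Qed.

(** The coboundary of a 2-cochain satisfies the 3-cocycle relation: four of its five instances on
    (g1, g2, x, y) give the fifth. This and [cocycle_mulr] propagate the identity through
    products. *)
Lemma cocycle_mull g1 g2 (x y : SL2 F) : cocycle g1 g2 x -> cocycle g1 g2 (x * y)%g ->
  cocycle g1 (g2 * x)%g y -> cocycle g2 x y -> cocycle (g1 * g2)%g x y.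
Proof.
rewrite /cocycle !mulgA => e1 e2 e3 e4; apply: (mulfI (K0 g1 g2)).
by rewrite mulrA e1 -mulrA e3 mulrA e4 [RHS]mulrCA e2 mulrA.
Qed.

Lemma cocycle_mulr (x y : SL2 F) g1 g2 : cocycle (x * y)%g g1 g2 -> cocycle y g1 g2 ->
  cocycle x (y * g1)%g g2 -> cocycle x y g1 -> cocycle x y (g1 * g2)%g.
Proof.
rewrite /cocycle !mulgA => e1 e2 e3 e4; apply: (mulfI (K0 g1 g2)).
by rewrite mulrCA -e1 mulrA e4 -mulrA e3 mulrA e2 mulrA.
Qed.

Lemma kubota_weyll g : K weyl g = h (X (weyl * g)%g) (X (weyl * g)%g / X g).
Proof. by rewrite /kubota xfun_weyl divr1. Qed.

Lemma xfun_weyl_a g : g _a != 0 -> X (weyl * g)%g = g _a.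
Proof. by move=> a0; rewrite xfun_c !genE mul1r mul0r addr0. Qed.

Lemma xfun_weyl_b g : g _a = 0 -> X (weyl * g)%g = g _b.
Proof. by move=> a0; rewrite xfun_d !genE mul1r mul0r addr0. Qed.

Lemma entry0 g : [/\ g _a = 0 -> g _b != 0 /\ g _c = - (g _b)^-1,
   g _c = 0 -> g _a != 0 /\ g _d = (g _a)^-1 & g _d = 0 -> g _b != 0 /\ g _c = - (g _b)^-1].
Proof.
have e := sl_det g.
have bc : g _b * g _c = -1 -> g _b != 0 /\ g _c = - (g _b)^-1.
  move=> bc; have b0 : g _b != 0.
    by apply: contra_eq_neq bc => ->; rewrite mul0r eq_sym oppr_eq0 oner_eq0.
  by split=> //; apply: (mulfI b0); rewrite bc mulrN mulfV.
split=> z0; move: e; rewrite z0 ?(mul0r, mulr0, sub0r, subr0).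
- by move=> e; apply: bc; rewrite -e opprK.
- move=> e; have a0 : g _a != 0 by apply: contra_eq_neq e => ->; rewrite mul0r eq_sym oner_eq0.
  by split=> //; apply: (mulfI a0); rewrite e mulfV.
- by move=> e; apply: bc; rewrite -e opprK.
Qed.

Lemma cocycle_weyl_diag t g : t != 0 -> cocycle weyl g (diag t).
Proof.
move=> t0; have X0 := xfun_neq0.
have Et g' : (g' * diag t)%g _a = g' _a * t /\ (g' * diag t)%g _b = g' _b / t.
  by rewrite !sl_mulE diagE // !genE !mulr0 addr0 add0r.
have Ec g' : (g' * diag t)%g _c = g' _c * t /\ (g' * diag t)%g _d = g' _d / t.
  by rewrite !sl_mulE diagE // !genE !mulr0 addr0 add0r.
have wc : (weyl * g)%g _c = g _a by rewrite !genE mul1r mul0r addr0.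
have wd : (weyl * g)%g _d = g _b by rewrite !genE mul1r mul0r addr0.
have [ea ec _] := entry0 g.
rewrite /cocycle !kubota_weyll.
have [a0|a0] := eqVneq (g _a) 0.
  have [b0 cE] := ea a0.
  have c0 : g _c != 0 by rewrite cE oppr_eq0 invr_eq0.
  rewrite (kubota_diagr_d t0); last by rewrite wc.
  rewrite (kubota_diagr_c t0 c0) wd xfun_weyl_b // (xfun_c c0).
  rewrite xfun_weyl_b; last by rewrite (Et g).1 a0 mul0r.
  rewrite xfun_c; last by rewrite (Ec g).1 mulf_neq0.
  rewrite (Et g).2 (Ec g).1.
  have -> : g _b / t / (g _c * t) = (g _b / g _c) * (t^-1 * t^-1) by field_nz.
  rewrite !(hMl, hMr, hVl, hVr) ?(mulf_neq0, invr_eq0) // (hS t0).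
  have -> : h t (g _c) = h t (-1) / h t (g _b).
    by rewrite cE -hVr // -hMr ?invr_eq0 // mulN1r.
  have s0 := h0 t (-1); have sE := hN1 t0.
  rewrite (hA t0 b0); move: sE; set s := h t (-1) => sE.
  have -> : s^-1 = s by apply: (mulfI s0); rewrite mulfV // sE.
  rewrite sE invr1 mulr1.
  by rewrite -[LHS]mul1r -sE; field_nz.
have [c0|c0] := eqVneq (g _c) 0.
  have [_ dE] := ec c0.
  have d0 : g _d != 0 by rewrite dE invr_eq0.
  rewrite (kubota_diagr_c t0) ?wc // (kubota_diagr_d t0 c0) xfun_weyl_a // (xfun_d c0).
  rewrite xfun_weyl_a; last by rewrite (Et g).1 mulf_neq0.
  rewrite xfun_d; last by rewrite (Ec g).1 c0 mul0r.
  rewrite (Et g).1 (Ec g).2.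
  have -> : g _a * t / (g _d / t) = (g _a / g _d) * (t * t) by field_nz.
  rewrite !(hMl, hMr, hVl, hVr) ?(mulf_neq0, invr_eq0) // (hS t0).
  have -> : h t (g _d) = (h t (g _a))^-1 by rewrite dE hVr.
  have s0 := h0 t (-1); have sE := hN1 t0.
  rewrite (hA t0 a0); move: sE; set s := h t (-1) => sE.
  by rewrite sE mulr1; field_nz.
rewrite (kubota_diagr_c t0) ?wc // (kubota_diagr_c t0 c0) !xfun_weyl_a // ?(Et g).1 ?mulf_neq0 //.
rewrite (xfun_c c0) xfun_c ?(Ec g).1 ?mulf_neq0 //.
have -> : g _a * t / (g _c * t) = g _a / g _c by field_nz.
rewrite !(hMl, hMr, hVl, hVr) ?(mulf_neq0, invr_eq0) //; field_nz.
Qed.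

Lemma hilbN1V a : a != 0 -> (h a (-1))^-1 = h a (-1).
Proof. by move=> a0; apply: (mulfI (h0 a (-1))); rewrite mulfV // hN1. Qed.

Lemma hilbN1l a : a != 0 -> h (-1) a = h a (-1).
Proof. by move=> a0; rewrite (hA a0 N10) hilbN1V. Qed.

Lemma hilb_mN1 a : a != 0 -> h (-1) (- a) = h (- a) (- a).
Proof.
move=> a0; rewrite [RHS]hS ?oppr_eq0 // -(mulN1r a) hMr // hMl // hilbN1l //.
Qed.

(** Only when all four entries of g are nonzero is more than bilinearity and (a, -a) = 1 needed:
    there the Steinberg relation for a d + (- b c) = 1 enters. *)
Lemma cocycle_weyl_weyl g : cocycle weyl g weyl.
Proof.
have wc : (weyl * g)%g _c = g _a by rewrite !genE mul1r mul0r addr0.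
have wd : (weyl * g)%g _d = g _b by rewrite !genE mul1r mul0r addr0.
have gc : (g * weyl)%g _c = g _d by rewrite !genE mulr1 mulr0 add0r.
have gd : (g * weyl)%g _d = - g _c by rewrite !genE mulrN1 mulr0 addr0.
have ga : (g * weyl)%g _a = g _b by rewrite !genE mulr1 mulr0 add0r.
have gb : (g * weyl)%g _b = - g _a by rewrite !genE mulrN1 mulr0 addr0.
have [ea ec ed] := entry0 g; have e := sl_det g.
have kr g' : K g' weyl = h (X (g' * weyl)%g / X g') (X (g' * weyl)%g).
  by rewrite /kubota xfun_weyl divr1.
rewrite /cocycle !kubota_weyll !kr -mulgA.
have X0 := xfun_neq0 (weyl * (g * weyl))%g.
have [a0|a0] := eqVneq (g _a) 0.
  have [b0 cE] := ea a0; have c0 : g _c != 0 by rewrite cE oppr_eq0 invr_eq0.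
  rewrite (xfun_weyl_b a0) (xfun_c c0) (@xfun_weyl_a (g * weyl)%g) ga //.
  rewrite mulfV // h1l // mulr1.
  have hbc : h (g _b) (g _c) = 1 by rewrite cE -invrN hVr ?oppr_eq0 // hN // invr1.
  have [d0|d0] := eqVneq (g _d) 0.
    rewrite (@xfun_d (g * weyl)%g) ?gc // gd; have -> : - g _c / g _c = -1 by field_nz.
    have -> : g _b / - g _c = g _b * g _b by rewrite cE opprK invrK.
    have -> : - g _c = (g _b)^-1 by rewrite cE opprK.
    rewrite !(hMr, hVr) ?invr_eq0 // hbc (hA b0 N10) invrK (hS b0).
    by rewrite divr1 hN1 // mulr1.
  rewrite (@xfun_c (g * weyl)%g) ?gc // !(hMl, hMr, hVl, hVr) ?(mulf_neq0, invr_eq0) // hbc.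
  have -> : h (g _c) (g _d) = h (g _d) (-1) / h (g _b) (g _d).
    by rewrite cE -(mulN1r (g _b)^-1) hMl ?invr_eq0 // hVl // hilbN1l.
  by rewrite (hS d0) divr1; field_nz.
rewrite (xfun_weyl_a a0).
have [b0|b0] := eqVneq (g _b) 0.
  have d0 : g _d != 0.
    by apply: contra_eq_neq e => ->; rewrite b0 mulr0 mul0r subrr eq_sym oner_eq0.
  have dE : g _d = (g _a)^-1.
    by apply: (mulfI a0); rewrite mulfV // -e b0 mul0r subr0.
  rewrite (@xfun_weyl_b (g * weyl)%g) ?ga // gb (@xfun_c (g * weyl)%g) ?gc //.
  have -> : - g _a / g _a = -1 by field_nz.
  have -> : - g _a / g _d = - g _a * g _a by rewrite dE invrK.
  have -> : h (- g _a) (- g _a * g _a) = h (-1) (- g _a).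
    have := @hN (- g _a); rewrite oppr_eq0 opprK => /(_ a0) e1.
    by rewrite hMr ?oppr_eq0 // e1 mulr1 -hilb_mN1.
  congr (_ * _); have [c0|c0] := eqVneq (g _c) 0.
    rewrite (xfun_d c0) mulfV // h1l // dE invrK hMr // hS //.
    by rewrite hN1.
  rewrite (xfun_c c0) !(hMr, hMl, hVl, hVr) ?invr_eq0 //.
  have -> : h (g _c) (g _d) = h (g _a) (g _c) by rewrite dE hVr // (hA a0 c0) invrK.
  by rewrite dE hVl ?invr_eq0 // hVr // invrK.
rewrite (@xfun_weyl_a (g * weyl)%g) ga //.
have [c0|c0] := eqVneq (g _c) 0.
  have [_ dE] := ec c0; have d0 : g _d != 0 by rewrite dE invr_eq0.
  rewrite (xfun_d c0) (@xfun_c (g * weyl)%g) gc // mulfV // h1l // mul1r.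
  rewrite dE invrK !(hMl, hMr, hVl) ?invr_eq0 // (hS a0) hN1 // mul1r.
  by rewrite (hA a0 b0); field_nz.
rewrite (xfun_c c0); have [d0|d0] := eqVneq (g _d) 0.
  have [_ cE] := ed d0.
  rewrite (@xfun_d (g * weyl)%g) ?gc // gd.
  have -> : - g _c / g _c = -1 by field_nz.
  have -> : - g _c = (g _b)^-1 by rewrite cE opprK.
  rewrite invrK !(hMl, hMr, hVl, hVr) ?invr_eq0 // hilbN1l // hilbN1V // (hS b0) hN1 // mulr1.
  have -> : h (g _a) (g _c) = h (g _a) (-1) / h (g _a) (g _b).
    by rewrite cE -(mulN1r (g _b)^-1) hMr ?invr_eq0 // hVr.
  by rewrite (hS a0); field_nz.
rewrite (@xfun_c (g * weyl)%g) gc //.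
have St : h (g _a * g _d) (- (g _b * g _c)) = 1.
  by apply: (hilb_steinberg n_gt0 cop mu_full hilbP); rewrite ?oppr_eq0 ?mulf_neq0.
move: St; rewrite -mulN1r !(hMl, hMr, hVl, hVr) ?(mulf_neq0, invr_eq0) //.
rewrite (hS a0) (hS d0) (hA d0 c0) (hA d0 b0).
have := hN1 a0; have := hN1 d0.
have := h0 (g _a) (-1); have := h0 (g _d) (-1).
move: (h (g _a) (-1)) (h (g _d) (-1)) => sa sd sd0 sa0 sdE saE St.
by rewrite -[LHS]mulr1 -St -[RHS]mul1r -saE; field_nz.
Qed.

Local Notation cover := (cover_of hilb).
Local Notation sec := (sec hilb).
Implicit Types (k : SL2 F) (e : mu F n).

Let hN1V a : a != 0 -> (h a (-1))^-1 = h a (-1).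
Proof. exact: (hilbN1V). Qed.
Let hUl a u : a != 0 -> vge 1 (u - 1) -> h u a = 1.
Proof. exact: (hilb_one_unit_l n_gt0 cop mu_full hilbP). Qed.
Let hUr a u : a != 0 -> vge 1 (u - 1) -> h a u = 1.
Proof. exact: (hilb_one_unit_r n_gt0 cop mu_full hilbP). Qed.

Lemma cocycle_borel g1 g2 g3 : g1 _c = 0 -> cocycle g1 g2 g3.
Proof.
move=> /bruhat_small[a0 ->].
by apply: cocycle_mull; [exact: cocycle_diagl|exact: cocycle_diagl|exact: cocycle_diagl|exact:
  cocycle_upperl].
Qed.

Lemma cocycle_of_weyl (y : SL2 F) : (forall g, cocycle weyl g y) ->
  forall g1 g2, cocycle g1 g2 y.
Proof.
move=> hy g1 g2; have [c0|c0] := eqVneq (g1 _c) 0; first exact: cocycle_borel.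
have cB g2' g3' : cocycle (upper (g1 _a / g1 _c) * diag (g1 _c)^-1)%g g2' g3'.
  by apply: cocycle_borel; rewrite !genE diagE ?invr_eq0 // !genE mul0r mulr0 addr0.
have cm x g g' := @cocycle_upperm x g g'.
rewrite (bruhat_big c0); apply: cocycle_mull; [exact: cB|exact: cB|exact: cB|].
by apply: cocycle_mull; [exact: cm|exact: cm|exact: hy|exact: cocycle_upperl].
Qed.

(** [cocycle_of_weyl] reduces the first argument to [weyl], so the identity holds with a generator
    in last position; [cocycle_mulr] and the Bruhat decomposition of [g3] do the rest. *)
Lemma cocycle_all g1 g2 g3 : cocycle g1 g2 g3.
Proof.
have cw g g' : cocycle g g' weyl.
  by apply: cocycle_of_weyl => g''; apply: (cocycle_weyl_weyl).
have cd t g g' : t != 0 -> cocycle g g' (diag t).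
  move=> t0; apply: cocycle_of_weyl => g''.
  exact: (cocycle_weyl_diag).
have cu x g g' : cocycle g g' (upper x).
  exact: (cocycle_upperr).
have [c0|c0] := eqVneq (g3 _c) 0.
  by have [a0 ->] := bruhat_small c0; apply: cocycle_mulr; [exact: cu|exact: cu|exact: cu|exact:
    cd].
have ci : (g3 _c)^-1 != 0 by rewrite invr_eq0.
have cm (x y : SL2 F) : (forall g g', cocycle g g' x) -> (forall g g', cocycle g g' y) ->
    forall g g', cocycle g g' (x * y)%g.
  by move=> hx hy g g'; apply: cocycle_mulr.
rewrite (bruhat_big c0); apply: (cm) => g g'; apply: (cm) => ? ?.
- exact: cu.
- exact: cd.
- exact: cw.
- exact: cu.
Qed.

Lemma cover_ext (x y : cover) : base x = base y ->
  mu_val (fiber x) = mu_val (fiber y) -> x = y.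
Proof. by case: x y => [g e] [g' e'] /= -> /val_inj ->. Qed.

Lemma cover_mulA : associative (@cover_mul p F n hilb).
Proof.
move=> x y z; apply: cover_ext; first exact: mulgA.
have := cocycle_all (base x) (base y) (base z); rewrite /cocycle /= => e.
rewrite [RHS](_ : _ = (K (base x) (base y) * K (base x * base y)%g (base z)) *
  (mu_val (fiber x) * mu_val (fiber y) * mu_val (fiber z))); last by ring.
by rewrite e; ring.
Qed.

Lemma cmulA (x y z : cover) : (x * (y * z))%g = ((x * y) * z)%g.
Proof. exact: cover_mulA. Qed.

Lemma kubota1l g : K 1%g g = 1.
Proof. by rewrite -upper0 (kubota_upperl). Qed.

Lemma kubota1r g : K g 1%g = 1.
Proof. by rewrite -upper0 (kubota_upperr). Qed.

Lemma cmul1 (x : cover) : (1 * x)%g = x.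
Proof. by apply: cover_ext; rewrite /= ?mul1g // kubota1l !mul1r. Qed.

Lemma cmulr1 (x : cover) : (x * 1)%g = x.
Proof. by apply: cover_ext; rewrite /= ?mulg1 // kubota1r mul1r mulr1. Qed.

Definition cen e : cover := Cover hilb 1%g e.

Lemma cen_comm e (x : cover) : (cen e * x)%g = (x * cen e)%g.
Proof.
by apply: cover_ext; rewrite /= ?mul1g ?mulg1 // kubota1l kubota1r !mul1r mulrC.
Qed.

Lemma cover_cen g e : Cover hilb g e = (cen e * sec g)%g.
Proof. by apply: cover_ext; rewrite /= ?mul1g // kubota1l mul1r mulr1. Qed.

Lemma sec_mul g g' : K g g' = 1 -> (sec g * sec g')%g = sec (g * g')%g.
Proof. by move=> e; apply: cover_ext; rewrite //= e !mulr1. Qed.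

Lemma sec1 : sec 1%g = 1%g. Proof. by []. Qed.

Lemma sec_upperl x g : (sec (upper x) * sec g)%g = sec (upper x * g)%g.
Proof. by apply: sec_mul; apply: (kubota_upperl). Qed.

Lemma sec_upperr x g : (sec g * sec (upper x))%g = sec (g * upper x)%g.
Proof. by apply: sec_mul; apply: (kubota_upperr). Qed.

Lemma sec_diagM a b : a != 0 -> b != 0 ->
  (sec (diag a) * sec (diag b))%g = (cen (hilb b a) * sec (diag (a * b)))%g.
Proof.
move=> a0 b0; apply: cover_ext; rewrite /= ?mul1g ?diagM //.
rewrite kubota1l (kubota_diagl) // xfun_diag // hVl // invrK.
by ring.
Qed.

(** Representatives of the cosets of B(F) in the big cell; x is the coordinate used for sections
    throughout. *)
Definition wn x : SL2 F := (weyl * upper x)%g.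

Lemma wnE x : [/\ (wn x) _a = 0, (wn x) _b = -1, (wn x) _c = 1 & (wn x) _d = x].
Proof. by split; rewrite !genE; ring. Qed.

Lemma xfun_wn x : X (wn x) = 1.
Proof. by have [_ _ e _] := wnE x; rewrite xfun_c e // oner_eq0. Qed.

Lemma wn_upper x y : (sec (wn x) * sec (upper y))%g = sec (wn (x + y)).
Proof. by rewrite sec_upperr /wn -mulgA upperD. Qed.

Lemma wn_diag x a : a != 0 ->
  (sec (wn x) * sec (diag a))%g = (sec (diag a^-1) * sec (wn (x / a ^+ 2)))%g.
Proof.
move=> a0; have ai : a^-1 != 0 by rewrite invr_eq0.
have [_ _ wc _] := wnE x.
apply: cover_ext => /=.
  by apply: sl_ext; rewrite !sl_mulE !weylE !upperE (diagE a0) (diagE ai) !mat2E; field_nz.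
rewrite (kubota_diagl) // xfun_wn h1l // invr1.
by rewrite (kubota_diagr_c) // wc ?oner_eq0 // h1r.
Qed.

Lemma wn_weylV x : (sec (wn x) * sec weylV)%g = sec (lower (- x)).
Proof.
have e : (wn x * weylV)%g = lower (- x).
  by apply: sl_ext; rewrite !sl_mulE weylE upperE weylVE lowerE !mat2E; ring.
rewrite -e; apply: sec_mul; rewrite /kubota e xfun_wn divr1.
have -> : X weylV = -1 by rewrite xfun_c weylVE mat2E ?oppr_eq0 ?oner_eq0.
have [->|x0] := eqVneq x 0.
  rewrite oppr0 lower0 (_ : X 1%g = 1) ?h1l ?invr_eq0 //; first by rewrite mul1r invr_eq0.
  by rewrite -upper0 xfun_upper.
rewrite xfun_c lowerE mat2E ?oppr_eq0 // invrN1 mulrN1 opprK.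
by have := @hN (- x); rewrite oppr_eq0 opprK; apply.
Qed.

(** For large x this puts w n(x) in B(F) times a lower unipotent element near 1, which determines
    smooth sections near infinity. *)
Lemma wn_lower x : x != 0 -> sec (wn x) =
  (cen (hilb x (-1)) * (sec (diag x^-1) * sec (upper (- x)) * sec (lower x^-1)))%g.
Proof.
move=> x0; have xi : x^-1 != 0 by rewrite invr_eq0.
have g1 : ((diag x^-1 * upper (- x)) * lower x^-1)%g = wn x.
  by apply: sl_ext; rewrite !sl_mulE !upperE lowerE weylE (diagE xi) !mat2E; field_nz.
apply: cover_ext; first by rewrite /= mul1g g1.
rewrite /= kubota1l !mul1r !mulr1 (kubota_upperr) mulr1.
rewrite /kubota g1 xfun_wn xfun_upperr xfun_diag // invrK.
rewrite xfun_c lowerE mat2E // !div1r invrK hVl // hS // hN1V //.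
by rewrite -[X in X * _](hN1V x0) mulVf.
Qed.

Lemma sec_big g : g _c != 0 ->
  sec g = (sec (upper (g _a / g _c)) * (sec (diag (g _c)^-1) * sec (wn (g _d / g _c))))%g.
Proof.
move=> c0; have ci : (g _c)^-1 != 0 by rewrite invr_eq0.
rewrite (@sec_mul (diag _)); last first.
  by rewrite (kubota_diagl) // xfun_wn h1l // invr1.
by rewrite sec_upperl mulgA -bruhat_big.
Qed.

Lemma sec_small g : g _c = 0 -> g _a != 0 /\
  sec g = (sec (diag (g _a)) * sec (upper (g _b / g _a)))%g.
Proof.
by move=> c0; have [a0 e] := bruhat_small c0; split; rewrite // sec_upperr -e.
Qed.

Lemma upper_diag a x : a != 0 ->
  (sec (upper x) * sec (diag a))%g = (sec (diag a) * sec (upper (x / a ^+ 2)))%g.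
Proof.
move=> a0; rewrite sec_upperl sec_upperr; congr sec.
by apply: sl_ext; rewrite !sl_mulE !upperE diagE // !mat2E; field_nz.
Qed.

(** Symbols with an argument in 1 + P are trivial, so only lower left entries matter. When those of
    g, k and g k are all nonzero, the lower left entry of g k is a sum of two terms; divided by it,
    they add up to 1 and the Steinberg relation concludes. *)
Lemma kubota_congruence g k : congruence 1 g -> congruence 1 k -> K g k = 1.
Proof.
move=> hg hk; have hgk := congruenceM hg hk.
have [a1 b1 c1 d1] := congruenceP hg; have [a2 b2 c2 d2] := congruenceP hk.
have [a3 b3 c3 d3] := congruenceP hgk.
have gkc : (g * k)%g _c = g _c * k _a + g _d * k _c by rewrite sl_mulE.
have a20 := one_neq0 a2; have d10 := one_neq0 d1; have d20 := one_neq0 d2.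
have d30 := one_neq0 d3.
rewrite /kubota; have [cg|cg] := eqVneq (g _c) 0.
  have [ck|ck] := eqVneq (k _c) 0.
    have c0 : (g * k)%g _c = 0 by rewrite gkc cg ck; ring.
    rewrite (xfun_d c0) (xfun_d cg) (xfun_d ck).
    by rewrite !(hMl, hMr, hVl, hVr) ?(mulf_neq0, invr_eq0) // !hUl // !invr1 !mulr1.
  have e : (g * k)%g _c = g _d * k _c by rewrite gkc cg; ring.
  rewrite (xfun_c (g := (g * k)%g)) e ?mulf_neq0 // (xfun_d cg) (xfun_c ck).
  by rewrite mulfK // hUr // ?mulf_neq0 ?invr_eq0 // mulf_neq0.
have [ck|ck] := eqVneq (k _c) 0.
  have e : (g * k)%g _c = g _c * k _a by rewrite gkc ck; ring.
  rewrite (xfun_c (g := (g * k)%g)) e ?mulf_neq0 // (xfun_c cg) (xfun_d ck).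
  by rewrite mulrAC mulfV // mul1r hUl // !mulf_neq0 ?invr_eq0.
rewrite (xfun_c cg) (xfun_c ck).
have [cgk|cgk] := eqVneq ((g * k)%g _c) 0.
  rewrite (xfun_d cgk) !(hMl, hMr, hVl, hVr) ?(mulf_neq0, invr_eq0) //.
  rewrite !(hUl _ d3) // !(hUr _ d3) // mul1r invr1 mul1r invrK.
  have -> : k _c = - g _c * (k _a / g _d).
    by apply: (mulfI d10); move/eqP: cgk; rewrite gkc addrC addr_eq0 => /eqP ->; field_nz.
  rewrite !(hMr, hVr) ?(mulf_neq0, invr_eq0, oppr_eq0) // hN // (hUr _ a2) // (hUr _ d1) //.
  by rewrite invr1 !mulr1.
rewrite (xfun_c cgk).
have St : h (g _c * k _a / (g * k)%g _c) (g _d * k _c / (g * k)%g _c) = 1.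
  apply: (hilb_steinberg n_gt0 cop mu_full hilbP); rewrite ?mulf_neq0 ?invr_eq0 //.
  by rewrite -mulrDl -gkc mulfV.
move: St; rewrite !(hMl, hMr, hVl, hVr) ?(mulf_neq0, invr_eq0) //.
rewrite !(hUl _ a2) // !(hUr _ d1) // => St.
by rewrite -[RHS]St; field_nz.
Qed.

Lemma sec_congruenceM m g k : (0 < m)%N -> congruence m g -> congruence m k ->
  (sec g * sec k)%g = sec (g * k)%g.
Proof.
move=> m0 hg hk; apply: sec_mul; apply: kubota_congruence; exact: congruence_le m0.
Qed.

Definition sec_congruence m : set cover := [set x | exists2 k, congruence m k & x = sec k].

Lemma open_sec_congruence m : (0 < m)%N -> open_subgroup [set: cover] (sec_congruence m).
Proof.
move=> m0; split=> //; last by exists m => // g hg _; exists g.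
split.
- by exists 1%g => //; apply: congruence1.
- move=> _ _ [g hg ->] [k hk ->]; exists (g * k)%g; first exact: congruenceM.
  exact: sec_congruenceM hg hk.
- move=> _ y [g hg ->] e; exists (g^-1)%g; first exact: congruenceV.
  have -> : y = (sec (g^-1)%g * (sec g * y))%g.
    rewrite cmulA (sec_congruenceM m0 (congruenceV hg) hg) mulVg.
    by rewrite [sec _]sec1 cmul1.
  by rewrite e cmulr1.
Qed.

(** A conjugate of [sec k] could differ from the lift of the conjugate by a root of unity. That it
    does not for small k makes right translates of smooth sections smooth. *)
Definition commutes_small (x : cover) := forall m, (0 < m)%N -> exists2 m', (0 < m')%N &
  forall k, congruence m' k -> exists2 k', congruence m k' & (sec k * x = x * sec k')%g.

Lemma commutes_smallM (x y : cover) : commutes_small x -> commutes_small y -> commutes_small (x *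
  y)%g.
Proof.
move=> hx hy m m0; have [m1 m10 h1] := hy m m0; have [m2 m20 h2] := hx m1 m10.
exists m2 => // k /h2[k1 /h1[k2 hk2 e2] e1]; exists k2 => //.
by rewrite cmulA e1 -!cmulA e2.
Qed.

Lemma commutes_small_sec g :
  (forall k, congruence 1 k -> congruence 1 (g^-1 * k * g)%g ->
     K k g = K g (g^-1 * k * g)%g) -> commutes_small (sec g).
Proof.
move=> hK m m0; have [m' m'0 h'] := conj_congruence g m; exists m' => // k hk.
exists (g^-1 * k * g)%g; first exact: h'.
apply: cover_ext; first by rewrite /= !mulgA mulgV mul1g.
by rewrite /= !mulr1; apply: hK; [exact: congruence_le m'0|exact: congruence_le (h' _ hk) m0].
Qed.

Lemma commutes_small_upper x : commutes_small (sec (upper x)).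
Proof.
apply: commutes_small_sec => k _ _.
by rewrite (kubota_upperl) (kubota_upperr).
Qed.

Lemma commutes_small_diag a : a != 0 -> commutes_small (sec (diag a)).
Proof.
move=> a0; apply: commutes_small_sec => k /congruenceP[_ _ _ d1] hk'.
have /congruenceP[_ _ _ d2] := hk'; set k' := (_ * k * _)%g in hk' d2 *.
have e : k' _c = k _c * (a * a).
  have [ea eb ec ed] := sl_invE (diag a).
  by rewrite /k' !sl_mulE ec ed (diagE a0) !mat2E; ring.
rewrite (kubota_diagl) //; have [c0|c0] := eqVneq (k _c) 0.
  rewrite (kubota_diagr_d) // hUr // xfun_d ?hUl //.
  by rewrite e c0 mul0r.
rewrite (kubota_diagr_c) // xfun_c e ?mulf_neq0 //.
rewrite !hMl ?mulf_neq0 // (hA a0 c0) hS // -[X in _ * (X * _)](hN1V a0) mulVf // mulr1.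
by rewrite invrK.
Qed.

Lemma commutes_small_weyl : commutes_small (sec weyl).
Proof.
apply: commutes_small_sec => k /congruenceP[_ _ _ d1] hk'.
have /congruenceP[a2 _ _ _] := hk'; set k' := (_ * k * _)%g in hk' a2 *.
have dw : (k * weyl)%g _c = k _d by rewrite !sl_mulE !weylE !mat2E; ring.
have aw : (weyl * k')%g _c = k' _a by rewrite [LHS]sl_mulE !weylE !mat2E; ring.
have X0 := @xfun_neq0; have d10 := one_neq0 d1; have a20 := one_neq0 a2.
rewrite /kubota xfun_weyl !divr1 (xfun_c (g := (k * weyl)%g)) ?dw //.
rewrite hUr ?mulf_neq0 ?invr_eq0 //.
by rewrite (xfun_c (g := (weyl * k')%g)) ?aw // hUl // mulf_neq0 ?invr_eq0.
Qed.

Lemma commutes_small_all (x : cover) : commutes_small x.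
Proof.
case: x => g e; rewrite cover_cen; apply: commutes_smallM.
  by move=> m m0; exists m => // k hk; exists k => //; rewrite -cen_comm.
have [c0|c0] := eqVneq (g _c) 0.
  have [a0 ->] := sec_small c0; apply: commutes_smallM.
    exact: commutes_small_diag.
  exact: commutes_small_upper.
rewrite (sec_big c0) /wn -sec_upperr; apply: commutes_smallM; first exact: commutes_small_upper.
apply: commutes_smallM; first by apply: commutes_small_diag; rewrite invr_eq0.
by apply: commutes_smallM; [exact: commutes_small_weyl|exact: commutes_small_upper].
Qed.

End CoverGroup.

(** * Eigenvectors and orthogonal projections *)

Section LinearAlgebra.
Variables (C : numClosedFieldType) (E : lmodType C).
Implicit Types (X : set E) (u x y : E).

Definition subspace X := X 0 /\ forall (c : C) x y, X x -> X y -> X (c *: x + y).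

(** Bounded dimension as linear dependence of any [N + 1] vectors; the property passes to subsets
    without a choice of basis. *)
Definition dim_le N X := forall x : 'I_N.+1 -> E, (forall i, X (x i)) ->
  exists c : 'I_N.+1 -> C, (exists i, c i != 0) /\ \sum_i c i *: x i = 0.

Section Subspace.
Variable X : set E.
Hypothesis Xsub : subspace X.

Lemma subspaceD x y : X x -> X y -> X (x + y).
Proof. by move=> hx hy; have := Xsub.2 1 _ _ hx hy; rewrite scale1r. Qed.

Lemma subspaceZ c x : X x -> X (c *: x).
Proof. by move=> hx; have := Xsub.2 c _ _ hx Xsub.1; rewrite addr0. Qed.

Lemma subspaceB x y : X x -> X y -> X (x - y).
Proof. by move=> hx hy; rewrite -scaleN1r; apply: subspaceD => //; apply: subspaceZ. Qed.

Lemma subspace_sum (I : Type) (r : seq I) (P : pred I) (f : I -> E) :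
  (forall i, P i -> X (f i)) -> X (\sum_(i <- r | P i) f i).
Proof. move=> h; elim/big_ind: _ => //; [exact: Xsub.1|exact: subspaceD]. Qed.

Section Eigen.
Variable M : E -> E.
Hypothesis MX : forall x, X x -> X (M x).
Hypothesis Mlin : forall c x y, X x -> X y -> M (c *: x + y) = c *: M x + M y.

Let MD x y : X x -> X y -> M (x + y) = M x + M y.
Proof. by move=> hx hy; have := Mlin 1 hx hy; rewrite !scale1r. Qed.

Let M0 : M 0 = 0.
Proof. by have := MD Xsub.1 Xsub.1; rewrite addr0 => /eqP; rewrite -subr_eq0 opprD addNKr
  oppr_eq0 => /eqP. Qed.

Let MZ c x : X x -> M (c *: x) = c *: M x.
Proof. by move=> hx; have := Mlin c hx Xsub.1; rewrite M0 !addr0. Qed.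

Let iterX i x : X x -> X (iter i M x).
Proof. by move=> hx; elim: i => //= i; apply: MX. Qed.

Let peval N (P : {poly C}) x := \sum_(i < N) P`_i *: iter i M x.

Let pevalX N P x : X x -> X (peval N P x).
Proof. by move=> hx; apply: subspace_sum => i _; apply: subspaceZ; apply: iterX. Qed.

Let M_sum N (f : nat -> E) : (forall i, X (f i)) -> M (\sum_(i < N) f i) = \sum_(i < N) M (f i).
Proof.
move=> hf; elim: N => [|N IHN]; first by rewrite !big_ord0.
by rewrite !big_ord_recr /= MD ?IHN //; apply: subspace_sum.
Qed.

Let peval_XsubC N (a : C) (Q : {poly C}) x : X x -> (size Q <= N)%N ->
  peval N.+1 (('X - a%:P) * Q) x = M (peval N Q x) - a *: peval N Q x.
Proof.
move=> hx sQ; rewrite /peval.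
rewrite (@M_sum N (fun i => Q`_i *: iter i M x)); last by move=> i; apply: subspaceZ; apply: iterX.
have -> : \sum_(i < N.+1) (('X - a%:P) * Q)`_i *: iter i M x =
    \sum_(i < N.+1) ('X * Q)`_i *: iter i M x - \sum_(i < N.+1) a *: (Q`_i *: iter i M x).
  by rewrite -sumrB; apply: eq_bigr => i _; rewrite mulrBl coefB coefCM scalerBl scalerA.
congr (_ - _); last first.
  by rewrite -scaler_sumr big_ord_recr /= [Q`_N]nth_default // scale0r addr0.
rewrite big_ord_recl coefXM /= scale0r add0r; apply: eq_bigr => i _.
by rewrite coefXM /= MZ //; apply: iterX.
Qed.

Let peval_eigen N (P : {poly C}) x : P != 0 -> (size P <= N)%N -> X x -> x != 0 ->
  peval N P x = 0 -> exists a y, [/\ X y, y != 0 & M y = a *: y].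
Proof.
elim: N P => [|N IHN] P P0 sP hx x0 e.
  by move: P0; rewrite -size_poly_gt0 ltnNge sP.
have [sP1|sP1] := eqVneq (size P) 1%N.
  have /eqP/size_poly1P[c c0 PE] := sP1.
  move: e; rewrite /peval PE big_ord_recl big1 ?addr0 => [|i _].
    by rewrite coefC /= => /eqP; rewrite scaler_eq0 (negPf c0) (negPf x0).
  by rewrite coefC /= scale0r.
have [a /factor_theorem[Q PE]] := closed_rootP _ sP1.
have Q0 : Q != 0 by apply: contraNneq P0 => Q0; rewrite PE Q0 mul0r.
have sQ : (size Q <= N)%N.
  move: sP; rewrite PE size_Mmonic ?monicXsubC // size_XsubC addnC /=.
  by rewrite ltnS.
have [y0|y0] := eqVneq (peval N Q x) 0; first exact: IHN y0.
exists a, (peval N Q x); split=> //; first exact: pevalX.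
by apply/eqP; rewrite -subr_eq0 -peval_XsubC // mulrC -PE e.
Qed.

(** x, M x, ..., M^N x are dependent, so a nonzero polynomial in M kills x; stripping off its linear
    factors one at a time meets an eigenvector. *)
Lemma eigenvector_ex N x : dim_le N X -> X x -> x != 0 ->
  exists a y, [/\ X y, y != 0 & M y = a *: y].
Proof.
move=> hN hx x0; have [i|c [[i ci] e]] := hN (fun i => iter i M x); first exact: iterX.
apply: (@peval_eigen N.+1 (\poly_(i < N.+1) c (inord i)) x) => //.
- apply: contra_neq ci => /polyP/(_ i); rewrite coef_poly ltn_ord coef0 => <-.
  by rewrite inord_val.
- rewrite -[RHS]e; apply: eq_bigr => j _; rewrite coef_poly ltn_ord.
  by rewrite inord_val.
Qed.

End Eigen.

Section Projection.
Variables (I : set E) (B : E -> E -> C) (N : nat).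
Hypotheses (XI : X `<=` I) (Isub : subspace I) (XN : dim_le N X).
Hypothesis Blin : forall c x y z, I x -> I y -> I z -> B (c *: x + y) z = c * B x z + B y z.
Hypothesis Bherm : forall x y, I x -> I y -> B x y = (B y x)^*.
Hypothesis Bpos : forall x, I x -> x != 0 -> B x x != 0.

Let B0 z : I z -> B 0 z = 0.
Proof.
move=> hz; have := Blin 1 Isub.1 Isub.1 hz; rewrite scale1r mul1r addr0 => /eqP.
by rewrite -subr_eq0 opprD addNKr oppr_eq0 => /eqP.
Qed.

Let Bsum (k : nat) (c : nat -> C) (f : nat -> E) z : (forall i, I (f i)) -> I z ->
  B (\sum_(i < k) c i *: f i) z = \sum_(i < k) c i * B (f i) z.
Proof.
move=> hf hz; elim: k => [|k IHk]; first by rewrite !big_ord0 B0.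
have IS : I (\sum_(i < k) c i *: f i).
  elim/big_ind: _ => [|u v hu hv|i _]; first exact: Isub.1.
    by have := Isub.2 1 _ _ hu hv; rewrite scale1r.
  by have := Isub.2 (c i) _ _ (hf i) Isub.1; rewrite addr0.
by rewrite !big_ord_recr /= addrC Blin // IHk addrC.
Qed.

Let ortho (k : nat) (y : nat -> E) := [/\ forall i, X (y i), forall i, (i < k)%N -> y i != 0 &
  forall i j, (i < k)%N -> (j < k)%N -> i != j -> B (y i) (y j) = 0].

Let ortho_le k (y : nat -> E) : ortho k y -> (k <= N)%N.
Proof.
move=> [yX y0 yo]; rewrite leqNgt; apply/negP => lt.
have [c [[i ci] e]] := XN (x := fun i : 'I_N.+1 => y i) (fun i => yX i).
have ik : (i < k)%N by apply: leq_trans (ltn_ord i) _.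
have := congr1 (fun u => B u (y i)) e; rewrite /= B0; last exact: XI.
have -> : \sum_(j < N.+1) c j *: y j = \sum_(j < N.+1) c (inord j) *: y j.
  by apply: eq_bigr => j _; rewrite inord_val.
rewrite (@Bsum _ (fun j => c (inord j))); [|by move=> j; apply: XI|exact: XI].
rewrite (bigD1 i) //= big1 ?addr0 => [|j ji].
  move/eqP; rewrite inord_val mulf_eq0 (negPf ci) /=.
  by apply/negP; apply: Bpos; [exact: XI|exact: y0].
by rewrite (yo j i) ?mulr0 //; apply: leq_trans (ltn_ord j) _.
Qed.

(** An orthogonal family of nonzero vectors in X has at most N members, and a maximal one spans X,
    since x minus its components could otherwise be appended. The projection is then given by the
    usual coefficients. *)
Lemma ortho_projection f : I f -> exists2 w, X w & forall x, X x -> B (f - w) x = 0.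
Proof.
move=> If; pose P k := `[< exists y : nat -> E, ortho k y >].
have ex : exists k, P k by exists 0%N; apply/asboolP; exists (fun=> 0 : E); split=> // _; exact:
  Xsub.1.
have ub k : P k -> (k <= N)%N by move=> /asboolP[y]; apply: ortho_le.
case: (ex_maxnP ex ub) => k /asboolP[y [yX y0 yo]] kmax.
have IX x : X x -> I x by apply: XI.
pose pr f := \sum_(i < k) (B f (y i) / B (y i) (y i)) *: y i.
have prX g : X (pr g) by apply: subspace_sum => i _; apply: subspaceZ.
have IB g g' : I g -> I g' -> I (g - g').
  by move=> hg hg'; rewrite addrC -scaleN1r; apply: Isub.2.
have prO g (j : 'I_k) : I g -> B (g - pr g) (y j) = 0.
  move=> Ig; have -> : g - pr g = (-1) *: pr g + g by rewrite scaleN1r addrC.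
  rewrite Blin ?mulN1r; [|exact: IX|exact: Ig|exact: IX].
  rewrite (@Bsum _ (fun i => B g (y i) / B (y i) (y i))); [|by move=> i; exact: IX|exact: IX].
  rewrite (bigD1 j) //= big1 ?addr0 => [|i ij].
    by rewrite divfK ?addNr //; apply: Bpos; [exact: IX|exact: y0].
  by rewrite (yo i j) ?mulr0.
exists (pr f) => // x hx.
have xE : x = pr x.
  apply/eqP; rewrite -subr_eq0; apply/negPn/negP => z0.
  have zX : X (x - pr x) by apply: subspaceB.
  suff : (k.+1 <= k)%N by rewrite ltnn.
  apply: kmax; apply/asboolP; exists (fun i => if (i == k)%N then x - pr x else y i); split.
  - by move=> i; case: ifP.
  - move=> i; rewrite ltnS leq_eqVlt; case: eqP => //= _; exact: y0.
  - have xo i : (i < k)%N -> B (x - pr x) (y i) = 0.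
      by move=> ik; apply: (prO x (Ordinal ik)); apply: IX.
    move=> i j; rewrite !ltnS [(i <= _)%N]leq_eqVlt [(j <= _)%N]leq_eqVlt; case: eqP => [->|_]
      /=; case: eqP => [->|_] //=.
    + by rewrite eqxx.
    + by move=> _ jk _; apply: xo.
    + by move=> ik _ _; rewrite Bherm; [rewrite xo // conjC0|exact: IX|exact: IX].
    + exact: yo.
have IfP : I (f - pr f) by apply: IB => //; apply: IX.
rewrite xE Bherm; [|exact: IfP|exact: IX].
rewrite (@Bsum _ (fun i => B x (y i) / B (y i) (y i))); [|by move=> i; exact: IX|exact: IfP].
rewrite big1 ?conjC0 // => i _; rewrite [B (y i) (f - _)]Bherm; [|exact: IX|exact: IfP].
by rewrite prO // conjC0 mulr0.
Qed.

End Projection.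
End Subspace.

(** [Phi] embeds X into a space of dimension [#|J| * size s]; for one vector more, the coordinate
    matrix has a nonzero left kernel. *)
Lemma dim_le_ker (V : lmodType C) (J : finType) (s : seq V) (X : set E) (Phi : E -> J -> V) :
  (forall v : V, exists c : nat -> C, v = \sum_(i < size s) c i *: s`_i) ->
  (forall j c x y, X x -> X y -> Phi (c *: x + y) j = c *: Phi x j + Phi y j) ->
  subspace X ->
  (forall x, X x -> (forall j, Phi x j = 0) -> x = 0) ->
  exists N, dim_le N X.
Proof.
move=> /boolp.choice[co coP] Plin Xs Pker; pose T := (J * 'I_(size s))%type.
exists #|{: T}| => x hx.
pose A := \matrix_(k < #|{: T}|.+1, l < #|{: T}|)
  co (Phi (x k) (enum_val l).1) (enum_val l).2.
have kA : kermx A != 0.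
  rewrite -mxrank_eq0 mxrank_ker -lt0n subn_gt0 ltnS.
  exact: rank_leq_col.
have [u uA u0] := rowV0Pn kA.
have {}uA : u *m A = 0 by apply/sub_kermxP.
exists (fun i => u 0 i); split.
  by have [i ui] := rV0Pn _ u0; exists i.
apply: Pker; first by apply: subspace_sum => // i _; apply: subspaceZ.
move=> j; have Psum : Phi (\sum_i u 0 i *: x i) j = \sum_i u 0 i *: Phi (x i) j.
  have P0 : Phi 0 j = 0.
    have := Plin j 1 0 0 Xs.1 Xs.1; rewrite !scale1r addr0 => /eqP.
    by rewrite -subr_eq0 opprD addNKr oppr_eq0 => /eqP.
  elim: (index_enum _) => [|i r IHr]; first by rewrite !big_nil.
  rewrite !big_cons Plin ?IHr //; apply: subspace_sum => // k _; exact: subspaceZ.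
rewrite Psum; under eq_bigr => i _ do rewrite (coP (Phi (x i) j)) scaler_sumr.
rewrite exchange_big big1 //= => l _.
under eq_bigr => i _ do rewrite scalerA.
rewrite -scaler_suml; have := congr1 (fun M : 'rV_ _ => M 0 (enum_rank (j, l))) uA.
rewrite mxE [RHS]mxE /=; under eq_bigr => i _ do rewrite mxE enum_rankK /=.
by move=> ->; rewrite scale0r.
Qed.

End LinearAlgebra.

(** * Genuine representations of the covering torus *)

Lemma diag_congruence (p : nat) (F : padicField p) m (a : F) :
  (0 < m)%N -> vge m%:Z (a - 1) -> a != 0 /\ congruence m (diag a).
Proof.
move=> m0 ha; have aU : fin_unit a by apply: one_unit; apply: vge_le ha _; lia.
have [a0 va] := aU; split=> //; apply: congruenceI; rewrite diagE // ?mat2E //; try exact: vge0.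
have -> : a^-1 - 1 = - (a - 1) * a^-1 by field.
by apply: (vgeM (vgeN ha) (fin_unit_vge (fin_unitV aU))); lia.
Qed.

Section ClassSums.
Variables (p n : nat) (F : padicField p).
Hypotheses (n_gt0 : (0 < n)%N) (cop : coprime p n).
Variables (w g : F).
Hypotheses (w0 : w != 0) (w1 : Defs.pval w = 1).
Hypotheses (gU : fin_unit g) (gP : (residue_card F).-1.-primitive_root (presred g)).

Lemma sum_shift (E : zmodType) (f : nat -> E) k : (forall i, f (i + n)%N = f i) ->
  \sum_(i < n) f (i + k)%N = \sum_(i < n) f i.
Proof.
move=> fn; elim: k => [|k IHk]; first by apply: eq_bigr => i _; rewrite addn0.
rewrite -IHk; case: n fn => [|n'] fn; first by rewrite !big_ord0.
rewrite big_ord_recr [RHS]big_ord_recl /= addrC; congr (_ + _).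
  by rewrite -addSnnS addnC fn.
by apply: eq_bigr => i _; rewrite /bump /= add1n addSnnS.
Qed.

Definition npow_invariant (E : Type) (f : F -> E) :=
  forall x c, x != 0 -> c != 0 -> f (x * c ^+ n) = f x.

(* The products w^i g^j, for i, j < n, represent F^* modulo n-th powers. *)
Definition class_sum (E : zmodType) (f : F -> E) : E :=
  \sum_(i < n) \sum_(j < n) f (w ^+ i * g ^+ j).

(** Multiplication by b = w^k g^l c^n shifts the exponents i and j cyclically modulo n, hence
    permutes the classes. *)
Lemma class_sum_shift (E : zmodType) (f : F -> E) b : npow_invariant f -> b != 0 ->
  class_sum (fun x => f (b * x)) = class_sum f.
Proof.
move=> fn b0; have [g0 _] := gU.
have [k [l [_ _ [c c0 bE]]]] := npow_decomp n_gt0 cop w0 w1 gU gP b0.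
have E1 i j : f (b * (w ^+ i * g ^+ j)) = f (w ^+ (i + k) * g ^+ (j + l)).
  rewrite -(fn (w ^+ (i + k) * g ^+ (j + l)) c) ?mulf_neq0 ?expf_neq0 //.
  by congr f; rewrite bE !exprD; ring.
rewrite /class_sum; under eq_bigr => i _ do under eq_bigr => j _ do rewrite E1.
rewrite (sum_shift (f := fun i => \sum_(j < n) f (w ^+ i * g ^+ (j + l)))).
  apply: eq_bigr => i _; rewrite (sum_shift (f := fun j => f (w ^+ i * g ^+ j))) // => j.
  by rewrite exprD mulrA fn // mulf_neq0 ?expf_neq0.
move=> i; apply: eq_bigr => j _; rewrite exprD mulrAC fn // mulf_neq0 ?expf_neq0 //.
Qed.

Lemma class_sum_eq (E : zmodType) (f f' : F -> E) : (forall x, x != 0 -> f x = f' x) ->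
  class_sum f = class_sum f'.
Proof.
move=> ff'; have [g0 _] := gU; apply: eq_bigr => i _; apply: eq_bigr => j _.
by rewrite ff' // mulf_neq0 ?expf_neq0.
Qed.

Lemma class_sumZ (C : pzRingType) (E : lmodType C) (f : F -> E) c :
  c *: class_sum f = class_sum (fun x => c *: f x).
Proof.
by rewrite /class_sum scaler_sumr; apply: eq_bigr => i _; rewrite scaler_sumr.
Qed.

Lemma class_sum_linear (C : pzRingType) (E E' : lmodType C) (L : E -> E') (f : F -> E) :
  linear L -> L (class_sum f) = class_sum (fun x => L (f x)).
Proof.
move=> Llin; pose L' : {linear E -> E'} := HB.pack L (GRing.isLinear.Build _ _ _ _ L Llin).
have LS (h : 'I_n -> E) : L (\sum_i h i) = \sum_i L (h i) by exact: (linear_sum L').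
by rewrite /class_sum LS; apply: eq_bigr => i _; rewrite LS.
Qed.

Lemma sum_root_unity (C : idomainType) (z : C) : z ^+ n = 1 -> z != 1 ->
  \sum_(i < n) z ^+ i = 0.
Proof.
move=> zn z1; have := subrX1 z n; rewrite zn subrr => /esym/eqP.
by rewrite mulf_eq0 subr_eq0 (negPf z1) => /eqP.
Qed.

End ClassSums.

Section Torus.
Variables (R : realType) (p n : nat) (F : padicField p).
Hypotheses (n_gt0 : (0 < n)%N) (cop : coprime p n).
Hypothesis mu_full : exists z : F, n.-primitive_root z.
Variable iota : mu F n -> R[i].
Hypothesis iotaP : identification iota.
Variable hilb : F -> F -> mu F n.
Hypothesis hilbP : is_hilbert_symbol hilb.
Local Notation C := R[i].
Local Notation cover := (cover_of hilb).
Local Notation sec := (sec hilb).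
Local Notation cen := (cen hilb).
Implicit Types (a b c x y : F).

Definition iota_hilb a b : C := iota (hilb a b).
Local Notation s := iota_hilb.

Lemma iotaM (x y : mu F n) : iota (x * y)%g = iota x * iota y.
Proof. by case: iotaP. Qed.

Lemma iota_exp (x : mu F n) : iota x ^+ n = 1.
Proof. by case: iotaP => _ _ h; apply/h; exists x. Qed.

Lemma iota_neq0 (x : mu F n) : iota x != 0.
Proof.
apply/eqP => x0; have := iota_exp x; rewrite x0 expr0n gtn_eqF // => /eqP.
by rewrite eq_sym oner_eq0.
Qed.

Lemma iota1 : iota 1%g = 1.
Proof. by apply: (mulfI (iota_neq0 1%g)); rewrite -iotaM mulg1 mulr1. Qed.

Lemma hs_neq0 a b : s a b != 0. Proof. exact: iota_neq0. Qed.

Lemma hs_exp a b : s a b ^+ n = 1. Proof. exact: iota_exp. Qed.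

Lemma hsMl a a' b : a != 0 -> a' != 0 -> b != 0 -> s (a * a') b = s a b * s a' b.
Proof.
move=> a0 a'0 b0; rewrite /s -iotaM; congr iota; apply: val_inj.
exact: (hilbMl n_gt0 mu_full hilbP).
Qed.

Lemma hsMr a b b' : a != 0 -> b != 0 -> b' != 0 -> s a (b * b') = s a b * s a b'.
Proof.
move=> a0 b0 b'0; rewrite /s -iotaM; congr iota; apply: val_inj.
exact: (hilbMr n_gt0 mu_full hilbP).
Qed.

Lemma hs_of_hilb1 a b : mu_val (hilb a b) = 1 -> s a b = 1.
Proof. by move=> e; rewrite /s -iota1; congr iota; apply: val_inj. Qed.

Lemma hs1l b : b != 0 -> s 1 b = 1.
Proof. by move=> b0; apply: hs_of_hilb1; apply: (hilb1l n_gt0 mu_full hilbP). Qed.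

Lemma hs1r a : a != 0 -> s a 1 = 1.
Proof. by move=> a0; apply: hs_of_hilb1; apply: (hilb1r n_gt0 mu_full hilbP). Qed.

Lemma hs_anti a b : a != 0 -> b != 0 -> s a b * s b a = 1.
Proof.
move=> a0 b0; rewrite /s -iotaM -iota1; congr iota; apply: val_inj.
exact: (hilb_anti n_gt0 cop mu_full hilbP).
Qed.

Lemma hs_self a : a != 0 -> s a a = s a (-1).
Proof.
by move=> a0; congr iota; apply: val_inj; apply: (hilb_self n_gt0 cop mu_full hilbP).
Qed.

Lemma hs_units a b : fin_unit a -> fin_unit b -> s a b = 1.
Proof. by move=> ? ?; apply: hs_of_hilb1; apply: (hilb_units n_gt0 cop mu_full hilbP). Qed.

Lemma hs_npow_l c b : c != 0 -> b != 0 -> s (c ^+ n) b = 1.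
Proof. by move=> ? ?; apply: hs_of_hilb1; apply: (hilb_npow_l n_gt0 mu_full hilbP). Qed.

Lemma hs_npow_r a c : a != 0 -> c != 0 -> s a (c ^+ n) = 1.
Proof. by move=> ? ?; apply: hs_of_hilb1; apply: (hilb_npow_r n_gt0 mu_full hilbP). Qed.

Lemma hs_one_unit_l a u : a != 0 -> vge 1 (u - 1) -> s u a = 1.
Proof. by move=> ? ?; apply: hs_of_hilb1; apply: (hilb_one_unit_l n_gt0 cop mu_full hilbP). Qed.

Lemma hs_one_unit_r a u : a != 0 -> vge 1 (u - 1) -> s a u = 1.
Proof. by move=> ? ?; apply: hs_of_hilb1; apply: (hilb_one_unit_r n_gt0 cop mu_full hilbP). Qed.

Lemma hsXl a b i : a != 0 -> b != 0 -> s (a ^+ i) b = s a b ^+ i.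
Proof.
move=> a0 b0; elim: i => [|i IHi]; first by rewrite !expr0 hs1l.
by rewrite !exprS hsMl ?expf_neq0 // IHi.
Qed.

Lemma hsXr a b i : a != 0 -> b != 0 -> s a (b ^+ i) = s a b ^+ i.
Proof.
move=> a0 b0; elim: i => [|i IHi]; first by rewrite !expr0 hs1r.
by rewrite !exprS hsMr ?expf_neq0 // IHi.
Qed.

Lemma hsVl a b : a != 0 -> b != 0 -> s a^-1 b = (s a b)^-1.
Proof.
move=> a0 b0; apply: (mulfI (hs_neq0 a b)).
by rewrite -hsMl ?invr_eq0 // !mulfV ?hs1l // hs_neq0.
Qed.

Lemma N1_neq0 : (-1 : F) != 0. Proof. by rewrite oppr_eq0 oner_eq0. Qed.

Lemma hsN1_sq a : a != 0 -> s a (-1) * s a (-1) = 1.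
Proof. by move=> a0; rewrite -hsMr ?N1_neq0 // mulrNN mulr1 hs1r. Qed.

Lemma hsN1_odd a : odd n -> a != 0 -> s a (-1) = 1.
Proof.
move=> on a0; have -> : (-1 : F) = (-1) ^+ n by rewrite -signr_odd on expr1.
by apply: hs_npow_r => //; apply: N1_neq0.
Qed.

Definition dd : nat := n %/ gcdn n 2.

Lemma dd_double : (n %| dd * 2)%N /\ (0 < dd)%N.
Proof.
have gd : (gcdn n 2 %| n)%N := dvdn_gcdl n 2.
split; last by rewrite divn_gt0 ?gcdn_gt0 ?n_gt0 // dvdn_leq.
have /dvdnP[k kE] := dvdn_gcdr n 2; rewrite /dd [X in (_ * X)%N]kE mulnCA divnK //.
exact: dvdn_mull.
Qed.

(** n divides 2d, so (a^d, b) is a sign and equals its inverse (b, a^d). This is why t(a^d) commutes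
    with the torus. *)
Lemma hs_dd a b : a != 0 -> b != 0 -> s (a ^+ dd) b = s b (a ^+ dd).
Proof.
move=> a0 b0; have ad := expf_neq0 dd a0.
apply: (mulIf (hs_neq0 (a ^+ dd) b)); rewrite [RHS]mulrC hs_anti //.
have [/dvdnP[k kE] _] := dd_double.
by rewrite hsXl // -exprD addnn -muln2 kE mulnC exprM hs_exp expr1n.
Qed.

Variables (V : lmodType C) (tau : cover -> V -> V).
Hypothesis tau_rep : representation (torus hilb) tau.
Hypothesis tau_genuine : genuine tau iota.

Definition tau_diag a : V -> V := tau (sec (diag a)).
Local Notation t := tau_diag.

Lemma torusP (x : cover) : torus hilb x <-> exists2 a, a != 0 & base x = diag a.
Proof.
split=> [[a a0 e]|[a a0 e]]; exists a => //.
  by apply: val_inj; rewrite /= diagE // e expr1.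
by rewrite e diagE // expr1.
Qed.

Lemma torus_diag a : a != 0 -> torus hilb (sec (diag a)).
Proof. by move=> a0; apply/torusP; exists a. Qed.

Lemma torus_cen e : torus hilb (cen e).
Proof. by apply/torusP; exists 1; rewrite ?oner_eq0 // diag1. Qed.

Lemma tau_torus (x : cover) a v : a != 0 -> base x = diag a ->
  tau x v = iota (fiber x) *: t a v.
Proof.
case: x => [y e] a0 /= ->; rewrite (cover_cen n_gt0 mu_full hilbP).
by case: tau_rep => _ _ ->; [rewrite tau_genuine|exact: torus_cen|exact: torus_diag].
Qed.

Lemma t_linear a : a != 0 -> linear (t a).
Proof. by move=> a0; case: tau_rep => h _ _; apply: h; apply: torus_diag. Qed.

Lemma tD a u v : a != 0 -> t a (u + v) = t a u + t a v.
Proof. by move=> a0; have := t_linear a0 1 u v; rewrite !scale1r. Qed.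

Lemma t0 a : a != 0 -> t a 0 = 0.
Proof.
by move=> a0; have /eqP := tD 0 0 a0; rewrite addr0 -subr_eq0 opprD addNKr oppr_eq0 => /eqP.
Qed.

Lemma tZ a (c : C) v : a != 0 -> t a (c *: v) = c *: t a v.
Proof. by move=> a0; have := t_linear a0 c v 0; rewrite t0 // !addr0. Qed.

Lemma tM a b v : a != 0 -> b != 0 -> t a (t b v) = s b a *: t (a * b) v.
Proof.
move=> a0 b0; case: tau_rep => _ _ h.
rewrite /t -h; [|exact: torus_diag|exact: torus_diag].
rewrite (sec_diagM n_gt0 mu_full hilbP) // h.
- by rewrite tau_genuine.
- exact: torus_cen.
- by apply: torus_diag; rewrite mulf_neq0.
Qed.

Lemma t1 v : t 1 v = v.
Proof. by rewrite /t diag1; case: tau_rep => _ -> _. Qed.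

Lemma tV a v : a != 0 -> t a (t a^-1 v) = s a (-1) *: v.
Proof.
move=> a0; rewrite tM ?invr_eq0 // mulfV // t1 hsVl // hs_self //; congr (_ *: _).
by apply: (mulfI (hs_neq0 a (-1))); rewrite mulfV ?hs_neq0 // hsN1_sq.
Qed.

Lemma t_surj a v : a != 0 -> exists u, t a u = v.
Proof.
move=> a0; exists (s a (-1) *: t a^-1 v).
by rewrite tZ // tV // scalerA hsN1_sq // scale1r.
Qed.

Lemma t_dd_comm a b v : a != 0 -> b != 0 -> t (a ^+ dd) (t b v) = t b (t (a ^+ dd) v).
Proof. by move=> a0 b0; have ad := expf_neq0 dd a0; rewrite !tM // hs_dd // mulrC. Qed.

Lemma t_npow_mul x c v : x != 0 -> c != 0 -> t (x * c ^+ n) v = t x (t (c ^+ n) v).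
Proof. by move=> x0 c0; rewrite tM ?expf_neq0 // hs_npow_l // scale1r. Qed.

Hypothesis tau_irr : irreducible (torus hilb) tau.

Lemma irr_subspace (X : set V) : subspace X -> (forall a v, a != 0 -> X v -> X (t a v)) ->
  (exists2 v, X v & v != 0) -> forall v, X v.
Proof.
move=> Xs Xt [v Xv v0] u; apply: contrapT => nXu; apply: (tau_irr.2).
exists X; split=> //.
- split; [exact: Xs.1|exact: Xs.2|move=> x y /torusP[a a0 xE] Xy].
  by rewrite (tau_torus _ a0 xE); apply: subspaceZ => //; apply: Xt.
- by move=> XE; move: Xv; rewrite XE => /= vE; rewrite vE eqxx in v0.
- by move=> XE; apply: nXu; rewrite XE.
Qed.

Hypothesis tau_smooth : smooth (torus hilb) tau.
Hypothesis tau_adm : admissible (torus hilb) tau.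

(** One nonzero vector is fixed by t(1 + P^m) for some m. The symbol being trivial on 1 + P, the
    vectors fixed by t(1 + P^m) form a stable subspace, which is therefore all of V. *)
Lemma t_small : exists2 m, (0 < m)%N & forall a v, vge m%:Z (a - 1) -> t a v = v.
Proof.
have [[v v0] _] := tau_irr; have [U [_ _ [m m0 hU]] Uv] := tau_smooth v.
exists m => //; suff h : forall u a, vge m%:Z (a - 1) -> t a u = u by move=> a u; exact: h.
apply: (@irr_subspace [set u | forall a, vge m%:Z (a - 1) -> t a u = u]).
- split=> [a /(diag_congruence m0)[a0 _]|c x y hx hy a ha]; first exact: t0.
  have [a0 _] := diag_congruence m0 ha.
  by rewrite tD // tZ // hx // hy.
- move=> a u a0 hu b hb; have [b0 _] := diag_congruence m0 hb.
  have hb1 : vge 1 (b - 1) by apply: vge_le hb _; lia.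
  rewrite tM // hs_one_unit_r // scale1r mulrC.
  by have := tM u a0 b0; rewrite hs_one_unit_l // scale1r => <-; rewrite hu.
- exists v => // a ha; have [a0 hc] := diag_congruence m0 ha.
  by apply: Uv; apply: hU => //; apply: torus_diag.
Qed.

(** By [t_small] an open subgroup of the torus fixes all of V, and admissibility makes its fixed
    space finite-dimensional. *)
Lemma V_findim : exists sq : seq V, forall v, exists c : nat -> C,
  v = \sum_(i < size sq) c i *: sq`_i.
Proof.
have [m m0 hm] := t_small.
pose U : set cover := [set x | exists2 a, vge m%:Z (a - 1) & x = sec (diag a)].
have oU : open_subgroup (torus hilb) U.
  split.
  - split.
    + by exists 1; rewrite ?subrr ?diag1 //; apply: vge0.
    + move=> _ _ [a ha ->] [b hb ->]; exists (a * b); first exact: vge_one_mul.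
      have [a0 ca] := diag_congruence m0 ha; have [b0 cb] := diag_congruence m0 hb.
      by rewrite (sec_congruenceM n_gt0 cop mu_full hilbP m0 ca cb) diagM.
    + move=> _ y [a ha ->] e; have [a0 ca] := diag_congruence m0 ha.
      have cV := congruenceV ca.
      have aE : (diag a)^-1%g = diag a^-1.
        by apply: (mulgI (diag a)); rewrite mulgV diagM ?invr_eq0 // mulfV // diag1.
      rewrite aE in cV; exists a^-1.
        by have [h _ _ _] := congruenceP cV; move: h; rewrite diagE ?invr_eq0 // mat2E.
      have -> : y = (sec (diag a^-1) * (sec (diag a) * y))%g.
        rewrite (cmulA n_gt0 cop mu_full hilbP) (sec_congruenceM n_gt0 cop mu_full hilbP m0 cV ca).
        by rewrite diagM ?invr_eq0 // mulVf // diag1 (cmul1 n_gt0 mu_full hilbP).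
      by rewrite e (cmulr1 n_gt0 mu_full hilbP).
  - by move=> _ [a ha ->]; apply: torus_diag; case: (diag_congruence m0 ha).
  - exists m => // y hy /torusP[a a0 /= yE]; exists a; last by rewrite yE.
    by have [h _ _ _] := congruenceP hy; move: h; rewrite yE diagE // mat2E.
have [sq hsq] := tau_adm oU; exists sq => v; apply: hsq => _ [a ha ->].
exact: hm.
Qed.

Lemma V_dim : exists N, dim_le N [set: V].
Proof.
have [sq hsq] := V_findim.
by apply: (@dim_le_ker _ V V unit sq [set: V] (fun u _ => u)) => // u _ /(_ tt).
Qed.

Lemma schur (D : V -> V) : linear D -> (forall a v, a != 0 -> D (t a v) = t a (D v)) ->
  exists c : C, forall v, D v = c *: v.
Proof.
move=> Dlin Dt; have [[v v0] _] := tau_irr; have [N hN] := V_dim.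
have D0 : D 0 = 0.
  have /eqP := Dlin 1 0 0; rewrite !scale1r addr0 -subr_eq0 opprD addNKr oppr_eq0.
  by move/eqP.
have sT : subspace [set: V] by split.
have Dlin' (c : C) u z : [set: V] u -> [set: V] z -> D (c *: u + z) = c *: D u + D z.
  by move=> _ _; exact: Dlin.
have [c [y [_ y0 yE]]] := eigenvector_ex sT (fun u _ => I) Dlin' hN I v0.
exists c; apply: irr_subspace; last by exists y.
- split=> [/=|a x z /= hx hz]; first by rewrite D0 scaler0.
  by rewrite Dlin hx hz scalerDr !scalerA mulrC.
- by move=> a x a0 /= hx; rewrite Dt // hx tZ.
Qed.

Lemma t_dd_scalar a : a != 0 -> exists c : C, forall v, t (a ^+ dd) v = c *: v.
Proof.
move=> a0; apply: schur; first by apply: t_linear; rewrite expf_neq0.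
by move=> b v b0; apply: t_dd_comm.
Qed.

Section ClassSumTorus.
Variables (w g : F).
Hypotheses (w0 : w != 0) (w1 : Defs.pval w = 1).
Hypotheses (gU : fin_unit g) (gP : (residue_card F).-1.-primitive_root (presred g)).
Local Notation csum f := (class_sum n w g f).

Let g0 : g != 0. Proof. by case: gU. Qed.

Lemma hs_gen_eq1 i : (s w g ^+ i == 1) = (n %| i)%N.
Proof.
have prim := hilb_unif_gen_prim n_gt0 cop mu_full hilbP gU gP w0 w1.
rewrite (prim_order_dvd prim) -hsXl //; apply/eqP/eqP => [e|e].
  rewrite -(hilbXl n_gt0 mu_full hilbP) //.
  have : hilb (w ^+ i) g = 1%g by case: iotaP => _ inj _; apply: inj; rewrite [LHS]e iota1.
  by move=> ->.
by apply: hs_of_hilb1; rewrite (hilbXl n_gt0 mu_full hilbP).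
Qed.

(** Orthogonality of characters: among the representatives x, only x = 1 has (x, w) = (x, g) = 1,
    and a power e prime to n preserves nontriviality. *)
Lemma sum_hs_class e i j : coprime e n -> (i < n)%N -> (j < n)%N ->
  csum (fun b => s (w ^+ i * g ^+ j) b ^+ e) = if (i == 0%N) && (j == 0%N) then (n * n)%:R else 0.
Proof.
move=> cen hi hj; set x := w ^+ i * g ^+ j.
have x0 : x != 0 by rewrite mulf_neq0 ?expf_neq0.
have -> : csum (fun b => s x b ^+ e) =
    (\sum_(k < n) (s x w ^+ e) ^+ k) * (\sum_(l < n) (s x g ^+ e) ^+ l).
  rewrite mulr_suml; apply: eq_bigr => k _; rewrite mulr_sumr; apply: eq_bigr => l _.
  by rewrite hsMr ?expf_neq0 // exprMn !hsXr // !(exprAC _ e).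
have xg : s x g = s w g ^+ i.
  by rewrite hsMl ?expf_neq0 // !hsXl // (hs_units gU gU) expr1n mulr1.
have eN (z : C) : z ^+ n = 1 -> (z ^+ e) ^+ n = 1 by move=> h; rewrite exprAC h expr1n.
have [i0|i0] := eqVneq i 0%N; last first.
  rewrite [X in _ * X](sum_root_unity (eN _ (hs_exp _ _))) ?mulr0 //.
  rewrite xg -exprM hs_gen_eq1 Gauss_dvdl 1?coprime_sym //.
  by apply/negP => /dvdn_leq; move: i0 hi; lia.
have [j0|j0] := eqVneq j 0%N.
  have -> : x = 1 by rewrite /x i0 j0 !expr0 mulr1.
  rewrite !hs1l // !expr1n; under eq_bigr => k _ do rewrite expr1n.
  by rewrite sumr_const card_ord -natrM.
rewrite [X in X * _](sum_root_unity (eN _ (hs_exp _ _))) ?mul0r //.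
have xw : s x w = (s w g ^+ j)^-1.
  rewrite /x i0 expr0 mul1r hsXl // -exprVn; congr (_ ^+ _).
  by apply: (mulfI (hs_neq0 w g)); rewrite hs_anti // mulfV // hs_neq0.
rewrite xw exprVn -[X in _ != X]invr1 (inj_eq invr_inj) -exprM hs_gen_eq1.
rewrite Gauss_dvdl 1?coprime_sym //.
by apply/negP => /dvdn_leq; move: j0 hj; lia.
Qed.

(* By orthogonality, summing over b leaves only the class x = 1. *)
Lemma class_sum_isolate e (f : F -> V) : coprime e n ->
  (forall b, b != 0 -> csum (fun x => s x b ^+ e *: f x) = 0) -> f 1 = 0.
Proof.
move=> cen h; have : csum (fun b => csum (fun x => s x b ^+ e *: f x)) = 0.
  rewrite (class_sum_eq n w0 gU (f' := fun=> 0)) => [|b b0]; last exact: h.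
  by rewrite /class_sum big1 // => i _; rewrite big1.
have -> : csum (fun b => csum (fun x => s x b ^+ e *: f x)) =
   csum (fun x => csum (fun b => s x b ^+ e) *: f x).
  rewrite /class_sum; under eq_bigr => k _.
    rewrite exchange_big; under eq_bigr => i _ do rewrite exchange_big.
    over.
  rewrite exchange_big; apply: eq_bigr => i _.
  rewrite exchange_big; apply: eq_bigr => j _.
  rewrite scaler_suml; apply: eq_bigr => k _.
  by rewrite scaler_suml.
have -> : csum (fun x => csum (fun b => s x b ^+ e) *: f x) =
    \sum_(i < n) \sum_(j < n) (if (i == 0%N :> nat) && (j == 0%N :> nat) then (n * n)%:R else 0 : C)
      *: f (w ^+ i * g ^+ j).
  by apply: eq_bigr => i _; apply: eq_bigr => j _; rewrite sum_hs_class.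
rewrite (bigD1 (Ordinal n_gt0)) //= (bigD1 (Ordinal n_gt0)) //= !expr0 mulr1.
rewrite big1 ?addr0 => [|j j0]; last by rewrite ifF ?scale0r //; apply: negbTE.
rewrite big1 ?addr0 => [|i i0]; last first.
  by rewrite big1 // => j _; rewrite ifF ?scale0r //; apply/negbTE; rewrite negb_and; apply/orP;
    left.
by move/eqP; rewrite scaler_eq0 pnatr_eq0 muln_eq0 gtn_eqF //= => /eqP.
Qed.

(** If the sum vanished for a nonzero v, applying t(b) and substituting b x for x would twist the
    summands by (x, b). All twisted sums would vanish, and [class_sum_isolate] would give v = 0. *)
Lemma class_sum_t_neq0 : (forall (c : F) v, c != 0 -> t (c ^+ n) v = v) ->
  exists v, csum (fun x => s x (-1) *: t x v) != 0.
Proof.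
move=> tn; have [[v v0] _] := tau_irr; exists v; apply/eqP => e.
move: v0; suff -> : v = 0 by rewrite eqxx.
have := @class_sum_isolate 1 (fun x => s x (-1) *: t x v) (coprime1n n).
rewrite hs1l ?N1_neq0 // scale1r t1; apply => b b0.
pose f x := (s x b * s x (-1)) *: t x v.
have finv : npow_invariant n f.
  move=> x c x0 c0; have cn := expf_neq0 n c0.
  rewrite /f !hsMl ?N1_neq0 // !hs_npow_l ?N1_neq0 // !mulr1.
  by rewrite t_npow_mul // tn.
rewrite (class_sum_eq n w0 gU (f' := f)); last by move=> x _; rewrite expr1 scalerA.
rewrite -[LHS](class_sum_shift n_gt0 cop w0 w1 gU gP finv b0).
have := congr1 (t b) e; rewrite t0 // => e2.
have lin := class_sum_linear n w g (fun x => s x (-1) *: t x v) (t_linear b0).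
rewrite lin in e2.
rewrite (class_sum_eq n w0 gU (f' := fun x => (s b b * s b (-1)) *: t b (s x (-1) *: t x v))).
  by rewrite -class_sumZ e2 scaler0.
move=> x x0; rewrite /f tZ // tM // !hsMl ?N1_neq0 // !scalerA; congr (_ *: _).
ring.
Qed.

(** For L_b = sum of t(x) t(b) t(x), whose terms depend only on the class of x as t(c^n)^2 = 1,
    substituting a x for x gives t(a) L_b t(a) = L_b; for n odd, t(a^-1) is inverse to t(a). Since
    t(x) t(b) t(x) = (x, b)^2 t(x)^2 t(b), the vanishing of every L_b would make every vector 0, by
    [class_sum_isolate] with e = 2, which is prime to n. *)
Lemma intertwiner_ex : odd n ->
  (forall (c : F), c != 0 -> exists2 z : C, z ^+ 2 = 1 & forall v, t (c ^+ n) v = z *: v) ->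
  exists L : V -> V, [/\ linear L, (exists v, L v != 0) &
    forall a v, a != 0 -> L (t a^-1 v) = t a (L v)].
Proof.
move=> on tn; pose L b v := csum (fun x => t x (t b (t x v))).
have inv (h : V -> V) v : (forall (c : C) v, h (c *: v) = c *: h v) ->
    npow_invariant n (fun x => t x (h (t x v))).
  move=> hZ x c x0 c0; have [z z2 tz] := tn c c0.
  by rewrite !t_npow_mul // !tz !tZ // hZ tZ // scalerA -expr2 z2 scale1r.
have Llin b : b != 0 -> linear (L b).
  move=> b0 c u v; rewrite /L /class_sum scaler_sumr -big_split; apply: eq_bigr => i _.
  rewrite scaler_sumr -big_split; apply: eq_bigr => j _ /=.
  by rewrite !(t_linear _ c) // ?mulf_neq0 ?expf_neq0.
have Lt a b v : a != 0 -> b != 0 -> t a (L b (t a v)) = L b v.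
  move=> a0 b0; rewrite /L (class_sum_linear n w g _ (t_linear a0)).
  have bZ (c : C) u : t b (c *: u) = c *: t b u by exact: tZ.
  rewrite -[RHS](class_sum_shift n_gt0 cop w0 w1 gU gP (inv _ v bZ) a0).
  apply: (class_sum_eq n w0 gU) => // x x0.
  rewrite (tM v x0 a0) bZ !tZ // (tM _ a0 x0) scalerA hs_anti // scale1r.
  by rewrite (mulrC x a).
have Lint a b v : a != 0 -> b != 0 -> L b (t a^-1 v) = t a (L b v).
  move=> a0 b0; have ai : a^-1 != 0 by rewrite invr_eq0.
  rewrite -(Lt a^-1 b v ai b0) tV // hsN1_odd // scale1r.
  by [].
have [h|] := EM (forall b v, b != 0 -> L b v = 0); last first.
  move=> /existsNP[b] /existsNP[v] /not_implyP[b0 /eqP nz].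
  by exists (L b); split; [exact: Llin|exists v|move=> a u a0; apply: Lint].
have [[v v0] _] := tau_irr; suff : v = 0 by move=> vE; rewrite vE eqxx in v0.
have := @class_sum_isolate 2 (fun x => t x (t x v)).
rewrite !t1; apply; first by rewrite coprime2n.
move=> b b0; have [u bu] := t_surj v b0.
rewrite -(h b u b0); apply: (class_sum_eq n w0 gU) => // x x0.
rewrite -bu -tZ //; congr (t x _); rewrite (tM u x0 b0) (tM u b0 x0).
rewrite (mulrC b x) scalerA expr2 -mulrA (mulrC (s x b) (s b x)) hs_anti // mulr1.
by [].
Qed.

End ClassSumTorus.
End Torus.

(** * The induced representation *)

Section Induced.
Variables (R : realType) (p n : nat) (F : padicField p).
Hypotheses (n_gt0 : (0 < n)%N) (cop : coprime p n).
Hypothesis mu_full : exists z : F, n.-primitive_root z.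
Variable iota : mu F n -> R[i].
Hypothesis iotaP : identification iota.
Variable hilb : F -> F -> mu F n.
Hypothesis hilbP : is_hilbert_symbol hilb.
Variables (V : lmodType R[i]) (tau : cover_of hilb -> V -> V).
Hypothesis tau_rep : representation (torus hilb) tau.
Hypothesis tau_genuine : genuine tau iota.
Hypothesis tau_irr : irreducible (torus hilb) tau.
Hypothesis tau_smooth : smooth (torus hilb) tau.
Hypothesis tau_adm : admissible (torus hilb) tau.
Local Notation C := R[i].
Local Notation cover := (cover_of hilb).
Local Notation sec := (sec hilb).
Local Notation cen := (cen hilb).
Local Notation v := (@Defs.pval p F).
Local Notation q := (residue_card F).
Local Notation Q := (q%:R : C).
Local Notation s := (iota_hilb iota hilb).
Local Notation t := (tau_diag tau).
Local Notation G := [set: cover].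
Local Notation Ind := (induced tau).
Local Notation rt := (right_transl (V := V)).
Implicit Types (a b c y : F) (g k : SL2 F) (x : cover) (f : cover -> V) (e : mu F n) (u : V).

Let cA x1 x2 x3 : (x1 * (x2 * x3))%g = ((x1 * x2) * x3)%g :> cover.
Proof. exact: (cmulA n_gt0 cop mu_full hilbP). Qed.
Let c1l x : (1 * x)%g = x. Proof. exact: (cmul1 n_gt0 mu_full hilbP). Qed.
Let c1r x : (x * 1)%g = x. Proof. exact: (cmulr1 n_gt0 mu_full hilbP). Qed.

Definition absC a : C := absF R a.

Lemma Qn0 : Q != 0. Proof. exact: Q_neq0. Qed.

Lemma absCE a : a != 0 -> absC a = Q ^ (- v a).
Proof. by move=> a0; rewrite /absC /absF (negPf a0). Qed.

Lemma absC_neq0 a : a != 0 -> absC a != 0.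
Proof. by move=> a0; rewrite absCE // expfz_neq0 ?Qn0. Qed.

Lemma absCM a b : a != 0 -> b != 0 -> absC (a * b) = absC a * absC b.
Proof. by move=> a0 b0; rewrite !absCE ?mulf_neq0 // pvalM // opprD expfzDr ?Qn0. Qed.

Lemma absCV a : a != 0 -> absC a^-1 = (absC a)^-1.
Proof.
move=> a0; apply: (mulfI (absC_neq0 a0)); rewrite -absCM ?invr_eq0 // !mulfV ?absC_neq0 //.
by rewrite absCE ?oner_eq0 // pval1 oppr0 expr0z.
Qed.

Lemma absC_unit a : fin_unit a -> absC a = 1.
Proof. by move=> [a0 va]; rewrite absCE // va oppr0 expr0z. Qed.

Lemma ind_t f a x : Ind f -> a != 0 -> f (sec (diag a) * x)%g = absC a *: t a (f x).
Proof.
move=> [h _] a0; have hu : Nunip (upper 0 : SL2 F) by exists 0; rewrite upperE.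
have := h _ _ x (torus_diag hilb a0) hu.
by rewrite upper0 [sec 1%g]sec1 c1r diagE // mat2_a.
Qed.

Lemma ind_u f y x : Ind f -> f (sec (upper y) * x)%g = f x.
Proof.
move=> [h _]; have hu : Nunip (upper y : SL2 F) by exists y; rewrite upperE.
have := h _ _ x (torus_cen hilb 1%g) hu; rewrite [cen 1%g]/(1%g : cover) c1l sl1E eqxx.
rewrite -/(absC 1) absC_unit ?scale1r; last exact: fin_unit1.
by case: tau_rep => _ -> _.
Qed.

Lemma ind_cen f e x : Ind f -> f (cen e * x)%g = iota e *: f x.
Proof.
move=> [h _]; have hu : Nunip (upper 0 : SL2 F) by exists 0; rewrite upperE.
have := h _ _ x (torus_cen hilb e) hu; rewrite upper0 [sec 1%g]sec1 c1r sl1E eqxx.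
rewrite -/(absC 1) absC_unit ?scale1r; last exact: fin_unit1.
by rewrite tau_genuine.
Qed.

Lemma ind_small f : Ind f -> exists2 m, (0 < m)%N &
  forall k x, congruence m k -> f (x * sec k)%g = f x.
Proof.
by move=> [_ [U [_ _ [m m0 hU]] fU]]; exists m => // k x hk; apply: fU; apply: hU.
Qed.

Lemma indI f : (forall a x, a != 0 -> f (sec (diag a) * x)%g = absC a *: t a (f x)) ->
  (forall y x, f (sec (upper y) * x)%g = f x) ->
  (forall e x, f (cen e * x)%g = iota e *: f x) ->
  (exists2 m, (0 < m)%N & forall k x, congruence m k -> f (x * sec k)%g = f x) -> Ind f.
Proof.
move=> ht hu hc [m m0 hm]; split; last first.
  eexists; first exact: (open_sec_congruence n_gt0 cop mu_full hilbP m0).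
  by move=> x _ [k hk ->]; apply: hm.
move=> x u z /torusP[a a0 xE] [y uE].
have -> : u = upper y by apply: val_inj; rewrite /= uE upperE.
rewrite (tau_torus n_gt0 mu_full hilbP tau_rep tau_genuine _ a0 xE) xE diagE // mat2_a.
case: x xE => [_ e] /= ->; rewrite (cover_cen n_gt0 mu_full hilbP) -!cA.
by rewrite hc ht // hu scalerA mulrC -scalerA.
Qed.

(** The Bruhat decomposition: B(F) and the big cell cover SL_2(F), and covariance moves each point
    to a representative. *)
Lemma ind_ext f f' : Ind f -> Ind f' -> (forall y, f (sec (wn y)) = f' (sec (wn y))) ->
  f 1%g = f' 1%g -> f = f'.
Proof.
move=> hf hf' hw h1; apply/funext => -[g e].
rewrite (cover_cen n_gt0 mu_full hilbP) !ind_cen //; congr (_ *: _).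
have [c0|c0] := eqVneq (sl_val g ord_max ord0) 0.
  have [a0 ->] := sec_small n_gt0 mu_full hilbP c0.
  rewrite -[(_ * _)%g]c1r -cA (ind_t _ hf a0) (ind_t _ hf' a0) (ind_u _ _ hf).
  by rewrite (ind_u _ _ hf') h1.
have c1 : (sl_val g ord_max ord0)^-1 != 0 by rewrite invr_eq0.
rewrite (sec_big n_gt0 mu_full hilbP c0) (ind_u _ _ hf) (ind_u _ _ hf').
by rewrite (ind_t _ hf c1) (ind_t _ hf' c1) hw.
Qed.

Lemma ind_subspace : subspace Ind.
Proof.
split.
  apply: indI.
  - by move=> a x a0 /=; rewrite (t0 tau_rep) // scaler0.
  - by [].
  - by move=> e x; rewrite /= scaler0.
  - by exists 1%N.
move=> c f f' hf hf'; have fE x : (c *: f + f') x = c *: f x + f' x by [].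
apply: indI.
- move=> a x a0; rewrite !fE !ind_t // (tD tau_rep) // (tZ tau_rep) // scalerDr.
  by rewrite !scalerA (mulrC c).
- by move=> y x; rewrite !fE !ind_u.
- by move=> e x; rewrite !fE !ind_cen // scalerDr !scalerA (mulrC c).
- have [m m0 hm] := ind_small hf; have [m' m'0 hm'] := ind_small hf'.
  exists (m + m')%N; first by rewrite addn_gt0 m0.
  move=> k x hk; rewrite !fE hm ?hm' //; apply: congruence_le hk _; lia.
Qed.

Lemma ind_rt f x : Ind f -> Ind (rt x f).
Proof.
move=> hf; apply: indI; rewrite /right_transl.
- by move=> a z a0; rewrite -cA ind_t.
- by move=> y z; rewrite -cA ind_u.
- by move=> e z; rewrite -cA ind_cen.
have [m m0 hm] := ind_small hf.
have [m' m'0 h'] := commutes_small_all n_gt0 cop mu_full hilbP x m0.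
exists m' => // k z /h'[k' hk' e]; by rewrite -cA e cA hm.
Qed.

Lemma rtM f x z : rt x (rt z f) = rt (x * z)%g f.
Proof. by apply/funext => u; rewrite /right_transl cA. Qed.

Lemma rt_linear x (c : C) f f' : rt x (c *: f + f') = c *: rt x f + rt x f'.
Proof. by []. Qed.

(* The restriction of f to the big cell, which determines f together with f 1. *)
Definition phi f y : V := f (sec (wn y)).

Lemma phi_upper f y z : phi (rt (sec (upper y)) f) z = phi f (z + y).
Proof. by rewrite /phi /right_transl (wn_upper n_gt0 mu_full hilbP). Qed.

Lemma phi_diag f a y : Ind f -> a != 0 ->
  phi (rt (sec (diag a)) f) y = (absC a)^-1 *: t a^-1 (phi f (y / a ^+ 2)).
Proof.
move=> hf a0; rewrite /phi /right_transl (wn_diag n_gt0 cop mu_full hilbP) //.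
by rewrite ind_t ?invr_eq0 // absCV.
Qed.

Lemma lower_congruence m y : vge m%:Z y -> congruence m (lower y).
Proof.
by move=> hy; apply: congruenceI; rewrite lowerE ?mat2E ?subrr //; apply: vge0.
Qed.

Lemma upper_congruence m y : vge m%:Z y -> congruence m (upper y).
Proof.
by move=> hy; apply: congruenceI; rewrite upperE ?mat2E ?subrr //; apply: vge0.
Qed.

Lemma phi_lower f y : Ind f -> y != 0 ->
  phi f y = (s y (-1) * (absC y)^-1) *: t y^-1 (f (sec (lower y^-1))).
Proof.
move=> hf y0; rewrite /phi (wn_lower n_gt0 cop mu_full hilbP y0) ind_cen // -cA.
by rewrite ind_t ?invr_eq0 // ind_u // absCV // scalerA.
Qed.

Definition ind_level m : set (cover -> V) :=
  [set f | Ind f /\ forall k x, congruence m k -> f (x * sec k)%g = f x].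

Lemma ind_level_ex f : Ind f -> exists2 m, (0 < m)%N & ind_level m f.
Proof. by move=> hf; have [m m0 hm] := ind_small hf; exists m. Qed.

Lemma ind_level_le m m' f : (m <= m')%N -> ind_level m f -> ind_level m' f.
Proof. by move=> le [hf hm]; split=> // k x hk; apply: hm; apply: congruence_le hk le. Qed.

Lemma phi_per m f y z : ind_level m f -> vge m%:Z z -> phi f (y + z) = phi f y.
Proof.
move=> [hf hm] hz; rewrite /phi -(wn_upper n_gt0 mu_full hilbP) hm //.
exact: upper_congruence.
Qed.

Lemma phi_infty m f y : ind_level m f -> y != 0 -> v y <= - m%:Z ->
  phi f y = (s y (-1) * (absC y)^-1) *: t y^-1 (f 1%g).
Proof.
move=> [hf hm] y0 hy; rewrite phi_lower // -[sec (lower _)]c1l hm //; apply: lower_congruence.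
by rewrite vge_nz ?invr_eq0 // pvalV //; lia.
Qed.

Lemma phi_lcst f (m : int) : Ind f -> lcst m (phi f).
Proof.
move=> hf; have [l _ hl] := ind_level_ex hf; exists l%:Z => y z _ _ hyz.
by rewrite -(phi_per z hl hyz) addrC subrK.
Qed.

Lemma ind_level_subspace m : subspace (ind_level m).
Proof.
split; first by split=> //; apply: ind_subspace.1.
move=> c f f' [hf hm] [hf' hm']; split; first exact: ind_subspace.2.
by move=> k x hk; have := (hm k x hk, hm' k x hk); rewrite !fctE => -[-> ->].
Qed.

(** f is determined by [f 1], which governs phi outside P^-m, and by the values of phi on the finite
    set P^-m / P^m. *)
Lemma ind_level_dim m : (0 < m)%N -> exists N, dim_le N (ind_level m).
Proof.
move=> m0; have [w w0 w1] := unif_ex F; have [sq hsq] := V_findim n_gt0 cop mu_full iotaP hilbP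
  tau_rep tau_genuine tau_irr tau_smooth tau_adm.
pose T := rs_type (rsys w0 w1 (m + m)).
pose Phi f (j : option T) := if j is Some c then phi f (w ^ (- m%:Z) * rs_rep c) else f 1%g.
apply: (@dim_le_ker _ _ V _ sq (ind_level m) Phi hsq) => //.
- by move=> [j|] c f f' _ _.
- exact: ind_level_subspace.
move=> f hf h; have [If hm] := hf; apply: ind_ext => //; [exact: ind_subspace.1| |exact: (h None)].
have f1 : f 1%g = 0 := h None.
move=> y; rewrite -/(phi f y) [RHS]/(0 : V).
have [hy|/negP hy] := boolP `[< vge (- m%:Z) y >]; last first.
  have [y0 vy] : y != 0 /\ v y <= - m%:Z.
    have y0 : y != 0 by apply/eqP => y0; apply: hy; apply/asboolP; rewrite y0; exact: vge0.
    split=> //; rewrite leNgt; apply/negP => h'; apply: hy; apply/asboolP; rewrite vge_nz //; lia.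
  rewrite (phi_infty hf) // f1 (t0 tau_rep) ?scaler0 // invr_eq0 //.
have [c0 hc0] := rep_unique w0 w1 (m + m)%N (asboolW hy).
have /(hc0 c0) hz := erefl c0.
rewrite -[y](subrK (w ^ (- m%:Z) * rs_rep c0)) addrC (phi_per _ hf); first exact: (h (Some c0)).
by apply: vge_le hz _; lia.
Qed.

Lemma cenM e e' x : (cen e * (cen e' * x))%g = (cen (e * e') * x)%g.
Proof.
rewrite cA; congr (_ * x)%g; apply: cover_ext; rewrite /= ?mul1g //.
by rewrite (kubota1l n_gt0 mu_full hilbP) mul1r.
Qed.

Lemma cen_inj e e' x : (cen e * x)%g = (cen e' * x)%g -> e = e'.
Proof.
move=> /(congr1 (@fiber p F n hilb)) /(congr1 (@mu_val p F n)) /=.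
rewrite !(kubota1l n_gt0 mu_full hilbP) !mul1r => /mulIf h.
by apply: val_inj; apply: h; have /andP[] := mu_valP (fiber x).
Qed.

Lemma cen1 x : (cen 1 * x)%g = x. Proof. exact: c1l. Qed.

Lemma cen_left e x z : (x * (cen e * z))%g = (cen e * (x * z))%g.
Proof. by rewrite cA -(cen_comm n_gt0 mu_full hilbP) -cA. Qed.

Local Notation bel e a y x := (cen e * (sec (diag a) * (sec (upper y) * x)))%g.

Lemma sec_upperM y z : (sec (upper y) * sec (upper z))%g = sec (upper (y + z)).
Proof. by rewrite (sec_upperl n_gt0 mu_full hilbP) upperD. Qed.

Lemma belM e a y b z x : a != 0 -> b != 0 ->
  bel e a y (sec (diag b) * (sec (upper z) * x))%g =
  bel (e * hilb b a)%g (a * b) (y / b ^+ 2 + z) x.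
Proof.
move=> a0 b0; rewrite [(sec (upper y) * _)%g]cA (upper_diag n_gt0 mu_full hilbP y b0).
rewrite -[(_ * (sec (upper z) * x))%g]cA [(_ * (sec (upper z) * x))%g]cA sec_upperM.
by rewrite [(sec (diag a) * _)%g]cA (sec_diagM n_gt0 mu_full hilbP a0 b0) -[(_ * _ * (sec (upper
  _) * x))%g]cA cenM.
Qed.

(** * Sections supported near the Borel subgroup *)

Section TestFunction.
Variable l : nat.
Hypothesis l_gt0 : (0 < l)%N.
Hypothesis t_level : forall a u, vge l%:Z (a - 1) -> t a u = u.

Definition ftest_rel u x u' := exists e a y k, [/\ a != 0, congruence l k,
  x = bel e a y (sec k) & u' = (iota e * absC a) *: t a u].

(** Two decompositions of x differ by an element of B(F) in the congruence subgroup of level l. Its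
    diagonal part lies in 1 + P^l, where t, the absolute value and the symbol are all trivial. *)
Lemma ftest_rel_uniq u x u1 u2 : ftest_rel u x u1 -> ftest_rel u x u2 -> u1 = u2.
Proof.
move=> [e [a [y [k [a0 hk -> ->]]]]] [e' [a' [y' [k' [a'0 hk' E ->]]]]].
have hg := congruenceM hk (congruenceV hk').
move: (k * k'^-1)%g hg (mulgKV k' k) => g hg kE.
have /(congr1 (@base p F n hilb)) /= := E.
rewrite !mul1g -kE !mulgA => /mulIg E'.
have ent i j : sl_val (diag a * upper y * g)%g i j = sl_val (diag a' * upper y')%g i j.
  by rewrite E'.
have := (ent ord0 ord0, ent ord0 ord_max, ent ord_max ord0, ent ord_max ord_max).
rewrite !sl_mulE (diagE a0) (diagE a'0) !upperE !mat2E !(mulr0, mul0r, addr0, add0r, mulr1).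
have [ga1 _ _ _] := congruenceP hg; case=> [[[ea eb] ec] ed].
have gc : sl_val g ord_max ord0 = 0 by apply: (mulfI (x := a^-1)); rewrite ?invr_eq0 // mulr0.
rewrite gc mulr0 addr0 in ea.
have [b0 gE] := sec_small n_gt0 mu_full hilbP gc.
move: ga1 b0 gE ea; set b := sl_val g ord0 ord0 => ga1 b0 gE ea.
move: E; rewrite -kE -(sec_congruenceM n_gt0 cop mu_full hilbP l_gt0 hg hk') gE -(cA (sec (diag
  b))).
have -> : a' = a * b by [].
rewrite (belM _ _ _ _ a0 b0).
have -> : y / b ^+ 2 + sl_val g ord0 ord_max / b = y'.
  have gd : sl_val g ord_max ord_max = b^-1.
    by apply: (mulfI (x := a^-1)); rewrite ?invr_eq0 // ed -ea invfM.
  rewrite gd -ea in eb.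
  apply: (mulfI (mulf_neq0 a0 b0)); rewrite -eb; field; rewrite ?a0 ?b0 //.
move=> /cen_inj <-; have b1 : vge 1 (b - 1) by apply: vge_le ga1 _; lia.
rewrite (iotaM iotaP) -[iota (hilb b a)]/(s b a).
rewrite (hs_one_unit_l n_gt0 cop mu_full iotaP hilbP a0 b1) mulr1.
rewrite absCM // (absC_unit (one_unit b1)) mulr1; congr (_ *: _).
have := tM n_gt0 mu_full hilbP tau_rep tau_genuine u a0 b0.
by rewrite (t_level u ga1) (hs_one_unit_l n_gt0 cop mu_full iotaP hilbP a0 b1) scale1r.
Qed.

(* The section supported on the preimage of B(F) times the congruence subgroup of level l,
   with value u at 1; xget gives 0 off the support. *)
Definition ftest u : cover -> V := fun x => xget 0 [set u' | ftest_rel u x u'].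

Lemma ftestE u x u' : ftest_rel u x u' -> ftest u x = u'.
Proof.
move=> h; apply: (@ftest_rel_uniq u x) => //.
exact: (@xgetPex _ 0 [set u' | ftest_rel u x u'] (ex_intro _ u' h)).
Qed.

Lemma ftest_eq0 u x : ~ (exists u', ftest_rel u x u') -> ftest u x = 0.
Proof. by move=> h; apply: (@xgetPN _ 0 [set u' | ftest_rel u x u']) => u' hu; apply: h; exists
  u'. Qed.

(** Covariance has to hold off the support as well: T' brings T x back to x, so T x is off the
    support whenever x is. *)
Lemma ftest_move (T T' : cover -> cover) (D D' : V -> V) u :
  (forall x u', ftest_rel u x u' -> ftest_rel u (T x) (D u')) ->
  (forall x u', ftest_rel u x u' -> ftest_rel u (T' x) (D' u')) ->
  cancel T T' -> D 0 = 0 -> forall x, ftest u (T x) = D (ftest u x).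
Proof.
move=> hT hT' TK D0 x; have [[u' hu]|nh] := EM (exists u', ftest_rel u x u').
  by rewrite (ftestE hu) (ftestE (hT _ _ hu)).
rewrite (ftest_eq0 nh) D0 ftest_eq0 // => -[u' /hT']; rewrite TK => hu.
by apply: nh; eexists; exact: hu.
Qed.

Lemma ftest_rel_cen u e x u' : ftest_rel u x u' -> ftest_rel u (cen e * x)%g (iota e *: u').
Proof.
move=> [e' [a [y [k [a0 hk -> ->]]]]]; exists (e * e')%g, a, y, k; split=> //.
  by rewrite cenM.
by rewrite scalerA (iotaM iotaP) mulrA.
Qed.

Lemma ftest_rel_diag u b x u' : b != 0 -> ftest_rel u x u' ->
  ftest_rel u (sec (diag b) * x)%g (absC b *: t b u').
Proof.
move=> b0 [e [a [y [k [a0 hk -> ->]]]]].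
exists (e * hilb a b)%g, (b * a), y, k; split=> //; first by rewrite mulf_neq0.
  rewrite cen_left [(sec (diag b) * _)%g]cA (sec_diagM n_gt0 mu_full hilbP b0 a0).
  by rewrite -[(_ * _ * (sec (upper _) * _))%g]cA cenM.
rewrite (tZ tau_rep _ _ b0) (tM n_gt0 mu_full hilbP tau_rep tau_genuine _ b0 a0) !scalerA absCM //.
by rewrite (iotaM iotaP) -[iota (hilb a b)]/(s a b); congr (_ *: _); ring.
Qed.

Lemma ftest_rel_upper u z x u' : ftest_rel u x u' -> ftest_rel u (sec (upper z) * x)%g u'.
Proof.
move=> [e [a [y [k [a0 hk -> ->]]]]]; exists e, a, (z / a ^+ 2 + y), k; split=> //.
rewrite cen_left [(sec (upper z) * _)%g]cA (upper_diag n_gt0 mu_full hilbP z a0).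
by rewrite -[(_ * _ * (sec (upper _) * _))%g]cA [(_ * (sec (upper y) * _))%g]cA sec_upperM.
Qed.

Lemma ftest_rel_congruence u k x u' : congruence l k -> ftest_rel u x u' ->
  ftest_rel u (x * sec k)%g u'.
Proof.
move=> hk [e [a [y [k' [a0 hk' -> ->]]]]]; exists e, a, y, (k' * k)%g; split=> //.
  exact: congruenceM.
by rewrite -(sec_congruenceM n_gt0 cop mu_full hilbP l_gt0 hk' hk) !cA.
Qed.

Lemma ftest_inv u k x : congruence l k -> ftest u (x * sec k)%g = ftest u x.
Proof.
move=> hk; apply: (@ftest_move (fun x => x * sec k)%g (fun x => x * sec k^-1)%g id id) => //.
- by move=> z u'; apply: ftest_rel_congruence.
- by move=> z u'; apply: ftest_rel_congruence; apply: congruenceV.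
- move=> z; rewrite -cA (sec_congruenceM n_gt0 cop mu_full hilbP l_gt0 hk (congruenceV hk)).
  by rewrite mulgV [sec 1%g]sec1 c1r.
Qed.

Lemma ftest_ind u : Ind (ftest u).
Proof.
apply: indI.
- move=> a x a0; have ai : a^-1 != 0 by rewrite invr_eq0.
  have H := @ftest_move
    (fun x => (sec (diag a) * x)%g) (fun x => (cen (hilb a a^-1)^-1 * (sec (diag a^-1) * x))%g)
    (fun u => absC a *: t a u) (fun u => iota (hilb a a^-1)^-1%g *: (absC a^-1 *: t a^-1 u)) u.
  apply: H.
  + by move=> z u'; apply: ftest_rel_diag.
  + by move=> z u' hu; apply: ftest_rel_cen; apply: ftest_rel_diag.
  + move=> z; rewrite [(sec (diag a^-1) * _)%g]cA (sec_diagM n_gt0 mu_full hilbP ai a0).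
    by rewrite mulVf // diag1 [sec 1%g]sec1 c1r cenM mulVg cen1.
  + by rewrite (t0 tau_rep a0) scaler0.
- move=> y x; apply: (@ftest_move (fun x => sec (upper y) * x)%g
    (fun x => sec (upper (- y)) * x)%g id id) => // [z u'|z u'|z].
  + exact: ftest_rel_upper.
  + exact: ftest_rel_upper.
  + by rewrite cA sec_upperM addNr upper0 [sec 1%g]sec1 c1l.
- move=> e x; apply: (@ftest_move (fun x => cen e * x)%g (fun x => cen e^-1 * x)%g
    (fun u => iota e *: u) (fun u => iota e^-1%g *: u)) => // [z u'|z u'|z|].
  + exact: ftest_rel_cen.
  + exact: ftest_rel_cen.
  + by rewrite cenM mulVg cen1.
  + exact: scaler0.
- by exists l => // k x; apply: ftest_inv.
Qed.

Lemma ftest_lower u y : vge l%:Z y -> ftest u (sec (lower y)) = u.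
Proof.
move=> hy; apply: ftestE; exists 1%g, 1, 0, (lower y); split.
- exact: oner_neq0.
- exact: lower_congruence.
- by rewrite cen1 upper0 diag1 [sec 1%g]sec1 !c1l.
- by rewrite (t1 tau_rep) absC_unit ?mulr1 ?(iota1 n_gt0 iotaP) ?scale1r //; apply: fin_unit1.
Qed.

Lemma ftest1 u : ftest u 1%g = u.
Proof.
rewrite -[RHS](@ftest_lower u 0); last exact: vge0.
by rewrite lower0 sec1.
Qed.

(** The ratio of the lower entries is invariant under B(F) on the left; it shows that [weylV] and
    lower unipotent elements away from 1 are off the support. *)
Lemma ftest_support u x u' : ftest_rel u x u' -> sl_val (base x) ord_max ord_max != 0 /\
  vge l%:Z (sl_val (base x) ord_max ord0 / sl_val (base x) ord_max ord_max).
Proof.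
move=> [e [a [y [k [a0 hk -> _]]]]].
have -> : base (bel e a y (sec k)) = (diag a * (upper y * k))%g by rewrite /= mul1g.
rewrite !sl_mulE (diagE a0) !upperE !mat2E.
rewrite !(mulr0, mul0r, addr0, add0r, mul1r); have [_ _ kc kd] := congruenceP hk.
have kd1 : vge 1 (sl_val k ord_max ord_max - 1) by apply: vge_le kd _; lia.
have kU := one_unit kd1; have [d0 vd] := kU.
split; first by rewrite mulf_neq0 ?invr_eq0.
have -> : a^-1 * sl_val k ord_max ord0 / (a^-1 * sl_val k ord_max ord_max) =
  sl_val k ord_max ord0 * (sl_val k ord_max ord_max)^-1 by field; rewrite ?a0 ?d0.
by apply: (vgeM kc (fin_unit_vge (fin_unitV kU))); lia.
Qed.

(* phi (fbig u) is u on P^l and 0 elsewhere, while fbig u vanishes at 1. *)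
Definition fbig u := rt (sec weylV) (ftest u).

Lemma fbig_ind u : Ind (fbig u). Proof. exact/ind_rt/ftest_ind. Qed.

Lemma fbig1 u : fbig u 1%g = 0.
Proof.
rewrite /fbig /right_transl c1l; apply: ftest_eq0 => -[u' /ftest_support[/=]].
by rewrite weylVE mat2E eqxx.
Qed.

Lemma phi_fbig u y : phi (fbig u) y = if `[< vge l%:Z y >] then u else 0.
Proof.
rewrite /phi /fbig /right_transl (wn_weylV n_gt0 cop mu_full hilbP).
case: asboolP => hy; first by rewrite ftest_lower //; apply: vgeN.
apply: ftest_eq0 => -[u' /ftest_support[_ /=]]; rewrite lowerE !mat2E divr1 => /vgeN.
by rewrite opprK.
Qed.

End TestFunction.


Section Uniformizer.
Variable w : F.
Hypotheses (w0 : w != 0) (w1 : v w = 1).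
Local Notation bI := (bint w0 w1).
Local Notation aI := (aint w0 w1).
Implicit Types (m j : int).

Lemma bintZ (E : lmodType C) m (c : C) (f : F -> E) : lcst m f ->
  bI m (fun y => c *: f y) = c *: bI m f.
Proof.
move=> hf; have Zlin : linear (fun e : E => c *: e) by move=> b e e'; rewrite scalerDr !scalerA
  mulrC.
exact: esym (bint_linear w0 w1 Zlin hf).
Qed.

Lemma lcstZ (E : lmodType C) m (c : C) (f : F -> E) : lcst m f -> lcst m (fun y => c *: f y).
Proof. by move=> [l hl]; exists l => x y hx hy hxy; rewrite (hl x y). Qed.

Lemma bint_shells (E : lmodType C) m N (f : F -> E) : lcst m f ->
  bI m f = \sum_(i < N) aI (m + i%:Z) f + bI (m + N%:Z) f.
Proof.
move=> hf; elim: N => [|N IHN]; first by rewrite big_ord0 add0r addr0.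
rewrite IHN big_ord_recr -addrA; congr (_ + _).
rewrite (bint_split w0 w1); first by congr (_ + bI _ f); rewrite -addn1 PoszD addrA.
by apply: lcst_sub hf _; rewrite lerDl.
Qed.

Lemma aint_cst (E : lmodType C) m (e : E) :
  aI m (fun=> e) = (Q ^ (- m) - Q ^ (- (m + 1))) *: e.
Proof.
have := bint_split w0 w1 (lcst_cst F m e); rewrite !(bint_cst w0 w1) scalerBl => ->.
by rewrite addrK.
Qed.

Lemma aint0 (E : lmodType C) m (f : F -> E) :
  (forall y, y != 0 -> v y = m -> f y = 0) -> aI m f = 0.
Proof.
move=> hf; rewrite (@aint_eq _ _ _ w0 w1 _ _ _ _ (fun=> 0)) ?aint_cst ?scaler0 //.
by exists 0 => x y x0 vx y0 vy _; rewrite !hf.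
Qed.

Lemma bint_ball (E : lmodType C) m j (e : E) : m <= j ->
  bI m (fun y => if `[< vge j y >] then e else 0) = Q ^ (- j) *: e.
Proof.
move=> mj; have lc i0 : lcst i0 (fun y => if `[< vge j y >] then e else 0).
  exists j => x y _ _ hxy; congr (if _ then _ else _); apply/asbool_equiv_eq.
  split=> h; last by rewrite -[x](subrK y); apply: vgeD.
  by rewrite -[y](subrK x); apply: vgeD => //; rewrite -opprB; apply: vgeN.
have [N NE] : exists N : nat, j = m + N%:Z by exists `|j - m|%N; lia.
rewrite (bint_shells N (lc m)) big1 => [|i _].
  rewrite add0r -NE -(bint_cst w0 w1 j e); apply: (bint_eq w0 w1) => // y hy.
  by rewrite asboolT.
apply: aint0 => y y0 vy; rewrite asboolF //; rewrite vge_nz // vy.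
have := ltn_ord i; lia.
Qed.

Lemma bint_phi_linear m (c : C) f f' : Ind f -> Ind f' ->
  bI m (phi (c *: f + f')) = c *: bI m (phi f) + bI m (phi f').
Proof.
move=> hf hf'; rewrite -(bintZ _ (phi_lcst m hf)).
by rewrite -(bintD w0 w1 (lcstZ c (phi_lcst m hf)) (phi_lcst m hf')).
Qed.

Lemma bint_phi_upper m f y : Ind f -> vge m y ->
  bI m (phi (rt (sec (upper y)) f)) = bI m (phi f).
Proof.
move=> hf hy; rewrite -(bint_trans w0 w1 hy (phi_lcst m hf)).
by congr (bI m _); apply/funext => z; rewrite phi_upper.
Qed.

(** Substituting a^2 y for y contributes |a|^2 and moves the ball by 2 v(a); [phi_diag] contributes
    |a|^-1. *)
Lemma bint_phi_diag m f a : Ind f -> a != 0 ->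
  bI m (phi (rt (sec (diag a)) f)) = absC a *: t a^-1 (bI (m - (v a + v a)) (phi f)).
Proof.
move=> hf a0; have ai : a^-1 != 0 by rewrite invr_eq0.
have a2 : a ^- 2 != 0 by rewrite invr_eq0 expf_neq0.
have va : v (a ^- 2) = - (v a + v a) by rewrite pvalV ?expf_neq0 // expr2 pvalM.
pose L u := (absC a)^-1 *: t a^-1 u.
have Llin : linear L.
  by move=> c u u'; rewrite /L (t_linear tau_rep ai) scalerDr !scalerA mulrC.
transitivity (bI m (fun y => L (phi f (a ^- 2 * y)))).
  by congr (bI m _); apply/funext => y; rewrite phi_diag // mulrC.
have lc := phi_lcst (m + v (a ^- 2)) hf.
rewrite -(bint_linear w0 w1 Llin (lcst_scale w0 w1 a2 lc)) (bint_scale w0 w1 a2 lc) va /L.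
rewrite (tZ tau_rep) // scalerA; congr (_ *: _).
apply: (mulfI (absC_neq0 a0)); rewrite mulrA mulfV ?absC_neq0 // mul1r absCE //.
by rewrite -expfzDr ?Qn0 // opprD.
Qed.


(* phi f agrees with psi (f 1) near infinity. *)
Definition psi u y := (s y (-1) * (absC y)^-1) *: t y^-1 u.

Lemma phi_psi (m : nat) f y : ind_level m f -> y != 0 -> v y <= - m%:Z -> phi f y = psi (f 1%g) y.
Proof. exact: phi_infty. Qed.

(** [psi] at y^-1 without its absolute value: the shell integrals of [psi] become integrals of
    [hecke] over the units. *)
Definition hecke u y := s y (-1) *: t y u.

Lemma psiE u y : y != 0 -> psi u y = (absC y)^-1 *: hecke u y^-1.
Proof.
move=> y0; rewrite /psi /hecke scalerA mulrC; congr (_ * _ *: _).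
rewrite (hsVl n_gt0 mu_full iotaP hilbP y0 (N1_neq0 F)).
apply: (mulfI (hs_neq0 n_gt0 iotaP hilb y (-1))).
by rewrite (hsN1_sq n_gt0 mu_full iotaP hilbP y0) mulfV // hs_neq0.
Qed.

Lemma hecke_close u : exists2 m, (0 < m)%N &
  forall y b, y != 0 -> vge m%:Z (b - 1) -> hecke u (y * b) = hecke u y.
Proof.
have [m m0 hm] := t_small n_gt0 cop mu_full iotaP hilbP tau_rep tau_genuine tau_irr tau_smooth.
exists m => // y b y0 hb; have hb1 : vge 1 (b - 1) by apply: vge_le hb _; lia.
have [b0 _] := one_unit hb1.
rewrite /hecke (hsMl n_gt0 mu_full iotaP hilbP y0 b0 (N1_neq0 F)).
rewrite (hs_one_unit_l n_gt0 cop mu_full iotaP hilbP (N1_neq0 F) hb1) mulr1; congr (_ *: _).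
have := tM n_gt0 mu_full hilbP tau_rep tau_genuine u y0 b0.
by rewrite (hm _ u hb) (hs_one_unit_l n_gt0 cop mu_full iotaP hilbP y0 hb1) scale1r => <-.
Qed.

Lemma lcst_shell_close (E : lmodType C) (f : F -> E) (m : nat) :
  (forall y b, y != 0 -> vge m%:Z (b - 1) -> f (y * b) = f y) -> forall j, lcst_shell j f.
Proof.
move=> h j; exists (j + m%:Z) => x y x0 vx y0 vy hxy.
have b1 : vge m%:Z (x / y - 1).
  have -> : x / y - 1 = (x - y) * y^-1 by field.
  by apply: (vgeM hxy (vge_v _)); rewrite pvalV // vy; lia.
by rewrite -(h y _ y0 b1) mulrC divfK.
Qed.

Lemma psi_close u : exists2 m, (0 < m)%N &
  forall y b, y != 0 -> vge m%:Z (b - 1) -> psi u (y * b) = psi u y.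
Proof.
have [m m0 hm] := hecke_close u; exists m => // y b y0 hb.
have bU : fin_unit b by apply: one_unit; apply: vge_le hb _; lia.
have [b0 vb] := bU; have yi : y^-1 != 0 by rewrite invr_eq0.
rewrite !psiE ?mulf_neq0 // absCM // (absC_unit bU) mulr1 invfM hm //.
have -> : b^-1 - 1 = - (b - 1) * b^-1 by field.
by apply: (vgeM (vgeN hb) (fin_unit_vge (fin_unitV bU))); lia.
Qed.

Lemma psi_lcst u (j : int) : lcst_shell j (psi u).
Proof. by have [m _ hm] := psi_close u; apply: (lcst_shell_close hm). Qed.

Lemma lcst_shellZ (E : lmodType C) m (c : C) (f : F -> E) : lcst_shell m f ->
  lcst_shell m (fun y => c *: f y).
Proof. by move=> [l hl]; exists l => x y x0 vx y0 vy hxy; rewrite (hl x y). Qed.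

Lemma aintZ (E : lmodType C) m (c : C) (f : F -> E) : lcst_shell m f ->
  aI m (fun y => c *: f y) = c *: aI m f.
Proof.
move=> hf; rewrite /aint -(bintZ _ (lcst_shellP w0 w1 hf)); congr (bI m _).
by apply/funext => y; case: ifP => //; rewrite scaler0.
Qed.

(** Substituting c^n y for y, the factor |c^n|^-1 of [psi] cancels the Jacobian and (c^n y, -1) =
    (y, -1); only the scalar of t(c^-n) is left. *)
Lemma aint_psi_shift u (j : int) c (z : C) : c != 0 -> (forall u, t (c^-1 ^+ n) u = z *: u) ->
  aI (j + v c * n%:Z) (psi u) = z *: aI j (psi u).
Proof.
move=> c0 tc; have cn := expf_neq0 n c0; have ci : c^-1 != 0 by rewrite invr_eq0.
have vcn : v (c ^+ n) = v c * n%:Z by rewrite pvalX.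
have := aint_scale w0 w1 (m := j) cn (psi_lcst u _); rewrite vcn => e.
apply: (scalerI (expfz_neq0 (v c * n%:Z) Qn0)); rewrite -{}e.
rewrite scalerA -(aintZ _ (psi_lcst u j)).
apply/esym/(aint_eq w0 w1); first exact/lcst_shellZ/psi_lcst.
move=> y y0 vy; rewrite /psi (hsMl n_gt0 mu_full iotaP hilbP cn y0 (N1_neq0 F)).
rewrite (hs_npow_l n_gt0 mu_full iotaP hilbP c0 (N1_neq0 F)) mul1r absCM // !invfM.
have yi : y^-1 != 0 by rewrite invr_eq0.
rewrite -exprVn (mulrC (_ ^+ n) y^-1).
rewrite (t_npow_mul n_gt0 mu_full iotaP hilbP tau_rep tau_genuine _ yi ci).
rewrite tc (tZ tau_rep _ _ yi) !scalerA; congr (_ *: _).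
have -> : Q ^ (v c * n) = (absC (c ^+ n))^-1 by rewrite -absCV // absCE ?invr_eq0 // pvalV //
  opprK vcn.
ring.
Qed.

Lemma t_npow_inv c (z : C) : c != 0 -> z ^+ 2 = 1 -> (forall u, t (c ^+ n) u = z *: u) ->
  forall u, t (c^-1 ^+ n) u = z *: u.
Proof.
move=> c0 z2 tc u; have cn := expf_neq0 n c0; have ci : c^-1 != 0 by rewrite invr_eq0.
have z0 : z != 0 by apply/eqP => z0; move/eqP: z2; rewrite z0 expr0n eq_sym oner_eq0.
apply: (scalerI z0); rewrite scalerA -expr2 z2 scale1r -tc exprVn.
by rewrite (tV n_gt0 cop mu_full iotaP hilbP tau_rep tau_genuine) // (hs_npow_l n_gt0 mu_full
  iotaP hilbP c0 (N1_neq0 F)) scale1r.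
Qed.

Definition window (E : zmodType) N (f : int -> E) (j : int) : E := \sum_(i < N) f (j + i%:Z).

Lemma window_shift (E : zmodType) N (f : int -> E) : (forall j, f (j + N%:Z) = f j) ->
  forall j k : int, window N f j = window N f k.
Proof.
move=> fN; have W (j : int) (d : nat) : window N f (j + d%:Z) = window N f j.
  rewrite /window -(@sum_shift N E (fun i => f (j + i%:Z)) d).
    by apply: eq_bigr => i _; congr f; lia.
  by move=> i; rewrite -[RHS]fN; congr f; lia.
move=> j k; have [h|h] := lerP j k.
  by rewrite -(W j `|k - j|%N); congr window; lia.
by rewrite -(W k `|j - k|%N); congr window; lia.
Qed.

Lemma window_recl (E : zmodType) N (f : int -> E) j :
  f j + window N f (j + 1) = window N f j + f (j + N%:Z).
Proof.
transitivity (\sum_(i < N.+1) f (j + i%:Z)); last by rewrite big_ord_recr.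
rewrite big_ord_recl addr0; congr (_ + _).
by apply: eq_bigr => i _; congr f; rewrite lift0; lia.
Qed.

(** * The intertwining operator *)

Section QuadraticCharacter.
Hypothesis t_sq : forall (c : F), c != 0 ->
  exists2 z : C, z ^+ 2 = 1 & forall u, t (c ^+ n) u = z *: u.
Variable c1 : F.
Hypotheses (c10 : c1 != 0) (tc1 : forall u, t (c1 ^+ n) u = - u).
Local Notation N := (n + n)%N.

(** By [aint_psi_shift] for w, whose scalar has square 1, the shell integrals have period 2n, so a
    window of length 2n does not depend on its position. By the same lemma for [c1], moving it by n
    v(c1) changes its sign. *)
Lemma window_psi0 u j : window N (fun j => aI j (psi u)) j = 0.
Proof.
set W := window _ _; have per i : aI (i + N%:Z) (psi u) = aI i (psi u).
  have [z z2 tz] := t_sq w0; have tzi := t_npow_inv w0 z2 tz.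
  have sh i' : aI (i' + n%:Z) (psi u) = z *: aI i' (psi u).
    by rewrite -(aint_psi_shift u i' w0 tzi) w1 mul1r.
  by rewrite PoszD addrA !sh scalerA -expr2 z2 scale1r.
have tci : forall u, t (c1^-1 ^+ n) u = (-1) *: u.
  by apply: t_npow_inv; rewrite ?sqrrN ?expr1n // => u'; rewrite tc1 scaleN1r.
have : W (j + v c1 * n%:Z) = - W j.
  rewrite /W /window -sumrN; apply: eq_bigr => i _.
  by rewrite -scaleN1r -(aint_psi_shift u _ c10 tci); congr (aI _ _); ring.
rewrite /W (window_shift per _ j) => /eqP; rewrite -addr_eq0 -mulr2n -scaler_nat scaler_eq0.
by rewrite pnatr_eq0 => /eqP.
Qed.

(** The last of the 2n shells between the two balls has valuation j - 1, so the bound on j is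
    exactly what lets phi be replaced by [psi] on all of them. *)
Lemma bint_phi_periodic (m : nat) f j : ind_level m f -> j <= - m%:Z + 1 ->
  bI (j - N%:Z) (phi f) = bI j (phi f).
Proof.
move=> hf hj; have lc := phi_lcst (j - N%:Z) hf.1.
rewrite (bint_shells N lc) subrK -[RHS]add0r; congr (_ + _).
apply: etrans (window_psi0 (f 1%g) (j - N%:Z)).
apply: eq_bigr => i _.
apply: (aint_eq w0 w1).
  apply: lcst_lcst_shell; exact: phi_lcst hf.1.
by move=> y y0 vy; apply: phi_psi hf y0 _; rewrite vy; have := ltn_ord i; lia.
Qed.

(* The integral of phi f over P^j does not converge as j goes to minus infinity, but it is
   eventually 2n-periodic in j, because the shell integrals of psi change sign under a shift;
   ell0 is 2n times the regularized value. *)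
Definition tsum f := window N (fun j => bI j (phi f)).

Definition ell0 f : V := xget 0 [set u | exists m : nat, forall j, j <= - m%:Z -> tsum f j = u].

Lemma ell0E f u (m : nat) : (forall j, j <= - m%:Z -> tsum f j = u) -> ell0 f = u.
Proof.
move=> h; have [m' hm'] : exists m : nat, forall j, j <= - m%:Z -> tsum f j = ell0 f.
  by apply: (@xgetPex _ 0 [set u | exists m : nat, forall j, j <= - m%:Z -> tsum f j = u]);
    exists u, m.
by rewrite -(hm' (- (m%:Z + m'%:Z))) ?h //; lia.
Qed.

(** Moving the window by one exchanges two ball integrals that are a full period apart. *)
Lemma ell0P f : Ind f -> exists m : nat, forall j, j <= - m%:Z -> tsum f j = ell0 f.
Proof.
move=> hf; have [m m0 hm] := ind_level_ex hf; exists (m + N)%N.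
have st (d : nat) : tsum f (- (m + N)%N%:Z - d%:Z) = tsum f (- (m + N)%N%:Z).
  elim: d => [|d <-]; first by rewrite subr0.
  have := window_recl N (fun j => bI j (phi f)) (- (m + N)%N%:Z - d.+1%:Z).
  rewrite -(bint_phi_periodic hm (j := _ + N%:Z)); last lia.
  rewrite addrK addrC => /addIr; rewrite /tsum => <-; congr window; lia.
have {}st j : j <= - (m + N)%N%:Z -> tsum f j = tsum f (- (m + N)%N%:Z).
  by move=> hj; rewrite -(st (absz (j + (m + N)%N%:Z)%R)); congr (tsum f _); lia.
by move=> j hj; rewrite (ell0E st) st.
Qed.

Lemma ell0_linear (c : C) f f' : Ind f -> Ind f' -> ell0 (c *: f + f') = c *: ell0 f + ell0 f'.
Proof.
move=> hf hf'; have [m hm] := ell0P hf; have [m' hm'] := ell0P hf'.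
apply: (@ell0E _ _ (m + m')%N) => j hj.
rewrite -(hm j); last lia.
rewrite -(hm' j); last lia.
rewrite /tsum /window scaler_sumr -big_split; apply: eq_bigr => i _ /=.
exact: bint_phi_linear.
Qed.

Lemma ell0_upper f y : Ind f -> ell0 (rt (sec (upper y)) f) = ell0 f.
Proof.
move=> hf; have [m hm] := ell0P hf.
apply: (@ell0E _ _ (m + N + `|v y|)%N) => j hj; rewrite -(hm j); last lia.
apply: eq_bigr => i _; apply: bint_phi_upper => //.
by apply: vge_le (vge_v y) _; have := ltn_ord i; lia.
Qed.

(** The displacement of the ball by 2 v(a) in [bint_phi_diag] is absorbed, since far out the window
    sum does not depend on its position. *)
Lemma ell0_diag f a : Ind f -> a != 0 ->
  ell0 (rt (sec (diag a)) f) = absC a *: t a^-1 (ell0 f).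
Proof.
move=> hf a0; have [m hm] := ell0P hf; have ai : a^-1 != 0 by rewrite invr_eq0.
apply: (@ell0E _ _ (m + `|v a| + `|v a|)%N) => j hj.
rewrite -(hm (j - (v a + v a))); last lia.
have Llin : linear (fun u => absC a *: t a^-1 u).
  by move=> c u u'; rewrite (t_linear tau_rep ai) scalerDr !scalerA mulrC.
pose L : {linear V -> V} := HB.pack (fun u => absC a *: t a^-1 u) (GRing.isLinear.Build _ _ _ _ _
  Llin).
have -> : absC a *: t a^-1 (tsum f (j - (v a + v a))) = L (tsum f (j - (v a + v a))) by [].
rewrite /tsum /window linear_sum; apply: eq_bigr => i _ /=.
by rewrite (bint_phi_diag _ hf a0) addrAC.
Qed.

(** Far out, each of the 2n integrals is the volume q^-l of P^l times u. *)
Lemma ell0_fbig (l : nat) u : (0 < l)%N -> (forall a u, vge l%:Z (a - 1) -> t a u = u) ->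
  ell0 (fbig l u) = (Q ^ (- l%:Z) *+ N) *: u.
Proof.
move=> l0 tl; apply: (@ell0E _ _ N) => j hj.
transitivity (\sum_(i < N) Q ^ (- l%:Z) *: u); last by rewrite sumr_const card_ord scalerMnl.
apply: eq_bigr => i _.
rewrite -(bint_ball (m := j + i%:Z)); last by have := ltn_ord i; lia.
by congr (bI _ _); apply/funext => y; rewrite phi_fbig.
Qed.

Lemma ind0 : Ind (0 : cover -> V). Proof. exact: ind_subspace.1. Qed.

(** L turns the t(a^-1) of [ell0_diag] into t(a), so that x -> L (ell0 (rt x f)) is again a section
    of the induced representation. *)
Lemma reducible_of_intertwiner (L : V -> V) : linear L -> (exists u, L u != 0) ->
  (forall a u, a != 0 -> L (t a^-1 u) = t a (L u)) -> reducible G rt Ind.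
Proof.
move=> Llin [u0 Lu0] Lt; have [l l0 tl] := t_small n_gt0 cop mu_full iotaP hilbP tau_rep
  tau_genuine tau_irr tau_smooth.
have L0 : L 0 = 0.
  by have /eqP := Llin 1 0 0; rewrite !scale1r addr0 -subr_eq0 opprD addNKr oppr_eq0 => /eqP.
have LZ (c : C) u : L (c *: u) = c *: L u by have := Llin c u 0; rewrite !addr0 L0 addr0.
pose M f : cover -> V := fun x => L (ell0 (rt x f)).
have ell00 : ell0 (0 : cover -> V) = 0.
  have := ell0_linear 1 ind0 ind0; rewrite !scale1r addr0 => /eqP.
  by rewrite -subr_eq0 opprD addNKr oppr_eq0 => /eqP.
have Mlin (c : C) f f' : Ind f -> Ind f' -> M (c *: f + f') = c *: M f + M f'.
  move=> hf hf'; apply/funext => x; rewrite /M rt_linear.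
  by rewrite (ell0_linear c (ind_rt x hf) (ind_rt x hf')) Llin.
have Mlev (m : nat) f : (0 < m)%N -> ind_level m f -> ind_level m (M f).
  move=> m0 [hf hm].
  have hk k x : congruence m k -> M f (x * sec k)%g = M f x.
    move=> hk; rewrite /M -rtM; congr (L (ell0 (rt x _))).
    by apply/funext => z; exact: hm.
  split=> //; apply: indI; last by exists m.
  - move=> a x a0; rewrite /M -rtM (ell0_diag (ind_rt x hf) a0).
    by rewrite LZ Lt.
  - by move=> y x; rewrite /M -rtM (ell0_upper _ (ind_rt x hf)).
  - move=> e x; rewrite /M; have -> : rt (cen e * x)%g f = iota e *: rt x f.
      apply/funext => z; rewrite /right_transl cen_left (ind_cen _ _ hf).
      by [].
    have := ell0_linear (iota e) (ind_rt x hf) ind0; rewrite !addr0 ell00 addr0 => ->.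
    exact: LZ.
have MI f : Ind f -> Ind (M f).
  by move=> hf; have [m m0 hm] := ind_level_ex hf; have [] := Mlev m f m0 hm.
have Mrt z f : M (rt z f) = rt z (M f) by apply/funext => x; rewrite /M rtM.
have [N hN] := ind_level_dim l0.
have [[u1 u1n0] _] := tau_irr.
have lev1 : ind_level l (ftest l u1) by split; [exact: ftest_ind|move=> k x; exact: ftest_inv].
have f1n0 : ftest l u1 != 0.
  by apply/eqP => h; move: (ftest1 l0 tl u1); rewrite h => e; rewrite -e eqxx in u1n0.
(* M preserves the sections of level l, a finite-dimensional space that contains the nonzero
   [ftest l u1]. *)
have [z [f [hf fn0 Mf]]] := eigenvector_ex (ind_level_subspace l) (fun f => @Mlev l f l0)
  (fun (c : C) f f' hf hf' => Mlin c f f' hf.1 hf'.1) hN lev1 f1n0.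
exists [set f | Ind f /\ M f = z *: f]; split.
- split.
  + split; first exact: ind0.
    apply/funext => x; rewrite /M /= scaler0.
    have -> : rt x (0 : cover -> V) = 0 by [].
    by rewrite ell00.
  + move=> b f1 f2 [h1 e1] [h2 e2]; split; first exact: ind_subspace.2.
    by rewrite Mlin // e1 e2 scalerDr !scalerA mulrC.
  + move=> x f1 _ [h1 e1]; split; first exact: ind_rt.
    by rewrite Mrt e1.
- by move=> f1 [].
- move=> e; have : [set f | Ind f /\ M f = z *: f] f by split=> //; exact: hf.1.
  by rewrite e => /= f0; rewrite f0 eqxx in fn0.
- move=> e; have : Ind (fbig l u0) by apply: fbig_ind.
  rewrite -e => -[_] /(congr1 (fun h => h 1%g)); rewrite {1}/M.
  have -> : rt 1%g (fbig l u0) = fbig l u0 by apply/funext => x; rewrite /right_transl c1r.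
  rewrite ell0_fbig // fctE fbig1 // scaler0 LZ => /eqP; rewrite scaler_eq0 (negPf Lu0) orbF.
  by rewrite mulrn_eq0 addn_eq0 gtn_eqF //= expfz_eq0 (negPf Qn0) andbF.
Qed.

End QuadraticCharacter.

Lemma bint_conj j (h : F -> C^o) : lcst j h -> bI j (fun y => (h y)^* : C^o) = (bI j h)^*.
Proof.
move=> hl; have hl' : lcst j (fun y => (h y)^* : C^o).
  by case: hl => l hl; exists l => x y hx hy hxy; rewrite (hl x y).
have [r1 e1] := bintE w0 w1 hl; have [r2 e2] := bintE w0 w1 hl'.
rewrite (e1 (r1 + r2)%N) ?leq_addr // (e2 (r1 + r2)%N) ?leq_addl // /mean.
rewrite -[_ *: (_ *: \sum_c h _)]/(_ * (_ * \sum_c (h _ : C))) !rmorphM rmorph_sum /=.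
rewrite -[LHS]/(_ * (_ * \sum_c ((h _)^* : C))); congr (_ * (_ * _)).
  by rewrite geC0_conj // exprz_ge0 // ler0n.
by rewrite geC0_conj // invr_ge0 exprn_ge0 // ler0n.
Qed.

(** * The invariant inner product and the projection onto a subrepresentation *)

Section Unitary.
Variable B : {dot V for Num.conj}.
Hypothesis BU : forall x u u', torus hilb x -> B (tau x u) (tau x u') = B u u'.

Lemma dot_lin (c : C) u u' z : B (c *: u + u') z = c * B u z + B u' z.
Proof. exact: linearPl. Qed.

Lemma dot_herm u u' : B u u' = (B u' u)^*.
Proof. by rewrite hermC mul1r. Qed.

Lemma dot_scale (c : C) u u' : B (c *: u) (c *: u') = (c * c^*) * B u u'.
Proof. by rewrite linearZl_LR linearZr_LR /= mulrA. Qed.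

Lemma dot_t a u u' : a != 0 -> B (t a u) (t a u') = B u u'.
Proof. by move=> a0; apply: BU; apply: torus_diag. Qed.

Lemma dot_iota e u u' : B (iota e *: u) (iota e *: u') = B u u'.
Proof. by rewrite -!tau_genuine; apply: BU; apply: torus_cen. Qed.

Lemma absC_conj a : (absC a)^* = absC a.
Proof.
rewrite /absC /absF; case: ifP => _; first by rewrite conjC0.
by rewrite geC0_conj // exprz_ge0 // ler0n.
Qed.

Lemma dot_hecke (y : F) u u' : y != 0 ->
  B ((s y (-1) * (absC y)^-1) *: t y^-1 u) ((s y (-1) * (absC y)^-1) *: t y^-1 u') =
  Q ^ (v y + v y) * B u u'.
Proof.
move=> y0; rewrite -!(scalerA (s _ _)) dot_iota dot_scale dot_t ?invr_eq0 //.
by rewrite -absCV // absC_conj absCE ?invr_eq0 // pvalV // opprK -expfzDr ?Qn0.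
Qed.

Definition dotphi f f' y : C^o := B (phi f y) (phi f' y).

Lemma dotphi_lcst f f' j : Ind f -> Ind f' -> lcst j (dotphi f f').
Proof.
move=> hf hf'; have [l h] := phi_lcst j hf; have [l' h'] := phi_lcst j hf'.
exists (l + `|l| + `|l'|)%R => x y hx hy hxy; rewrite /dotphi (h x y) // ?(h' x y) //.
  by apply: vge_le hxy _; lia.
by apply: vge_le hxy _; lia.
Qed.

Lemma dotphi_infty (m : nat) f f' y : ind_level m f -> ind_level m f' -> y != 0 -> v y <= - m%:Z ->
  dotphi f f' y = Q ^ (v y + v y) * B (f 1%g) (f' 1%g).
Proof. by move=> hf hf' y0 hy; rewrite /dotphi (phi_infty hf) // (phi_infty hf') // dot_hecke. Qed.

(* The second term is the integral of dotphi f f' outside P^j, for small j. *)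
Definition form_at j f f' : C :=
  bI j (dotphi f f') + Q ^ (j - 1) * B (f 1%g) (f' 1%g).

(** On the shell of valuation j - 1 the integrand is q^(2 (j - 1)) B(f 1, f' 1), and its integral is
    (q^(j-1) - q^(j-2)) B(f 1, f' 1), which is the change of the tail term. *)
Lemma form_at_pred (m : nat) f f' j : ind_level m f -> ind_level m f' -> j <= 1 - m%:Z ->
  form_at (j - 1) f f' = form_at j f f'.
Proof.
move=> hf hf' hj; have lc := dotphi_lcst (j - 1) hf.1 hf'.1.
rewrite /form_at (bint_split w0 w1 lc) subrK addrAC [RHS]addrC; congr (_ + _).
rewrite (aint_eq w0 w1 (g := fun=> Q ^ ((j - 1) + (j - 1)) * B (f 1%g) (f' 1%g) : C^o)).
- rewrite aint_cst -[_ *: _]/(_ * _) mulrA -mulrDl; congr (_ * _).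
  rewrite mulrBl -!expfzDr ?Qn0 //.
  have -> : - (j - 1) + (j - 1 + (j - 1)) = j - 1 by ring.
  have -> : - (j - 1 + 1) + (j - 1 + (j - 1)) = j - 1 - 1 by ring.
  by rewrite subrK.
- exact: lcst_lcst_shell.
- by move=> y y0 vy; rewrite (dotphi_infty hf hf' y0) vy //; lia.
Qed.

(** The convergent integral of B(phi f, phi f') over F, that is, over B(F) \ SL_2(F) in the
    coordinate of the big cell. *)
Definition form f f' : C := xget 0 [set z | exists m : nat, forall j, j <= - m%:Z ->
  form_at j f f' = z].

Lemma formE (m : nat) f f' j : ind_level m f -> ind_level m f' -> j <= - m%:Z ->
  form f f' = form_at j f f'.
Proof.
move=> hf hf'; have st (d : nat) : form_at (- m%:Z - d%:Z) f f' = form_at (- m%:Z) f f'.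
  elim: d => [|d <-]; first by rewrite subr0.
  rewrite -(form_at_pred hf hf' (j := - m%:Z - d%:Z)); last lia.
  congr form_at; lia.
have {}st i : i <= - m%:Z -> form_at i f f' = form_at (- m%:Z) f f'.
  by move=> hi; rewrite -(st (absz (i + m%:Z)%R)); congr form_at; lia.
have [m' hm'] : exists m' : nat, forall i, i <= - m'%:Z -> form_at i f f' = form f f'.
  by apply: (@xgetPex _ 0 [set z | exists m : nat, forall i, i <= - m%:Z -> form_at i f f' = z]);
    exists (form_at (- m%:Z) f f'), m.
by move=> hj; rewrite st // -(hm' (- (m%:Z + m'%:Z))) ?st //; lia.
Qed.

Lemma ind_level2 f f' : Ind f -> Ind f' -> exists2 m, (0 < m)%N & ind_level m f /\ ind_level m f'.
Proof.
move=> /ind_level_ex[m m0 hm] /ind_level_ex[m' _ hm']; exists (m + m')%N.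
  by rewrite addn_gt0 m0.
by split; [apply: ind_level_le hm; lia|apply: ind_level_le hm'; lia].
Qed.

Lemma form_lin (c : C) f f' f0 : Ind f -> Ind f' -> Ind f0 ->
  form (c *: f + f') f0 = c * form f f0 + form f' f0.
Proof.
move=> hf hf' hf0; have [m _ [hm hm']] := ind_level2 hf hf'; have [m0 _ h0] := ind_level_ex hf0.
have {}hm := ind_level_le (leq_addr m0 m) hm; have {}hm' := ind_level_le (leq_addr m0 m) hm'.
have {}h0 := ind_level_le (leq_addl m m0) h0.
rewrite (formE (hm) h0 (lexx _)) (formE hm' h0 (lexx _)).
rewrite (formE ((ind_level_subspace _).2 c _ _ hm hm') h0 (lexx _)).
have lc := dotphi_lcst (- (m + m0)%N%:Z) hf hf0; have lc' := dotphi_lcst (- (m + m0)%N%:Z) hf' hf0.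
rewrite /form_at mulrDr addrACA -[c * bI _ _]/(c *: _) -(bintZ _ lc) -(bintD w0 w1 (lcstZ c lc)
  lc').
rewrite mulrCA -mulrDr -dot_lin; congr (bI _ _ + _).
by apply/funext => y; exact: (dot_lin c (phi f y) (phi f' y) (phi f0 y)).
Qed.

Lemma form_herm f f' : Ind f -> Ind f' -> form f f' = (form f' f)^*.
Proof.
move=> hf hf'; have [m _ [hm hm']] := ind_level2 hf hf'.
rewrite (formE hm hm' (lexx _)) (formE hm' hm (lexx _)) /form_at rmorphD [X in _ = _ + X]rmorphM /=.
have lc := dotphi_lcst (- m%:Z) hf' hf; rewrite -(bint_conj lc) -dot_herm.
rewrite [(Q ^ _)^*]geC0_conj ?exprz_ge0 ?ler0n //; congr (bI _ _ + _).
by apply/funext => y; rewrite /dotphi -dot_herm.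
Qed.

(** Both terms of [form_at] are nonnegative, so phi vanishes on the ball and [f 1] is 0; then phi
    vanishes outside the ball too. *)
Lemma form_neq0 f : Ind f -> f != 0 -> form f f != 0.
Proof.
move=> hf; apply: contra_neq => e; have [m _ hm] := ind_level_ex hf.
move: e; rewrite (formE hm hm (lexx _)) => e.
have lc := dotphi_lcst (- m%:Z) hf hf.
have [b0 bz] := bint_ge0 w0 w1 lc (fun y => dnorm_ge0 B (phi f y)).
have Q0 : 0 < Q ^ (- m%:Z - 1) by rewrite exprz_gt0 // lt_def Qn0 ler0n.
have c0 : 0 <= Q ^ (- m%:Z - 1) * B (f 1%g) (f 1%g) by apply: mulr_ge0; [exact: ltW|exact:
  dnorm_ge0].
move/eqP: e; rewrite paddr_eq0 // => /andP[/eqP /bz bz0].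
rewrite mulf_eq0 gt_eqF //= dnorm_eq0 => /eqP f1.
apply: ind_ext => //; first exact: ind0.
move=> y; rewrite -/(phi f y) [RHS]/(0 : V).
have [hy|/negP hy] := boolP `[< vge (- m%:Z) y >].
  by apply/eqP; rewrite -(dnorm_eq0 B); apply/eqP; apply: bz0; apply: asboolW.
have y0 : y != 0 by apply/eqP => y0; apply: hy; apply/asboolP; rewrite y0; exact: vge0.
rewrite (phi_infty hm) // ?f1 ?(t0 tau_rep) ?scaler0 // ?invr_eq0 //.
by rewrite leNgt; apply/negP => h'; apply: hy; apply/asboolP; rewrite vge_nz //; lia.
Qed.

Lemma form_upper f f' y : Ind f -> Ind f' ->
  form (rt (sec (upper y)) f) (rt (sec (upper y)) f') = form f f'.
Proof.
move=> hf hf'; have [m _ [hm hm']] := ind_level2 hf hf'.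
have [m1 _ [h1 h1']] := ind_level2 (ind_rt (sec (upper y)) hf) (ind_rt (sec (upper y)) hf').
have hj : - (m + m1 + `|v y|)%N%:Z <= - m%:Z by lia.
have hj1 : - (m + m1 + `|v y|)%N%:Z <= - m1%:Z by lia.
rewrite (formE hm hm' hj) (formE h1 h1' hj1); congr (_ + _ * B _ _).
- have hy : vge (- (m + m1 + `|v y|)%N%:Z) y by apply: vge_le (vge_v y) _; lia.
  rewrite -(bint_trans w0 w1 hy (dotphi_lcst _ hf hf')); congr (bI _ _).
  by apply/funext => z; rewrite /dotphi !phi_upper.
- by rewrite /right_transl c1l -[sec _]c1r (ind_u _ _ hf).
- by rewrite /right_transl c1l -[sec _]c1r (ind_u _ _ hf').
Qed.

Lemma form_diag f f' a : Ind f -> Ind f' -> a != 0 ->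
  form (rt (sec (diag a)) f) (rt (sec (diag a)) f') = form f f'.
Proof.
move=> hf hf' a0; have [m _ [hm hm']] := ind_level2 hf hf'; have ai : a^-1 != 0 by rewrite invr_eq0.
have [m1 _ [h1 h1']] := ind_level2 (ind_rt (sec (diag a)) hf) (ind_rt (sec (diag a)) hf').
pose j : int := - (m + m1 + `|v a| + `|v a|)%N%:Z.
have hj : j - (v a + v a) <= - m%:Z by rewrite /j; lia.
have hj1 : j <= - m1%:Z by rewrite /j; lia.
rewrite (formE hm hm' hj) (formE h1 h1' hj1) /form_at.
have a2 : a ^- 2 != 0 by rewrite invr_eq0 expf_neq0.
have va : v (a ^- 2) = - (v a + v a) by rewrite pvalV ?expf_neq0 // expr2 pvalM.
have lc := dotphi_lcst (j + v (a ^- 2)) hf hf'.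
have E y : dotphi (rt (sec (diag a)) f) (rt (sec (diag a)) f') y =
    Q ^ (v a + v a) *: dotphi f f' (a ^- 2 * y).
  rewrite /dotphi !phi_diag // dot_scale dot_t // -absCV // absC_conj absCE // pvalV // opprK.
  by rewrite -expfzDr ?Qn0 // (mulrC y).
congr (_ + _).
  transitivity (bI j (fun y => Q ^ (v a + v a) *: dotphi f f' (a ^- 2 * y))).
    by congr (bI _ _); apply/funext.
  rewrite (bintZ _ (lcst_scale w0 w1 a2 lc)) (bint_scale w0 w1 a2 lc) va scalerA.
  by rewrite -expfzDr ?Qn0 // subrr expr0z scale1r.
rewrite /right_transl !c1l -[sec _]c1r (ind_t _ hf a0) (ind_t _ hf' a0) dot_scale dot_t //.
rewrite absC_conj absCE // mulrA -!expfzDr ?Qn0 //; congr (Q ^ _ * _); ring.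
Qed.

Lemma form_cen f f' e : Ind f -> Ind f' -> form (rt (cen e) f) (rt (cen e) f') = form f f'.
Proof.
move=> hf hf'; have [m _ [hm hm']] := ind_level2 hf hf'.
have [m1 _ [h1 h1']] := ind_level2 (ind_rt (cen e) hf) (ind_rt (cen e) hf').
have hj : - (m + m1)%N%:Z <= - m%:Z by lia.
have hj1 : - (m + m1)%N%:Z <= - m1%:Z by lia.
have rE f0 x : Ind f0 -> rt (cen e) f0 x = iota e *: f0 x.
  by move=> h0; rewrite /right_transl -(cen_comm n_gt0 mu_full hilbP) (ind_cen _ _ h0).
rewrite (formE hm hm' hj) (formE h1 h1' hj1) /form_at !rE // dot_iota; congr (bI _ _ + _).
by apply/funext => y; rewrite /dotphi /phi !rE // dot_iota.
Qed.

Lemma phi_weylV f y : phi (rt (sec weylV) f) y = f (sec (lower (- y))).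
Proof. by rewrite /phi /right_transl (wn_weylV n_gt0 cop mu_full hilbP). Qed.

Lemma dotphi_weylV f f' y : Ind f -> Ind f' -> y != 0 ->
  dotphi (rt (sec weylV) f) (rt (sec weylV) f') y = Q ^ (v y + v y) * dotphi f f' (- y^-1).
Proof.
move=> hf hf' y0; have z0 : - y^-1 != 0 by rewrite oppr_eq0 invr_eq0.
have zi : (- y^-1)^-1 = - y by rewrite invrN invrK.
rewrite /dotphi !phi_weylV !(phi_lower _ z0) // dot_hecke // zi mulrA -expfzDr ?Qn0 //.
by rewrite pvalN pvalV // -opprD subrr expr0z mul1r.
Qed.

Lemma dotphi_near0 (m : nat) f f' j : ind_level m f -> ind_level m f' -> m%:Z <= j ->
  bI j (dotphi f f') = Q ^ (- j) * dotphi f f' 0.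
Proof.
move=> hm hm' hj; rewrite -[RHS](bint_cst w0 w1 j (dotphi f f' 0 : C^o)).
apply: (bint_eq w0 w1); first exact: dotphi_lcst hm.1 hm'.1.
move=> y hy; have hy' : vge m%:Z y by apply: vge_le hy hj.
by rewrite /dotphi -[y]add0r (phi_per _ hm hy') (phi_per _ hm' hy').
Qed.

(** The Weyl element acts by y -> - y^-1. This exchanges the shells of valuation i and - i for |i|
    <= m, and exchanges the ball P^(m+1), where the integrand is constant, with the tail at
    infinity. *)
Lemma form_weylV f f' : Ind f -> Ind f' ->
  form (rt (sec weylV) f) (rt (sec weylV) f') = form f f'.
Proof.
move=> hf hf'; set g := rt _ f; set g' := rt _ f'.
have hg : Ind g := ind_rt _ hf; have hg' : Ind g' := ind_rt _ hf'.
have [m1 m10 [hm1 hm1']] := ind_level2 hf hf'; have [m2 _ [hm2 hm2']] := ind_level2 hg hg'.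
set m := (m1 + m2)%N; have hm : ind_level m f by apply: ind_level_le hm1; rewrite /m; lia.
have hm' : ind_level m f' by apply: ind_level_le hm1'; rewrite /m; lia.
have hgm : ind_level m g by apply: ind_level_le hm2; rewrite /m; lia.
have hgm' : ind_level m g' by apply: ind_level_le hm2'; rewrite /m; lia.
rewrite (formE hm hm' (lexx _)) (formE hgm hgm' (lexx _)) /form_at.
have phi0 f0 : phi (rt (sec weylV) f0) 0 = f0 1%g by rewrite phi_weylV oppr0 lower0 sec1.
have E0 : dotphi g g' 0 = B (f 1%g) (f' 1%g) by rewrite /dotphi !phi0.
(* [g 1] is a value of f at [weylV], not at a point [wn y]; its product is read off the behaviour
   near infinity, at the point w^-m. *)
have E1 : B (g 1%g) (g' 1%g) = dotphi f f' 0.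
  have y0 : w ^ (- m%:Z) != 0 by rewrite expfz_neq0.
  have vy : v (w ^ (- m%:Z)) = - m%:Z by rewrite pvalXz // w1 mul1r.
  apply: (mulfI (expfz_neq0 (v (w ^ (- m%:Z)) + v (w ^ (- m%:Z))) Qn0)).
  rewrite -(dotphi_infty hgm hgm' y0) ?vy // dotphi_weylV // vy; congr (_ * _).
  have hz : vge m%:Z (- (w ^ (- m%:Z))^-1) by rewrite vge_nz ?oppr_eq0 ?invr_eq0 // pvalN pvalV
    // vy opprK.
  by rewrite /dotphi -[- _]add0r (phi_per _ hm hz) (phi_per _ hm' hz).
have lc := dotphi_lcst (- m%:Z) hf hf'; have lcg := dotphi_lcst (- m%:Z) hg hg'.
have shells (h : F -> C^o) : lcst (- m%:Z) h ->
    bI (- m%:Z) h = \sum_(i < (m + m).+1) (aI (- m%:Z + i%:Z) h : C) + bI (m%:Z + 1) h :> C.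
  move=> hl; rewrite (bint_shells (m + m).+1 hl).
  by have -> : - m%:Z + (m + m).+1%:Z = m%:Z + 1 by lia.
have shellE : \sum_(i < (m + m).+1) (aI (- m%:Z + i%:Z) (dotphi g g') : C) =
    \sum_(i < (m + m).+1) (aI (- m%:Z + i%:Z) (dotphi f f') : C).
  rewrite [RHS](reindex_inj rev_ord_inj); apply: eq_bigr => i _ /=.
  have -> : - m%:Z + ((m + m).+1 - i.+1)%N%:Z = - (- m%:Z + i%:Z) by have := ltn_ord i; lia.
  move: (- m%:Z + i%:Z) => j.
  have N1 : (-1 : F) != 0 := N1_neq0 F.
  have shl (i0 : int) : lcst_shell i0 (dotphi f f') by apply: lcst_lcst_shell; apply: dotphi_lcst.
  have shN : lcst_shell (- j) (fun z => dotphi f f' (- z)).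
    have [l hl] := shl (- j); exists l => x y x0 vx y0 vy hxy.
    apply: hl; rewrite ?oppr_eq0 ?pvalN //.
    by rewrite -opprD; apply: vgeN.
  transitivity (aI j (fun y => Q ^ (j + j) *: dotphi f f' (- y^-1))).
    apply: (aint_eq w0 w1); first by apply: lcst_lcst_shell; apply: dotphi_lcst.
    by move=> y y0 vy; rewrite dotphi_weylV // vy.
  rewrite aintZ; last first.
    by have [l hl] := lcst_lcst_shell (dotphi_lcst j hg hg'); exists l => x y x0 vx y0 vy hxy;
      have := hl x y x0 vx y0 vy hxy; rewrite !dotphi_weylV // vx vy;
      move/(mulfI (expfz_neq0 (j + j) Qn0)).
  rewrite (aint_inv w0 w1 shN) scalerA -expfzDr ?Qn0 // subrr expr0z scale1r.
  transitivity (aI (- j) (fun z => dotphi f f' (-1 * z))).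
    by congr (aI _ _); apply/funext => z; rewrite mulN1r.
  have := aint_scale w0 w1 (m := - j) N1 (shl _); rewrite pvalN1 addr0 expr0z scale1r.
  by [].
have [S [-> ->]] : exists S : C, bI (- m%:Z) (dotphi f f') = S + Q ^ (- m%:Z - 1) * dotphi f f' 0 /\
    bI (- m%:Z) (dotphi g g') = S + Q ^ (- m%:Z - 1) * B (f 1%g) (f' 1%g).
  have Em : - (m%:Z + 1) = - m%:Z - 1 by ring.
  have hle : m%:Z <= m%:Z + 1 by rewrite lerDl.
  have n1 : bI (m%:Z + 1) (dotphi f f') = Q ^ (- m%:Z - 1) * dotphi f f' 0 :> C.
    by rewrite -Em; apply: (dotphi_near0 hm hm' hle).
  have n2 : bI (m%:Z + 1) (dotphi g g') = Q ^ (- m%:Z - 1) * B (f 1%g) (f' 1%g) :> C.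
    by rewrite -Em -E0; apply: (dotphi_near0 hgm hgm' hle).
  exists (\sum_(i < (m + m).+1) (aI (- m%:Z + i%:Z) (dotphi f f') : C)); split.
    exact: (etrans (shells _ lc) (f_equal2 (@GRing.add C) erefl n1)).
  exact: (etrans (shells _ lcg) (f_equal2 (@GRing.add C) shellE n2)).
by rewrite E1 addrAC.
Qed.

Lemma weyl_inv : (sec weylV * sec weyl)%g = 1%g :> cover.
Proof.
have e : (weylV * weyl)%g = 1%g :> SL2 F.
  by apply: sl_ext; rewrite !genE !sl1E /=; ring.
rewrite -(sec1 hilb) -e; apply: sec_mul.
rewrite /kubota e [xfun weyl]xfun_weyl; have -> : xfun (1%g : SL2 F) = 1.
  by rewrite -diag1 xfun_diag ?oner_neq0 // invr1.
rewrite divr1 (hilb1r n_gt0 mu_full hilbP) // mulf_neq0 ?oner_neq0 // invr_eq0.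
exact: xfun_neq0.
Qed.

(** Generators are enough: [cen], [diag], [upper], and [weyl], which is reached from [weylV] as its
    inverse. *)
Lemma form_rt x f f' : Ind f -> Ind f' -> form (rt x f) (rt x f') = form f f'.
Proof.
have M x1 x2 : (forall f f', Ind f -> Ind f' -> form (rt x1 f) (rt x1 f') = form f f') ->
  (forall f f', Ind f -> Ind f' -> form (rt x2 f) (rt x2 f') = form f f') ->
  forall f f', Ind f -> Ind f' -> form (rt (x1 * x2)%g f) (rt (x1 * x2)%g f') = form f f'.
  move=> h1 h2 f1 f2 hf1 hf2; rewrite -!rtM h1 ?h2 //; exact: ind_rt.
have hW f1 f2 : Ind f1 -> Ind f2 -> form (rt (sec weyl) f1) (rt (sec weyl) f2) = form f1 f2.
  move=> h1 h2; rewrite -(form_weylV (ind_rt (sec weyl) h1) (ind_rt (sec weyl) h2)).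
  rewrite !rtM weyl_inv; congr form; apply/funext => z; exact: congr1 (c1r z).
case: x => g e; rewrite (cover_cen n_gt0 mu_full hilbP).
move: f f'; apply: (M); first by move=> *; apply: form_cen.
have [c0|c0] := eqVneq (sl_val g ord_max ord0) 0.
  have [a0 ->] := sec_small n_gt0 mu_full hilbP c0.
  by apply: (M) => *; [apply: form_diag|apply: form_upper].
have c1 : (sl_val g ord_max ord0)^-1 != 0 by rewrite invr_eq0.
rewrite (sec_big n_gt0 mu_full hilbP c0); apply: (M); first by move=> *; apply: form_upper.
apply: (M); first by move=> *; apply: form_diag.
rewrite /wn -(sec_upperr n_gt0 mu_full hilbP); apply: (M); first exact: hW.
by move=> *; apply: form_upper.
Qed.


Section Projection.
Variable W : set (cover -> V).
Hypotheses (W_sub : subrep G rt W) (W_ind : W `<=` Ind).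

Lemma W_subspace : subspace W. Proof. by case: W_sub. Qed.

Lemma W_rt x f : W f -> W (rt x f). Proof. by case: W_sub => _ _ h; apply: h. Qed.

Lemma indB f f' : Ind f -> Ind f' -> Ind (f - f').
Proof. exact: (subspaceB ind_subspace). Qed.

Lemma formB f f' f0 : Ind f -> Ind f' -> Ind f0 -> form (f - f') f0 = form f f0 - form f' f0.
Proof.
by move=> hf hf' h0; rewrite addrC -scaleN1r form_lin // mulN1r addrC.
Qed.

Lemma ind_level_rt (m m' : nat) k f : (0 < m)%N -> (m <= m')%N -> congruence m k ->
  ind_level m' f -> ind_level m' (rt (sec k) f).
Proof.
move=> m0 mm hk [hf hm]; split; first exact: ind_rt.
move=> k' x hk'; rewrite /right_transl -!cA; have hk'm := congruence_le hk' mm.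
have cM := sec_congruenceM n_gt0 cop mu_full hilbP m0.
have hn := congruence_normal hk hk'.
rewrite (cM _ _ hk'm hk).
have -> : (k' * k)%g = (k * (k^-1 * k' * k))%g by rewrite !mulgA mulgV mul1g.
rewrite -(cM _ _ hk (congruence_le hn mm)) cA.
exact: hm.
Qed.

Lemma ortho_unique (X : set (cover -> V)) f (u u' : cover -> V) : subspace X -> X `<=` Ind -> Ind
  f ->
  X u -> X u' -> (forall f1, X f1 -> form (f - u) f1 = 0) ->
  (forall f1, X f1 -> form (f - u') f1 = 0) -> u = u'.
Proof.
move=> Xs XI hf hu hu' h h'; apply: contrapT => ne; have nz : u - u' != 0 by rewrite subr_eq0;
  apply/eqP.
have hX : X (u - u') := subspaceB Xs hu hu'.
have e : u - u' = (f - u') - (f - u) by rewrite opprB [RHS]addrC addrA subrK.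
have hI := indB hf (XI _ hu); have hI' := indB hf (XI _ hu').
have := form_neq0 (XI _ hX) nz; rewrite {1}e (formB hI' hI (XI _ hX)) h // h' // subrr.
by rewrite eqxx.
Qed.

(** The projection u of f onto the level m part of W is orthogonal to all of W. Against x of level
    m1, let u' be the projection onto the part of level m + m1. The congruence subgroup of level m
    fixes f, hence u' by uniqueness of projections; so u' has level m and equals u. *)
Lemma projection_level (m : nat) f : (0 < m)%N -> ind_level m f ->
  exists2 u, W u & forall f1, W f1 -> form (f - u) f1 = 0.
Proof.
move=> m0 hf; pose X (j : nat) := [set f1 | W f1 /\ ind_level j f1] .
have Xs (j : nat) : subspace (X j).
  split=> [|c g g' [h1 h2] [h1' h2']]; first by split; [exact: W_subspace.1|exact:
    (ind_level_subspace j).1].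
  by split; [exact: W_subspace.2|exact: (ind_level_subspace j).2].
have XI (j : nat) : X j `<=` Ind by move=> g [/W_ind].
have pr (j : nat) : (0 < j)%N -> exists2 u, X j u & forall f1, X j f1 -> form (f - u) f1 = 0.
  move=> j0; have [N hN] := ind_level_dim j0.
  have hN' : dim_le N (X j) by move=> g hg; apply: hN => i; exact: (hg i).2.
  exact: (ortho_projection (Xs j) (XI j) ind_subspace hN' form_lin form_herm form_neq0 hf.1).
have [u hu uo] := pr m m0; exists u => [|x hx]; first exact: hu.1.
have [m1 m10 hm1] := ind_level_ex (W_ind hx).
have m'0 : (0 < m + m1)%N by rewrite addn_gt0 m0.
have [u' hu' uo'] := pr (m + m1)%N m'0.
have hxX : X (m + m1)%N x by split=> //; apply: ind_level_le hm1; lia.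
suff -> : u = u' by exact: uo'.
have lem : (m <= m + m1)%N by lia.
have sub f1 : X m f1 -> X (m + m1)%N f1 by move=> [h1 h2]; split=> //; apply: ind_level_le h2.
apply: (ortho_unique (Xs m) (XI m) hf.1 hu _ uo) => [|y hy]; last by apply: uo'; exact: sub.
split; first exact: hu'.1.
split=> [|k z hk]; first exact: (XI _ _ hu').
have Xrt k' f1 : congruence m k' -> X (m + m1)%N f1 -> X (m + m1)%N (rt (sec k') f1).
  by move=> hk' [h1 h2]; split; [exact: W_rt|exact: (ind_level_rt m0 lem hk' h2)].
suff : rt (sec k) u' = u' by move=> e; rewrite -[in RHS]e.
apply: (ortho_unique (Xs _) (XI _) hf.1 (Xrt _ _ hk hu') hu' _ uo') => y hy.
have fE : rt (sec k) f = f by apply/funext => z'; exact: hf.2.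
have kV := congruenceV hk.
have yE : y = rt (sec k) (rt (sec (k^-1)%g) y).
  rewrite rtM (sec_congruenceM n_gt0 cop mu_full hilbP m0 hk kV) mulgV [sec 1%g]sec1.
  by apply/funext => z'; rewrite /right_transl c1r.
have hy' := Xrt _ _ kV hy.
rewrite yE -[in f - _]fE; have -> : rt (sec k) f - rt (sec k) u' = rt (sec k) (f - u') by [].
rewrite form_rt; [exact: uo'|exact: indB hf.1 (XI _ _ hu')|exact: (XI _ _ hy')].
Qed.

Definition proj f := xget 0 [set u | W u /\ forall f1, W f1 -> form (f - u) f1 = 0].

Lemma projP f : Ind f -> W (proj f) /\ forall f1, W f1 -> form (f - proj f) f1 = 0.
Proof.
move=> hf; have [m m0 hm] := ind_level_ex hf; have [u h1 h2] := projection_level m0 hm.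
by apply: (@xgetPex _ 0 [set u | W u /\ forall f1, W f1 -> form (f - u) f1 = 0]); exists u.
Qed.

Lemma projE f (u : cover -> V) : Ind f -> W u -> (forall f1, W f1 -> form (f - u) f1 = 0) -> proj
  f = u.
Proof.
move=> hf hu uo; have [h1 h2] := projP hf.
exact: (ortho_unique W_subspace W_ind hf h1 hu h2 uo).
Qed.

Lemma proj_ind f : Ind f -> Ind (proj f).
Proof. by move=> /projP[/W_ind]. Qed.

Lemma proj_lin (c : C) f f' : Ind f -> Ind f' -> proj (c *: f + f') = c *: proj f + proj f'.
Proof.
move=> hf hf'; have [h1 h2] := projP hf; have [h1' h2'] := projP hf'.
apply: projE; [exact: ind_subspace.2|exact: W_subspace.2|].
move=> x hx; have -> : c *: f + f' - (c *: proj f + proj f') = c *: (f - proj f) + (f' - proj f').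
  by rewrite scalerBr opprD addrACA.
rewrite form_lin; [|exact: indB (proj_ind hf)|exact: indB (proj_ind hf')|exact: W_ind].
by rewrite h2 // h2' // mulr0 addr0.
Qed.

Lemma cover_inv x : exists x', (x * x')%g = 1%g.
Proof.
case: x => g e; exists (Cover hilb g^-1%g (kubota hilb g g^-1%g * e)^-1%g).
apply: cover_ext; first exact: mulgV.
by rewrite /= mulfV //; have /andP[] := mu_valP (kubota hilb g g^-1 * e)%g.
Qed.

Lemma proj_rt x f : Ind f -> proj (rt x f) = rt x (proj f).
Proof.
move=> hf; have [h1 h2] := projP hf.
apply: projE; [exact: ind_rt|exact: W_rt|move=> y hy].
have [x' xx'] := cover_inv x.
have yE : y = rt x (rt x' y) by rewrite rtM xx'; apply/funext => z; rewrite /right_transl c1r.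
rewrite yE; have -> : rt x f - rt x (proj f) = rt x (f - proj f) by [].
rewrite form_rt; [apply: h2; exact: W_rt|exact: indB (proj_ind hf)|].
by apply: W_ind; exact: W_rt.
Qed.

Lemma proj_id f : W f -> proj f = f.
Proof.
move=> hf; apply: projE => //; first exact: W_ind.
move=> x hx; have hI := W_ind hf; have hx' := W_ind hx.
by rewrite formB // subrr.
Qed.


Lemma t_level_le (l m : nat) : (forall a u, vge l%:Z (a - 1) -> t a u = u) -> (l <= m)%N ->
  forall a u, vge m%:Z (a - 1) -> t a u = u.
Proof. by move=> tl lm a u ha; apply: tl; apply: vge_le ha _. Qed.

Lemma rep_ball (a : int) r (i : rs_type (rsys w0 w1 r)) : vge a (w ^ a * rs_rep i).
Proof. by have := vge_wz w0 w1 a (rs_int i); rewrite addr0. Qed.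

(** * The operator D attached to the projection *)

Section Functional.
Variable l : nat.
Hypotheses (l0 : (0 < l)%N) (tl : forall a u, vge l%:Z (a - 1) -> t a u = u).

Lemma fbig_lin (b : nat) (c : C) u u' : (l <= b)%N ->
  fbig b (c *: u + u') = c *: fbig b u + fbig b u'.
Proof.
move=> lb; have b0 : (0 < b)%N by lia. have tb := t_level_le tl lb.
apply: ind_ext; [exact: fbig_ind|by apply: ind_subspace.2; apply: fbig_ind| |].
- move=> y; rewrite -[LHS]/(phi (fbig b _) y) -[RHS]/(c *: phi (fbig b u) y + phi (fbig b u') y).
  by rewrite !phi_fbig //; case: ifP => // _; rewrite scaler0 addr0.
- by rewrite -[RHS]/(c *: fbig b u 1%g + fbig b u' 1%g) !fbig1 // scaler0 addr0.
Qed.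

Lemma ftest_fbig u : ftest l u = rt (sec weyl) (fbig l u).
Proof.
have e : (sec weyl * sec weylV)%g = 1%g :> cover.
  have := wn_weylV n_gt0 cop mu_full hilbP 0.
  by rewrite /wn upper0 mulg1 oppr0 lower0 sec1.
by rewrite /fbig rtM e; apply/funext => x; rewrite /right_transl c1r.
Qed.

Lemma ftest_lin (c : C) u u' : ftest l (c *: u + u') = c *: ftest l u + ftest l u'.
Proof. by rewrite !ftest_fbig fbig_lin. Qed.

(** phi f is supported on P^a and constant modulo P^b, hence a finite combination of indicators of
    cosets of P^b, each a translated [fbig]; [f 1 = 0] matches the value of the sum at 1. *)
Lemma fbig_decomp f (a : int) (r b : nat) : Ind f -> f 1%g = 0 -> b%:Z = a + r%:Z -> (l <= b)%N ->
  (forall y, ~ vge a y -> phi f y = 0) -> (forall y z, vge b%:Z z -> phi f (y + z) = phi f y) ->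
  f = \sum_(i : rs_type (rsys w0 w1 r)) rt (sec (upper (- (w ^ a * rs_rep i))))
        (fbig b (phi f (w ^ a * rs_rep i))).
Proof.
move=> hf f1 bE lb f0 fb; have b0 : (0 < b)%N by lia. have tb := t_level_le tl lb.
pose F0 (i : rs_type (rsys w0 w1 r)) := rt (sec (upper (- (w ^ a * rs_rep i))))
  (fbig b (phi f (w ^ a * rs_rep i))).
have hI i : Ind (F0 i) by apply: ind_rt; apply: fbig_ind.
have sumE x : (\sum_i F0 i) x = \sum_i F0 i x by rewrite fct_sumE.
apply: (ind_ext hf); first by apply: (subspace_sum ind_subspace) => i _; exact: hI.
  move=> y; rewrite [RHS]sumE.
  have E i : F0 i (sec (wn y)) =
      if `[< vge b%:Z (y - w ^ a * rs_rep i) >] then phi f (w ^ a * rs_rep i) else 0.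
    by rewrite -[LHS]/(phi (F0 i) y) phi_upper phi_fbig.
  under eq_bigr => i _ do rewrite E.
  rewrite -/(phi f y); have [hy|ny] := pselect (vge a y); last first.
    rewrite f0 // big1 // => i _; rewrite asboolF // => h; apply: ny.
    rewrite -[y](subrK (w ^ a * rs_rep i)); apply: vgeD; first by apply: vge_le h _; lia.
    exact: rep_ball.
  have [i0 hi0] := rep_unique w0 w1 r hy; rewrite bE.
  rewrite (bigD1 i0) //= big1 ?addr0 => [|i ii]; last first.
    by rewrite asboolF // => /hi0 e; rewrite e eqxx in ii.
  rewrite asboolT; last exact/hi0.
  by rewrite -[in LHS](subrK (w ^ a * rs_rep i0) y) addrC fb // bE; apply/hi0.
rewrite f1 [RHS]sumE big1 // => i _.
rewrite /F0 /right_transl c1l -[sec _]c1r (ind_u _ _ (fbig_ind b0 tb _)).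
exact: fbig1.
Qed.

(* By Frobenius reciprocity lfun determines the projection onto W; by lfun_big it is, on the
   sections supported on the big cell, dfun composed with integration. *)
Definition lfun f : V := proj f 1%g.

Lemma lfun_lin (c : C) f f' : Ind f -> Ind f' -> lfun (c *: f + f') = c *: lfun f + lfun f'.
Proof. by move=> hf hf'; rewrite /lfun proj_lin. Qed.

Lemma lfun0 : lfun (0 : cover -> V) = 0.
Proof.
have := lfun_lin 1 ind0 ind0; rewrite !scale1r addr0 => /eqP.
by rewrite -subr_eq0 opprD addNKr oppr_eq0 => /eqP.
Qed.

Lemma lfun_sum (I : finType) (f : I -> cover -> V) : (forall i, Ind (f i)) ->
  lfun (\sum_i f i) = \sum_i lfun (f i).
Proof.
move=> hf; suff [] : Ind (\sum_i f i) /\ lfun (\sum_i f i) = \sum_i lfun (f i) by [].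
elim/big_rec2: _ => [|i x f' _ [hf' e]]; first by split; [exact: ind0|exact: lfun0].
have := lfun_lin 1 (hf i) hf'; rewrite !scale1r e => ->; split=> //.
by have := ind_subspace.2 1 _ _ (hf i) hf'; rewrite scale1r.
Qed.

Lemma lfun_upper f y : Ind f -> lfun (rt (sec (upper y)) f) = lfun f.
Proof.
move=> hf; rewrite /lfun proj_rt // /right_transl c1l -[sec _]c1r.
exact: (ind_u _ _ (proj_ind hf)).
Qed.

Lemma lfun_diag f a : Ind f -> a != 0 -> lfun (rt (sec (diag a)) f) = absC a *: t a (lfun f).
Proof.
move=> hf a0; rewrite /lfun proj_rt // /right_transl c1l -[sec _]c1r.
exact: (ind_t _ (proj_ind hf) a0).
Qed.

(** P^l is the disjoint union of q^(b - l) translates of P^b, and [lfun] is invariant under N(F). *)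
Lemma lfun_fbig (b : nat) u : (l <= b)%N ->
  lfun (fbig l u) = Q ^ (b%:Z - l%:Z) *: lfun (fbig b u).
Proof.
move=> lb; have b0 : (0 < b)%N by lia. have tb := t_level_le tl lb.
have dec := @fbig_decomp (fbig l u) l%:Z (b - l)%N b (fbig_ind l0 tl u) (fbig1 l0 u).
rewrite [X in lfun X = _]dec //; last 3 first.
- by lia.
- by move=> y hy; rewrite phi_fbig // asboolF.
- move=> y z hz; rewrite !phi_fbig //; congr (if _ then _ else _); apply/asbool_equiv_eq.
  have hz' : vge l%:Z z by apply: vge_le hz _; lia.
  by split=> h; [rewrite -[y](addrK z); apply: vgeB|apply: vgeD].
rewrite lfun_sum => [|i]; last by apply: ind_rt; apply: fbig_ind.
transitivity (\sum_(i : rs_type (rsys w0 w1 (b - l))) lfun (fbig b u)).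
  apply: eq_bigr => i _; rewrite lfun_upper; last exact: fbig_ind.
  rewrite phi_fbig // asboolT //.
  exact: rep_ball.
rewrite sumr_const rs_card -[_ *+ _]scaler_nat natrX; congr (_ *: _).
by rewrite subzn.
Qed.

(** The factor q^l divides by the volume of P^l, so that by [lfun_fbig] a smaller ball would give
    the same operator. *)
Definition dfun u := Q ^ l%:Z *: lfun (fbig l u).

Lemma dfun_lin : linear dfun.
Proof.
move=> c u u'; rewrite /dfun fbig_lin // lfun_lin; try exact: fbig_ind.
by rewrite scalerDr !scalerA mulrC.
Qed.

(** As f vanishes at 1, phi f has bounded support and f is a sum of translated bumps, each
    contributing its value times the volume of its ball. *)
Lemma lfun_big f : Ind f -> f 1%g = 0 -> exists m : nat, forall j, j <= - m%:Z ->
  lfun f = dfun (bI j (phi f)).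
Proof.
move=> hf f1; have [m m0 hm] := ind_level_ex hf; exists m => j hj.
have [r [hr -> fr]] := bint_sum_rep w0 w1 (`|j| + l)%N (phi_lcst j hf).
have [b bE] : exists b : nat, b%:Z = j + r%:Z by exists (absz (j + r%:Z)%R); lia.
have lb : (l <= b)%N by lia. have b0 : (0 < b)%N by lia. have tb := t_level_le tl lb.
have far y : ~ vge j y -> phi f y = 0.
  move=> ny; have y0 : y != 0 by apply/eqP => y0; apply: ny; rewrite y0; exact: vge0.
  rewrite (phi_infty hm) // ?f1 ?(t0 tau_rep) ?scaler0 // ?invr_eq0 //.
  by rewrite leNgt; apply/negP => h'; apply: ny; rewrite vge_nz //; lia.
rewrite [X in lfun X = _](fbig_decomp hf f1 bE lb far); last first.
  move=> y z hz; have hz' : vge j z by apply: vge_le hz _; lia.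
  have [hy|ny] := pselect (vge j y).
    by apply: fr; [exact: vgeD|exact: hy|rewrite addrAC subrr add0r -bE].
  rewrite !far // => h; apply: ny; rewrite -[y](addrK z); exact: vgeB.
rewrite lfun_sum => [|i]; last by apply: ind_rt; apply: fbig_ind.
pose Lb u := lfun (fbig b u).
have Lblin : linear Lb.
  by move=> c u u'; rewrite /Lb fbig_lin // lfun_lin //; apply: fbig_ind.
pose Lb' : {linear V -> V} := HB.pack Lb (GRing.isLinear.Build _ _ _ _ Lb Lblin).
transitivity (Lb (\sum_(i : rs_type (rsys w0 w1 r)) phi f (w ^ j * rs_rep i))).
  rewrite -[RHS]/(Lb' _) linear_sum; apply: eq_bigr => i _ /=.
  by rewrite lfun_upper //; apply: fbig_ind.
rewrite /dfun (lfun_fbig _ lb) -/(Lb _) -bE -[Lb (_ *: _)]/(Lb' (_ *: _)) linearZ_LR /=.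
rewrite !scalerA -!expfzDr ?Qn0 //.
have -> : l%:Z + (b%:Z - l%:Z) - b%:Z = 0 by ring.
by rewrite expr0z scale1r.
Qed.

(** [lfun] of the translate of [fbig] by [diag a] is computed in two ways: [lfun_diag] produces t(a)
    outside D, and [bint_phi_diag] produces t(a^-1) inside D. *)
Lemma dfun_t a u : a != 0 -> dfun (t a^-1 u) = t a (dfun u).
Proof.
move=> a0; have ai : a^-1 != 0 by rewrite invr_eq0.
have hI : Ind (fbig l u) by apply: fbig_ind.
have h1 : rt (sec (diag a)) (fbig l u) 1%g = 0.
  rewrite /right_transl c1l -[sec _]c1r (ind_t _ hI a0) fbig1 //.
  by rewrite (t0 tau_rep a0) scaler0.
have [m hm] := lfun_big (ind_rt (sec (diag a)) hI) h1.
have := hm (- (m + `|v a| + `|v a|)%N%:Z); rewrite lfun_diag // bint_phi_diag //.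
set j := _ - (v a + v a); have jl : j <= l%:Z by rewrite /j; lia.
have -> : bI j (phi (fbig l u)) = Q ^ (- l%:Z) *: u.
  by rewrite -(bint_ball u jl); congr (bI _ _); apply/funext => y; rewrite phi_fbig.
pose dl : {linear V -> V} := HB.pack dfun (GRing.isLinear.Build _ _ _ _ dfun dfun_lin).
rewrite (tZ tau_rep) // scalerA -[dfun (_ *: _)]/(dl (_ *: _)) linearZ_LR /= -scalerA.
have le : - (m + `|v a| + `|v a|)%N%:Z <= - m%:Z by lia.
move=> /(_ le) /(scalerI (absC_neq0 a0)) e.
rewrite /dfun (tZ tau_rep) // e scalerA -expfzDr ?Qn0 // subrr expr0z scale1r.
by [].
Qed.

(** If D = 0, [lfun f] depends on [f 1] only, through an operator commuting with the torus, hence a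
    scalar z. As [proj f x] is [lfun (rt x f)], the projection is z; then W is 0 for z = 0 and
    everything otherwise. *)
Lemma dfun_neq0 : W <> [set 0] -> W <> Ind -> exists u, dfun u != 0.
Proof.
move=> W0 WI; apply: contrapT => nD.
have D0 u : dfun u = 0 by apply: contrapT => /eqP h; apply: nD; exists u.
have L0 f : Ind f -> f 1%g = 0 -> lfun f = 0.
  by move=> hf f1; have [m hm] := lfun_big hf f1; rewrite (hm (- m%:Z)) // D0.
pose E u := lfun (ftest l u); have tI u : Ind (ftest l u) by apply: ftest_ind.
have Elin : linear E by move=> c u u'; rewrite /E ftest_lin lfun_lin.
have LE f : Ind f -> lfun f = E (f 1%g).
  move=> hf; apply/eqP; rewrite -subr_eq0; apply/eqP.
  have hI : Ind (- 1 *: ftest l (f 1%g) + f) by apply: ind_subspace.2.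
  have e : (- 1 *: ftest l (f 1%g) + f) 1%g = 0.
    by rewrite -[LHS]/(-1 *: ftest l (f 1%g) 1%g + f 1%g) ftest1 // scaleN1r addNr.
  by have := L0 _ hI e; rewrite lfun_lin // scaleN1r addrC.
have EZ (c : C) u : E (c *: u) = c *: E u.
  have E0 : E 0 = 0.
    have /eqP := Elin 1 0 0; rewrite !scale1r addr0 -subr_eq0 opprD addNKr oppr_eq0.
    by move/eqP.
  by have := Elin c u 0; rewrite !addr0 E0 addr0.
have Et a u : a != 0 -> E (t a u) = t a (E u).
  move=> a0; apply: (scalerI (absC_neq0 a0)); rewrite -EZ.
  rewrite -(lfun_diag (tI u) a0) LE; last exact: ind_rt.
  by rewrite /right_transl c1l -[sec _]c1r (ind_t _ (tI u) a0) ftest1.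
have [z Ez] := schur n_gt0 cop mu_full iotaP hilbP tau_rep tau_genuine tau_irr tau_smooth tau_adm
  Elin Et.
have projZ f : Ind f -> proj f = z *: f.
  move=> hf; apply/funext => x; rewrite -[x]c1l -[LHS]/(rt x (proj f) 1%g) -proj_rt //.
  by rewrite -[LHS]/(lfun (rt x f)) LE ?Ez //; exact: ind_rt.
have [z0|z0] := eqVneq z 0.
  apply: W0; apply/seteqP; split=> [f hf|_ ->] /=; last exact: W_subspace.1.
  by rewrite -(proj_id hf) projZ ?z0 ?scale0r //; exact: W_ind.
apply: WI; apply/seteqP; split=> [|f hf]; first exact: W_ind.
have -> : f = z^-1 *: proj f by rewrite projZ // scalerA mulVf // scale1r.
by apply: (subspaceZ W_subspace); case: (projP hf).
Qed.

Section NonzeroIntertwiner.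
Hypothesis dn0 : exists u, dfun u != 0.
Local Notation d := (dd n).

(** D intertwines t(a^-d) with t(a^d); both being scalars, they agree. *)
Lemma dd_inv a (z z' : C) : a != 0 -> (forall u, t (a ^+ d) u = z *: u) ->
  (forall u, t (a^-1 ^+ d) u = z' *: u) -> z' = z.
Proof.
move=> a0 hz hz'; have [u du] := dn0; have ad := expf_neq0 d a0.
have := dfun_t u ad; rewrite -exprVn hz' hz.
pose dl : {linear V -> V} := HB.pack dfun (GRing.isLinear.Build _ _ _ _ dfun dfun_lin).
rewrite -[dfun (_ *: _)]/(dl (_ *: _)) linearZ_LR /= => /eqP.
by rewrite -subr_eq0 -scalerBl scaler_eq0 (negPf du) orbF subr_eq0 => /eqP.
Qed.

Lemma dd_scalar a : a != 0 -> exists2 z : C, z ^+ 2 = s (a ^+ d) (-1) &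
  forall u, t (a ^+ d) u = z *: u /\ t (a^-1 ^+ d) u = z *: u.
Proof.
move=> a0; have ai : a^-1 != 0 by rewrite invr_eq0.
have scal := t_dd_scalar n_gt0 cop mu_full iotaP hilbP tau_rep tau_genuine tau_irr tau_smooth
  tau_adm.
have [z hz] := scal a a0; have [z' hz'] := scal a^-1 ai.
have e := dd_inv a0 hz hz'; exists z; last by move=> u; rewrite hz hz' e.
have [[u u0] _] := tau_irr; have ad := expf_neq0 d a0.
have := tV n_gt0 cop mu_full iotaP hilbP tau_rep tau_genuine u ad.
rewrite -exprVn hz' e hz scalerA -expr2 => /eqP.
by rewrite -subr_eq0 -scalerBl scaler_eq0 (negPf u0) orbF subr_eq0 => /eqP.
Qed.

Lemma dd_odd : odd n -> d = n.
Proof. by move=> on; rewrite /dd (eqP (_ : coprime n 2)) ?divn1 // coprimen2. Qed.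

(** Here n = 2d, and t(c^d)^2 is computed twice: as z^2 = (c^d, -1) and as (c^d, c^d) t(c^n). The
    two symbols agree. *)
Lemma npow_even c u : ~~ odd n -> c != 0 -> t (c ^+ n) u = u.
Proof.
move=> en c0; have [z z2 hz] := dd_scalar c0; have cd := expf_neq0 d c0.
have dE : n = (d + d)%N.
  rewrite /dd (gcdn_idPr _); last by rewrite dvdn2.
  by rewrite addnn -muln2 divnK // dvdn2.
have := tM n_gt0 mu_full hilbP tau_rep tau_genuine u cd cd.
rewrite !(hz _).1 scalerA -expr2 z2 (hs_self n_gt0 cop mu_full iota hilbP cd) -exprD -dE.
by move/(scalerI (hs_neq0 n_gt0 iotaP hilb _ _)).
Qed.

Lemma npow_sq c : odd n -> c != 0 -> exists2 z : C, z ^+ 2 = 1 & forall u, t (c ^+ n) u = z *: u.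
Proof.
move=> on c0; have [z z2 hz] := dd_scalar c0; exists z.
  by rewrite z2 (hsN1_odd n_gt0 mu_full iotaP hilbP) // expf_neq0.
by move=> u; rewrite -(congr1 (fun i => c ^+ i) (dd_odd on)) (hz u).1.
Qed.

(** By [dfun_t] the kernel of D is stable under the torus. *)
Lemma dfun_inj u : dfun u = 0 -> u = 0.
Proof.
move=> du; apply: contrapT => /eqP u0; have [u1] := dn0; case/eqP.
pose dl : {linear V -> V} := HB.pack dfun (GRing.isLinear.Build _ _ _ _ dfun dfun_lin).
apply: (irr_subspace n_gt0 mu_full hilbP tau_rep tau_genuine tau_irr (X := [set u | dfun u = 0])).
- split; first exact: (linear0 dl).
  by move=> c v1 v2 /= h1 h2; rewrite dfun_lin h1 h2 scaler0 addr0.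
- move=> a v1 a0 /= h1; have ai : a^-1 != 0 by rewrite invr_eq0.
  by have := dfun_t v1 ai; rewrite invrK h1 (t0 tau_rep ai).
- by exists u.
Qed.

(** With a = w^-d and f0 = [ftest l u], the translate of f0 by [diag a] minus |a| z f0 vanishes at 1
    and is killed by [lfun], so its integral is 0 as D is injective. The translate brings in the
    integral of phi f0 over P^(j + 2d), so the 2d shells in between contribute 0. *)
Lemma sum_psi u : exists m : nat, forall j, j <= - m%:Z ->
  \sum_(i < d + d) aI (j + i%:Z) (psi u) = 0.
Proof.
pose a := w^-1 ^+ d; have wi : w^-1 != 0 by rewrite invr_eq0.
have a0 : a != 0 by rewrite expf_neq0.
have [z z2 hz] := dd_scalar w0.
have z0 : z != 0.
  apply/eqP => e; move: z2; rewrite e expr0n => /eqP.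
  by rewrite eq_sym (negPf (hs_neq0 n_gt0 iotaP hilb _ _)).
have va : v a = - d%:Z by rewrite pvalX // pvalV // w1 mulN1r.
have ta u' : t a u' = z *: u' by rewrite (hz u').2.
have tai u' : t a^-1 u' = z *: u' by rewrite /a exprVn invrK (hz u').1.
pose f0 := ftest l u; have h0 : Ind f0 by apply: ftest_ind.
have h1 : Ind (rt (sec (diag a)) f0) by apply: ind_rt.
pose f1 := - (absC a * z) *: f0 + rt (sec (diag a)) f0.
have hf1 : Ind f1 by apply: ind_subspace.2.
have f11 : f1 1%g = 0.
  rewrite /f1 -[LHS]/(- (absC a * z) *: f0 1%g + rt (sec (diag a)) f0 1%g).
  rewrite /right_transl c1l -[sec _]c1r (ind_t _ h0 a0) /f0 ftest1 // ta.
  by rewrite scalerA scaleNr addNr.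
have Lf1 : lfun f1 = 0 by rewrite lfun_lin // lfun_diag // ta scalerA scaleNr addNr.
have lev : ind_level l f0 by split=> // k x; apply: ftest_inv.
have [m hm] := lfun_big hf1 f11; exists (m + l + d + d)%N => j hj.
have := hm j; rewrite Lf1 => /(_ _)/esym/dfun_inj; rewrite bint_phi_linear // bint_phi_diag //
  tai va.
have -> : j - (- d%:Z - d%:Z) = j + (d + d)%N%:Z by rewrite PoszD; ring.
rewrite scalerA scaleNr addrC => e; have {}e : bI (j + (d + d)%N) (phi f0) = bI j (phi f0).
  apply: (scalerI (mulf_neq0 (absC_neq0 a0) z0)); apply/eqP; rewrite -subr_eq0 e //; lia.
have := bint_shells (d + d) (phi_lcst j h0); rewrite e -[LHS]add0r => /addIr/esym e'.
apply: etrans e'; apply: eq_bigr => i _; apply: (aint_eq w0 w1); first exact: psi_lcst.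
move=> y y0 vy; rewrite (phi_psi lev y0) /f0 ?ftest1 //.
by rewrite vy; have := ltn_ord i; lia.
Qed.

Lemma lcst_shellD (E : lmodType C) j (f f' : F -> E) : lcst_shell j f -> lcst_shell j f' ->
  lcst_shell j (fun y => f y + f' y).
Proof.
move=> [i hi] [i' hi']; exists (Num.max i i') => x y x0 vx y0 vy hxy.
by rewrite (hi x y) ?(hi' x y) //; apply: vge_le hxy _; lia.
Qed.

Lemma aintD (E : lmodType C) j (f f' : F -> E) : lcst_shell j f -> lcst_shell j f' ->
  aI j (fun y => f y + f' y) = aI j f + aI j f'.
Proof.
move=> hf hf'; rewrite /aint -(bintD w0 w1 (lcst_shellP w0 w1 hf) (lcst_shellP w0 w1 hf')).
by congr (bI j _); apply/funext => y; case: ifP; rewrite ?addr0.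
Qed.

Lemma aint_sum (E : lmodType C) j N (f : nat -> F -> E) : (forall i, lcst_shell j (f i)) ->
  lcst_shell j (fun y => \sum_(i < N) f i y) /\
  aI j (fun y => \sum_(i < N) f i y) = \sum_(i < N) aI j (f i).
Proof.
move=> hf; elim: N => [|N [IH1 IH2]].
  have e : (fun y => \sum_(i < 0) f i y) = (fun=> 0) by apply/funext => y; rewrite big_ord0.
  rewrite e big_ord0; split; last exact: aint0.
  by exists 0.
have e : (fun y => \sum_(i < N.+1) f i y) = (fun y => \sum_(i < N) f i y + f N y).
  by apply/funext => y; rewrite big_ord_recr.
rewrite e; split; first exact: lcst_shellD.
by rewrite aintD // IH2 big_ord_recr.
Qed.

(** Scaling by w^-k brings the shell to the units, where inversion turns [psi] into [hecke]; the
    absolute value cancels the Jacobian. *)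
Lemma aint_psiE u (k : nat) : aI (- k%:Z) (psi u) = aI 0 (fun y => hecke u (w ^+ k * y)).
Proof.
have wk : w ^- k != 0 by rewrite invr_eq0 expf_neq0.
have wk' : w ^+ k != 0 by rewrite expf_neq0.
have vk : v (w ^- k) = - k%:Z by rewrite pvalV // pvalX // w1 mul1r.
have [m m0 hm] := hecke_close u.
have lc : lcst_shell 0 (fun y => hecke u (w ^+ k * y)).
  by apply: (@lcst_shell_close _ _ m) => y b y0 hb; rewrite mulrA hm // mulf_neq0.
have := aint_scale w0 w1 (m := 0) wk (psi_lcst u _); rewrite vk add0r => e.
apply: (scalerI (expfz_neq0 (- k%:Z) Qn0)); rewrite -{}e.
have := aint_inv w0 w1 (m := 0) (f := fun y => hecke u (w ^+ k * y)).
rewrite oppr0 expr0z scale1r => <- //; rewrite -aintZ; last first.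
  apply: (@lcst_shell_close _ _ m) => y b y0 hb.
  have bU : fin_unit b by apply: one_unit; apply: vge_le hb _; lia.
  have [b0 _] := bU; rewrite invfM mulrA hm // ?mulf_neq0 ?invr_eq0 //.
  have -> : b^-1 - 1 = - (b - 1) * b^-1 by field.
  by apply: (vgeM (vgeN hb) (fin_unit_vge (fin_unitV bU))); lia.
apply: (aint_eq w0 w1).
  have [m' _ hm'] := psi_close u; apply: (@lcst_shell_close _ _ m') => y b y0 hb.
  by rewrite mulrA hm' // mulf_neq0.
move=> y y0 vy; rewrite psiE ?mulf_neq0 // invfM invrK; congr (_ *: _).
by rewrite absCM // [absC y]absC_unit // mulr1 -absCV // invrK absCE // pvalX // w1 mul1r.
Qed.

(** The integrals A k of [hecke u (w^k y)] over the units have period n, and 2d is a multiple of n,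
    so [sum_psi] makes the sum of A k over k < n vanish. Summing over g^j y as well turns the
    integrand into the class sum, which does not depend on y and must then be 0, against
    [class_sum_t_neq0]. *)
Lemma class_sum_contra : (forall c u, c != 0 -> t (c ^+ n) u = u) -> False.
Proof.
move=> tn; have [g gU gP] := unit_gen F; have [g0 vg] := gU.
have [u] := class_sum_t_neq0 n_gt0 cop mu_full iotaP hilbP tau_rep tau_genuine tau_irr w0 w1 gU
  gP tn.
case/eqP; rewrite -[LHS]/(class_sum n w g (hecke u)); set cs := class_sum _ _ _ _.
have [m0 m00 hm0] := hecke_close u.
have inv : npow_invariant n (hecke u).
  move=> x c x0 c0; have cn := expf_neq0 n c0.
  rewrite /hecke (hsMl n_gt0 mu_full iotaP hilbP x0 cn (N1_neq0 F)).
  rewrite (hs_npow_l n_gt0 mu_full iotaP hilbP c0 (N1_neq0 F)) mulr1.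
  by rewrite (t_npow_mul n_gt0 mu_full iotaP hilbP tau_rep tau_genuine _ x0 c0) tn.
have shl b : b != 0 -> lcst_shell 0 (fun y => hecke u (b * y)).
  move=> b0; apply: (@lcst_shell_close _ _ m0) => y b1 y0 hb.
  by rewrite mulrA hm0 // mulf_neq0.
pose A (k : nat) := aI 0 (fun y => hecke u (w ^+ k * y)).
have AN (k : nat) : A (k + n)%N = A k.
  apply: (aint_eq w0 w1); first by apply: shl; rewrite expf_neq0.
  by move=> y y0 _; rewrite exprD mulrAC inv // mulf_neq0 ?expf_neq0.
have sumA (r : nat) : \sum_(i < n * r) A i = (\sum_(i < n) A i) *+ r.
  elim: r => [|r IHr]; first by rewrite muln0 big_ord0.
  rewrite mulnS addnC big_split_ord /= IHr mulrS addrC; congr (_ + _).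
  by rewrite -[RHS](sum_shift (n * r)%N AN); apply: eq_bigr => i _; rewrite addnC.
have [rd rdE] : exists r, (d + d)%N = (n * r)%N.
  by have [/dvdnP[r e] _] := dd_double n_gt0; exists r; rewrite addnn -muln2 e mulnC.
have rd0 : (0 < rd)%N.
  have [_ d0] := dd_double n_gt0; case: rd rdE => //; rewrite muln0; lia.
have sum0 : \sum_(i < n) A i = 0.
  have [m hm] := sum_psi u; pose K := (m + n * rd)%N.
  have := hm (- K%:Z + 1); rewrite rdE => h.
  have {}h : \sum_(i < n * rd) aI (- K%:Z + 1 + i%:Z) (psi u) = 0.
    apply: h; rewrite /K; have : (0 < n * rd)%N by rewrite muln_gt0 n_gt0.
    lia.
  have : \sum_(i < n * rd) A (i + m)%N = 0.
    rewrite -[RHS]h (reindex_inj rev_ord_inj); apply: eq_bigr => i _ /=.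
    rewrite /A -aint_psiE; congr (aI _ _); have := ltn_ord i; rewrite /K; lia.
  rewrite -rdE.
  have AN' (k : nat) : A (k + n * rd)%N = A k.
    by elim: (rd) => [|r IHr]; rewrite ?muln0 ?addn0 // mulnS addnCA addnC AN.
  rewrite rdE (sum_shift m AN') sumA -scaler_nat => /eqP; rewrite scaler_eq0 pnatr_eq0.
  by rewrite gtn_eqF //= => /eqP.
have Aj (k j : nat) : aI 0 (fun y => hecke u (w ^+ k * g ^+ j * y)) = A k.
  have gj : g ^+ j != 0 by rewrite expf_neq0.
  have vgj : v (g ^+ j) = 0 by rewrite pvalX // vg mul0r.
  have wk : w ^+ k != 0 by rewrite expf_neq0.
  have := aint_scale w0 w1 (m := 0) (f := fun y => hecke u (w ^+ k * y)) gj.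
  rewrite /A vgj addr0 expr0z scale1r => <-; last exact: shl.
  by congr (aI _ _); apply/funext => y; rewrite mulrA.
have sh2 (i j : nat) : lcst_shell 0 (fun y => hecke u (w ^+ i * g ^+ j * y)).
  by apply: shl; rewrite mulf_neq0 ?expf_neq0.
have in1 (i : nat) := aint_sum n (sh2 i).
have in2 := aint_sum n (f := fun i y => \sum_(j < n) hecke u (w ^+ i * g ^+ j * y))
  (fun i => (in1 i).1).
have : aI 0 (fun y => \sum_(i < n) \sum_(j < n) hecke u (w ^+ i * g ^+ j * y)) = 0.
  rewrite in2.2.
  under eq_bigr => i _.
    rewrite (in1 i).2; under eq_bigr => j _ do rewrite Aj.
    rewrite sumr_const card_ord -scaler_nat; over.
  by rewrite -scaler_sumr sum0 scaler0.
rewrite (aint_eq w0 w1 (g := fun=> cs)); last 2 first.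
- exact: in2.1.
- move=> y y0 _; rewrite /cs -(class_sum_shift n_gt0 cop w0 w1 gU gP inv y0).
  by apply: eq_bigr => i _; apply: eq_bigr => j _; rewrite mulrC.
(* The units have volume 1 - q^-1, which is nonzero. *)
rewrite aint_cst oppr0 add0r expr0z => /eqP; rewrite scaler_eq0 => /orP[|/eqP->//].
rewrite subr_eq0 => /eqP e; have := Q_gt1 F R.
have : Q = 1 by have := mulVf Qn0; rewrite -[Q^-1]/(Q ^ (-1)) -e mul1r.
by move=> ->; rewrite ltxx.
Qed.

End NonzeroIntertwiner.
End Functional.

(** In each excluded case all t(c^n) would be the identity: for n even by [npow_even], for n odd if
    -1 is never the scalar of some t(c^n). *)
Lemma quadratic_of_subrep : W <> [set 0] -> W <> Ind ->
  [/\ odd n, (forall c, c != 0 -> exists2 z : C, z ^+ 2 = 1 & forall u, t (c ^+ n) u = z *: u) &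
    exists2 c, c != 0 & forall u, t (c ^+ n) u = - u].
Proof.
move=> W0 WI; have [l l0 tl] := t_small n_gt0 cop mu_full iotaP hilbP tau_rep tau_genuine tau_irr
  tau_smooth.
have dn0 := dfun_neq0 l0 tl W0 WI.
have contra := class_sum_contra l0 tl dn0.
have on : odd n by apply: contrapT => /negP en; apply: contra => c u; apply: (npow_even l0 tl dn0).
have sq c (c0 : c != 0) := npow_sq l0 tl dn0 on c0; split=> //.
apply: contrapT => nc; apply: contra => c u c0; have [z z2 hz] := sq c c0.
have /eqP := z2; rewrite -subr_eq0 subr_sqr_1 mulf_eq0 subr_eq0 addr_eq0 => /orP[] /eqP zE.
  by rewrite hz zE scale1r.
by case: nc; exists c => // u'; rewrite hz zE scaleN1r.
Qed.

End Projection.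
End Unitary.
End Uniformizer.

(** * The central character *)

Lemma npow_center c : c != 0 -> center_of (torus hilb) (sec (diag (c ^+ n))).
Proof.
move=> c0; have cn := expf_neq0 n c0; split; first exact: torus_diag.
move=> x /torusP[a a0]; case: x => [_ e] /= ->; rewrite (cover_cen n_gt0 mu_full hilbP).
have h1 : hilb a (c ^+ n) = 1%g by apply: val_inj; apply: (hilb_npow_r n_gt0 mu_full hilbP).
have h2 : hilb (c ^+ n) a = 1%g by apply: val_inj; apply: (hilb_npow_l n_gt0 mu_full hilbP).
rewrite cen_left -[RHS]cA (sec_diagM n_gt0 mu_full hilbP cn a0).
by rewrite (sec_diagM n_gt0 mu_full hilbP a0 cn) h1 h2 mulrC.
Qed.

(** Central elements act by scalars by Schur's lemma; the value 0 is taken off the center. *)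
Lemma central_character_ex : exists chi, central_character (torus hilb) tau chi.
Proof.
have /boolp.choice[chi chiP] (z : cover) : exists c : C, center_of (torus hilb) z ->
    forall u, tau z u = c *: u.
  have [hz|nz] := pselect (center_of (torus hilb) z); last by exists 0.
  have [tz comm] := hz; have [tlin _ tmul] := tau_rep.
  suff [c hc] : exists c : C, forall u, tau z u = c *: u by exists c.
  apply: (schur n_gt0 cop mu_full iotaP hilbP tau_rep tau_genuine tau_irr tau_smooth tau_adm).
    exact: tlin.
  move=> a u a0; have ta := torus_diag hilb a0.
  by rewrite -[t a u]/(tau _ u) -[t a _]/(tau _ _) -!tmul // comm.
by exists chi => z hz u; apply: chiP.
Qed.

(** For n odd, d = n and chi at [sec (diag (c ^+ n))] is the scalar of t(c^n). Multiplicativity on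
    H^d(F) comes from the triviality of the symbol on n-th powers. *)
Lemma quadraticP chi : odd n -> central_character (torus hilb) tau chi ->
  nontrivial_quadratic (Hpow (dd n)) (fun h => chi (sec h)) <->
  (forall c, c != 0 -> exists2 z : C, z ^+ 2 = 1 & forall u, t (c ^+ n) u = z *: u) /\
  (exists2 c, c != 0 & forall u, t (c ^+ n) u = - u).
Proof.
move=> on chiP.
have tE c u : c != 0 -> t (c ^+ n) u = chi (sec (diag (c ^+ n))) *: u.
  by move=> c0; apply: chiP; apply: npow_center.
have HP g : Hpow (dd n) g <-> exists2 c, c != 0 & g = diag (c ^+ n).
  have e c : c != 0 -> sl_val (diag (c ^+ n)) = mat2 (c ^+ dd n) 0 0 (c ^- dd n).
    by move=> c0; rewrite diagE ?expf_neq0 // (congr1 (fun i => c ^+ i) (dd_odd on)).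
  by split=> -[c c0 gE]; exists c => //; [apply: val_inj; rewrite /= gE e|rewrite gE e].
have [[u0 un0] _] := tau_irr.
have scal (z z' : C) : z *: u0 = z' *: u0 -> z = z'.
  by move=> /eqP; rewrite -subr_eq0 -scalerBl scaler_eq0 (negPf un0) orbF subr_eq0 => /eqP.
split=> [[_ sq [g hg g1]]|[sq [c c0 hc]]].
  split=> [c c0|].
    by exists (chi (sec (diag (c ^+ n)))); [apply: sq; apply/HP; exists c|move=> u; apply: tE].
  have := sq g hg; have [c c0 gE] := (HP g).1 hg.
  move=> /eqP; rewrite -subr_eq0 subr_sqr_1 mulf_eq0 subr_eq0 (negPf g1) addr_eq0 => /eqP zE.
  by exists c => // u; rewrite tE // -gE zE scaleN1r.
split.
- move=> _ _ /HP[a a0 ->] /HP[b b0 ->]; have an := expf_neq0 n a0; have bn := expf_neq0 n b0.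
  rewrite diagM // -exprMn; apply: scal; rewrite -tE ?mulf_neq0 // -scalerA -!tE // exprMn.
  have := tM n_gt0 mu_full hilbP tau_rep tau_genuine u0 an bn.
  by rewrite (hs_npow_l n_gt0 mu_full iotaP hilbP b0 an) scale1r => <-.
- move=> _ /HP[a a0 ->]; have [z z2 hz] := sq a a0.
  by have -> : chi (sec (diag (a ^+ n))) = z by apply: scal; rewrite -tE.
- exists (diag (c ^+ n)); first by apply/HP; exists c.
  apply/eqP => e; have := hc u0; rewrite tE // e scale1r => /eqP.
  rewrite -addr_eq0 -mulr2n -scaler_nat scaler_eq0 pnatr_eq0 /=.
  by rewrite (negPf un0).
Qed.

End Induced.

Theorem theorem6p2 (R : realType) (p n : nat) (F : padicField p)
    (n_gt0 : (0 < n)%N) (coprime_pn : coprime p n)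
    (mu_full : exists z : F, n.-primitive_root z)
    (iota : mu F n -> R[i]) (iotaP : identification iota)
    (hilb : F -> F -> mu F n) (hilbP : is_hilbert_symbol hilb)
    (V : lmodType R[i]) (tau : cover_of hilb -> V -> V)
    (tau_rep : representation (torus hilb) tau)
    (tau_genuine : genuine tau iota)
    (tau_smooth : smooth (torus hilb) tau)
    (tau_admissible : admissible (torus hilb) tau)
    (tau_irreducible : irreducible (torus hilb) tau)
    (tau_unitary : unitary (torus hilb) tau) :
  reducible [set: cover_of hilb] (right_transl (V := V)) (induced tau)
  <->
  odd n /\
  exists2 chi : cover_of hilb -> R[i], central_character (torus hilb) tau chi &
    nontrivial_quadratic (Hpow (n %/ gcdn n 2)) (fun h => chi (sec hilb h)).
Proof.
have [w w0 w1] := unif_ex F; split=> [[W [Wsub WI W0 WT]]|[on [chi chiP quad]]].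
  have [B BU] := tau_unitary.
  have [on sq ex] := quadratic_of_subrep n_gt0 coprime_pn mu_full iotaP hilbP tau_rep tau_genuine
    tau_irreducible tau_smooth tau_admissible w0 w1 BU Wsub WI W0 WT.
  split=> //; have [chi chiP] := central_character_ex n_gt0 coprime_pn mu_full iotaP hilbP tau_rep
    tau_genuine tau_irreducible tau_smooth tau_admissible.
  exists chi => //.
  exact: ((quadraticP n_gt0 coprime_pn mu_full iotaP hilbP tau_rep tau_genuine tau_irreducible on chiP).2
    (conj sq ex)).
have [sq [c c0 hc]] := (quadraticP n_gt0 coprime_pn mu_full iotaP hilbP tau_rep tau_genuine
  tau_irreducible on chiP).1 quad.
have [g gU gP] := unit_gen F.
have [L [Llin Ln0 Lt]] := intertwiner_ex n_gt0 coprime_pn mu_full iotaP hilbP tau_rep tau_genuine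
  tau_irreducible w0 w1 gU gP on sq.
exact: (reducible_of_intertwiner n_gt0 coprime_pn mu_full iotaP hilbP tau_rep tau_genuine
  tau_irreducible tau_smooth tau_admissible w0 w1 sq c0 hc Llin Ln0 Lt).
Qed.
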